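(* Let $(X_t)_{t\ge 0}$ be a regular jump Lévy process in $\mathbf{R}^d$, with transition densities $p(t,x)$ and $t_b>0$ a time such that $p(t_b,\cdot)$ is strictly positive and bounded on $\mathbf{R}^d$, and let $V$ be a confining $X$-Kato class potential with Feynman--Kac semigroup $\{T_t: t\ge0\}$ (all terms as defined in the context). (1) For $\{T_t: t\ge0\}$ the properties satisfy: AIUC $\Longleftrightarrow$ AGSD, and IUC $\Longrightarrow$ GSD, in the sense that $t_0$-IUC implies $2t_0$-GSD for every $t_0>0$, and $t_0$-GSD implies $2t_0$-IUC whenever $t_0\ge t_b$. (2) If, moreover, for every $t>0$ there is a constant $C_4=C_4(X,t)$ with $p(t,x)\le C_4$ for all $x\in\mathbf{R}^d$, then also GSD $\Longrightarrow$ IUC.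
   Context: Conventions. $(X_t)_{t\ge0}$ is a Lévy process in $\mathbf{R}^d$, $d\ge1$; $\mathbf{P}^x,\mathbf{E}^x$ refer to the process started at $x$. $B(x,r)$ is the open ball; $\mathbf{1}$ is the function identically $1$. $C, C_i$ denote positive constants; $C(X,a,\dots)$ depends only on the process (and the dimension $d$) and on the listed parameters. $f\asymp Cg$ means $C^{-1}g\le f\le Cg$. Regular jump Lévy process: a Lévy process satisfying (A1)--(A3). (A1) $(X_t)$ is symmetric, its Lévy measure is absolutely continuous with a strictly positive density $\nu$, and: (1) for every $0<r\le 1/2$ there is $C_1=C_1(X,r)\ge1$ with $\nu(x)\asymp C_1\nu(y)$ for $r\le|y|\le|x|\le|y|+1$; (2) there is $C_2=C_2(X)\ge1$ with $\nu(x)\le C_2\nu(y)$ for $1/2\le|y|\le|x|$; (3) there is $C_3=C_3(X)\ge1$ with $\int_{|z-x|>1/2,\,|z-y|>1/2}\nu(x-z)\nu(z-y)\,dz\le C_3\nu(x-y)$ for $|y-x|\ge1$. (A2) $(X_t)$ is strong Feller, equivalently it has transition densities $p(t,x,y)=p(t,y-x)$ for $t>0$; moreover there are $t_b>0$ and a constant $C(X,t_b)$ with $0<p(t_b,x)\le C(X,t_b)$ for all $x\in\mathbf{R}^d$. (A3) For all $0<p<q<R\le1$, $\sup_{x\in B(0,p)}\sup_{y\in B(0,q)^c}G_{B(0,R)}(x,y)<\infty$, where for a bounded open set $D$, $G_D(x,y)=\int_0^\infty p_D(t,x,y)\,dt$ for $x,y\in D$ (and $0$ otherwise), and $p_D$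 is the transition density of the process killed upon exiting $D$. Potentials. A Borel function $V:\mathbf{R}^d\to\mathbf{R}$ belongs to $\mathcal{K}^X$ if $\lim_{t\to0}\sup_x\mathbf{E}^x[\int_0^t|V(X_s)|ds]=0$, and to $\mathcal{K}^X_{\mathrm{loc}}$ if $V\mathbf{1}_B\in\mathcal{K}^X$ for every ball $B$. $V$ is an $X$-Kato class potential if $V_-\in\mathcal{K}^X$ and $V_+\in\mathcal{K}^X_{\mathrm{loc}}$. It is confining if also $V(x)\to\infty$ as $|x|\to\infty$. Feynman--Kac semigroup: $T_tf(x)=\mathbf{E}^x[e^{-\int_0^tV(X_s)ds}f(X_t)]$, $t>0$. Whenever $(X_t)$ is a regular jump Lévy process and $V$ is a confining $X$-Kato class potential, $\{T_t\}$ is a strongly continuous semigroup of symmetric compact operators on $L^2(\mathbf{R}^d)$; there is an orthonormal basis $\{\varphi_n\}_{n\ge0}$ of $L^2(\mathbf{R}^d)$ with $T_t\varphi_n=e^{-\lambda_nt}\varphi_n$, where $\lambda_0<\lambda_1\le\lambda_2\le\cdots\to\infty$; each $\varphi_n$ is bounded and continuous, and the ground state $\varphi_0$ is chosen strictly positive. Intrinsic semigroup: $\widetilde T_tf(x)=\frac{e^{\lambda_0t}}{\varphi_0(x)}T_t(\varphi_0f)(x)$ on $L^2(\mathbf{R}^d,\varphi_0^2dx)$. $\{T_t\}$ is IUC if $\widetilde T_t$ is bounded from $L^2(\mathbf{R}^d,\varphi_0^2dx)$ to $L^\infty(\mathbf{R}^d)$ for every $t>0$; it is $t_0$-IUC if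 this holds for $t=t_0$ (hence for all $t\ge t_0$); it is AIUC if it is $t_0$-IUC for some $t_0>0$. $\{T_t\}$ is GSD (ground state dominated) if for every $t>0$ there is $C_{12}=C_{12}(X,V,t)$ with $T_t\mathbf{1}(x)\le C_{12}\varphi_0(x)$ for all $x\in\mathbf{R}^d$; it is $t_0$-GSD if this holds for $t=t_0$ (hence for all $t\ge t_0$); it is AGSD if it is $t_0$-GSD for some $t_0>0$. *)

(* Defs.v *)
From HB Require Import structures.
From mathcomp Require Import all_boot all_order all_algebra.
From mathcomp Require Import all_classical all_reals all_analysis.

Set Implicit Arguments.
Unset Strict Implicit.
Unset Printing Implicit Defensive.

Import Order.TTheory GRing.Theory Num.Theory.
Import numFieldNormedType.Exports.

Local Open Scope classical_set_scope.
Local Open Scope ring_scope.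

(* Euclidean space R^n is 'rV[R]_n. Its library norm `|x| is
   the sup norm, so the Euclidean norm is introduced separately; both induce the
   library topology of 'rV[R]_n. *)

Section borel_rV.
Context {R : realType} {n : nat}.

Definition coord_rV (i : 'I_n) (x : 'rV[R]_n) : R := x 0 i.

Let coors : 'I_n -> 'rV[R]_n -> measurableTypeR R := coord_rV.

Let rV_set0 : g_sigma_preimage coors set0.
Proof. exact: sigma_algebra0. Qed.

Let rV_setC A : g_sigma_preimage coors A -> g_sigma_preimage coors (~` A).
Proof. exact: sigma_algebraC. Qed.

Let rV_bigcup (F : _^nat) : (forall i, g_sigma_preimage coors (F i)) ->
  g_sigma_preimage coors (\bigcup_i (F i)).
Proof. exact: sigma_algebra_bigcup. Qed.

(* The product sigma-algebra, as for n.-tuple in the library: since R is second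
   countable it is the Borel sigma-algebra of 'rV[R]_n. *)
HB.instance Definition _ := @isMeasurable.Build
  (measure_tuple_display default_measure_display)
  'rV[R]_n (g_sigma_preimage coors) rV_set0 rV_setC rV_bigcup.

End borel_rV.


Section lebesgue_rV.
Context (R : realType).

Lemma measurable_coord_rV n (i : 'I_n) :
  measurable_fun [set: 'rV[R]_n] (coord_rV i).
Proof.
move=> _ Y mY; rewrite setTI; apply: sub_sigma_algebra => /=.
rewrite -bigcup_seq/=; exists i => /=; first by rewrite mem_index_enum.
by exists Y => //; rewrite setTI.
Qed.

Lemma measurable_fun_rV d (T : measurableType d) n (f : T -> 'rV[R]_n) :
  (forall i, measurable_fun [set: T] (fun x => f x 0 i)) ->
  measurable_fun [set: T] f.
Proof.
move=> mf; apply: (@measurability _ _ _ _ _ _ (\big[setU/set0]_(i < n)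
  preimage_set_system setT (@coord_rV R n i) measurable)) => //.
move=> _ [B + <-]; rewrite -bigcup_seq => -[i _ [C mC <-]].
by rewrite setTI; exact: mf.
Qed.

Definition cons_rV n (z : R * 'rV[R]_n) : 'rV[R]_n.+1 := row_mx z.1%:M z.2.

Definition uncons_rV n (x : 'rV[R]_n.+1) : R * 'rV[R]_n :=
  (x 0 ord0, \row_j x 0 (lift ord0 j)).

Lemma cons_rVK n : cancel (@cons_rV n) (@uncons_rV n).
Proof.
case=> a v; rewrite /uncons_rV /cons_rV /=; congr pair.
  by rewrite mxE; case: splitP => // j _; rewrite ord1 mxE mulr1n.
apply/rowP => j; rewrite !mxE; case: splitP => [k|k [jk]]; first by rewrite ord1.
by congr (v _ _); apply/val_inj; case: jk.
Qed.

Lemma measurable_cons_rV n : measurable_fun [set: R * 'rV[R]_n] (@cons_rV n).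
Proof.
apply: measurable_fun_rV => i.
rewrite /cons_rV; under eq_fun do rewrite mxE.
case: (fintype.split (i : 'I_(1 + n))) => j.
  by rewrite ord1; under eq_fun do rewrite mxE mulr1n; exact: measurable_fst.
apply: (@measurableT_comp _ _ _ _ _ _ (coord_rV j)) => //.
exact: measurable_coord_rV.
Qed.

Lemma measurable_uncons_rV n :
  measurable_fun [set: 'rV[R]_n.+1] (@uncons_rV n).
Proof.
apply: measurable_fun_pair; first exact: measurable_coord_rV.
apply: measurable_fun_rV => i; under eq_fun do rewrite mxE.
exact: measurable_coord_rV.
Qed.

Section cons_measure.
Local Open Scope ereal_scope.
Context n (mu : {sigma_finite_measure set 'rV[R]_n -> \bar R}).

Definition cons_measure : set 'rV[R]_n.+1 -> \bar R :=
  pushforward (@lebesgue_measure R \x mu) (@cons_rV n).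

Let cons0 : cons_measure set0 = 0.
Proof. by rewrite /cons_measure /pushforward preimage_set0 measure0. Qed.

Let cons_ge0 A : 0 <= cons_measure A.
Proof.
rewrite /cons_measure /pushforward.
exact: (measure_ge0 (lebesgue_measure \x mu)).
Qed.

Let cons_sigma_additive : semi_sigma_additive cons_measure.
Proof.
move=> F mF tF mUF; rewrite /cons_measure /pushforward preimage_bigcup.
apply: measure_semi_sigma_additive.
- by move=> k; rewrite -[X in measurable X]setTI; exact: measurable_cons_rV.
- apply/trivIsetP => /= i j _ _ ij; rewrite -preimage_setI.
  by move/trivIsetP : tF => /(_ _ _ _ _ ij) ->//; rewrite preimage_set0.
- rewrite -preimage_bigcup -[X in measurable X]setTI.
  exact: measurable_cons_rV.
Qed.

HB.instance Definition _ := isMeasure.Build _ _ _ cons_measure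
  cons0 cons_ge0 cons_sigma_additive.

Let cons_sigma_finite : sigma_finite setT cons_measure.
Proof.
have /sigma_finiteP[F [TF ndF Foo]] := sigma_finiteT (@lebesgue_measure R).
have /sigma_finiteP[G [TG ndG Goo]] := sigma_finiteT mu.
exists (fun k => @uncons_rV n @^-1` (F k `*` G k)).
  apply/esym; rewrite -subTset => x _ /=.
  have [i _ Fi] : (\bigcup_k F k) (uncons_rV x).1 by rewrite -TF.
  have [j _ Gj] : (\bigcup_k G k) (uncons_rV x).2 by rewrite -TG.
  exists (maxn i j) => //; split.
  - by move: Fi; exact/subsetPset/ndF/leq_maxl.
  - by move: Gj; exact/subsetPset/ndG/leq_maxr.
move=> k; have [mF Fk] := Foo k; have [mG Gk] := Goo k; split.
  rewrite -[X in measurable X]setTI; apply: measurable_uncons_rV => //.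
  exact: measurableX.
rewrite /cons_measure /pushforward -comp_preimage.
rewrite (_ : _ \o _ = id); last by apply/funext => z; exact: cons_rVK.
rewrite preimage_id.
by rewrite product_measure1E// lte_mul_pinfty// ge0_fin_numE.
Qed.

HB.instance Definition _ :=
  Measure_isSigmaFinite.Build _ _ _ cons_measure cons_sigma_finite.

End cons_measure.

(* Lebesgue measure on R^d as an iterated product; on R^0 it is a point mass. *)
Fixpoint lebesgue_rV d : {sigma_finite_measure set 'rV[R]_d -> \bar R} :=
  match d return {sigma_finite_measure set 'rV[R]_d -> \bar R} with
  | 0 => \d_(0 : 'rV[R]_0)
  | d'.+1 => cons_measure (lebesgue_rV d')
  end.

End lebesgue_rV.
Arguments lebesgue_rV {R d}.

Section euclidean.
Context {R : realType} {d : nat}.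
Local Notation E := 'rV[R]_d.

Definition dotp (x y : E) : R := \sum_i x 0 i * y 0 i.

Definition enorm (x : E) : R := Num.sqrt (dotp x x).

Definition eball (x : E) (r : R) : set E := [set y | enorm (y - x) < r].

End euclidean.

Section levy.
Context {R : realType} {d : nat} {dO : measure_display} {Omega : measurableType dO}.
Variable P : probability Omega R.
Local Notation E := 'rV[R]_d.
Local Notation leb := (@lebesgue_rV R d).

Definition mutually_independent n (Y : 'I_n -> Omega -> E) : Prop :=
  forall A : 'I_n -> set E, (forall i, measurable (A i)) ->
    P [set w | forall i, A i (Y i w)] = (\prod_(i < n) P (Y i @^-1` A i))%E.

Variable X : R -> {RV P >-> E}.

(* The index of X is meant to range over the nonnegative reals: no value X t
   with t < 0 is ever constrained or used. *)
Record levy_process : Prop := LevyProcess {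
  levy_start : {ae P, forall w, X 0 w = 0} ;
  levy_independent : forall n (t : nat -> R),
    0 <= t 0%N -> (forall i, t i < t i.+1) ->
    mutually_independent (fun (i : 'I_n) w => X (t i.+1) w - X (t i) w) ;
  levy_stationary : forall s h, 0 <= s -> 0 <= h ->
    forall A : set E, measurable A ->
      P [set w | A (X (s + h) w - X s w)] = P (X h @^-1` A) ;
  levy_right_continuous : forall w t, 0 <= t -> X s w @[s --> t^'+] --> X t w ;
  levy_left_limits : forall w t, 0 < t -> cvg (X s w @[s --> t^'-]) }.

Definition symmetric_process : Prop :=
  forall t, 0 <= t -> forall A : set E, measurable A ->
    P [set w | A (- X t w)] = P (X t @^-1` A).

(* E^x and P^x: the process started at x is x + X, since X starts at 0.
   Exit events are in general measurable only for the completion of P, so P^x is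
   taken with the outer measure of P, which is the completed probability. *)
Definition Ex (x : E) (F : (R -> E) -> \bar R) : \bar R :=
  (\int[P]_w F (fun t => (x + X t w)%R))%E.

Definition Px (x : E) (A : set (R -> E)) : \bar R :=
  mu_ext P [set w | A (fun t => x + X t w)].

(* (b, A, N) is a Levy triplet of X: E exp(i xi.X_t) = exp(t eta(xi)) with
   eta(xi) = i b.xi - xi.A xi / 2
             + \int (exp(i xi.z) - 1 - i xi.z 1_{|z| < 1}) N(dz),
   written through the real and imaginary parts of eta. *)
Section triplet.
Variables (b : E) (A : 'M[R]_d) (N : {measure set E -> \bar R}).

Definition Re_eta (xi : E) : R :=
  - (dotp xi (xi *m A) / 2) + (\int[N]_z (cos (dotp xi z) - 1))%R.

Definition Im_eta (xi : E) : R :=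
  dotp b xi
  + (\int[N]_z (sin (dotp xi z) - dotp xi z * \1_(eball 0 1) z))%R.

Record levy_triplet : Prop := LevyTriplet {
  triplet_sym : A^T = A ;
  triplet_psd : forall xi, 0 <= dotp xi (xi *m A) ;
  triplet_0 : N [set 0] = 0%E ;
  triplet_fin : (\int[N]_z (Num.min 1 (enorm z ^+ 2))%:E < +oo)%E ;
  triplet_cos : forall t, 0 <= t -> forall xi,
    (\int[P]_w (cos (dotp xi (X t w)))%:E
      = (expR (t * Re_eta xi) * cos (t * Im_eta xi))%:E)%E ;
  triplet_sin : forall t, 0 <= t -> forall xi,
    (\int[P]_w (sin (dotp xi (X t w)))%:E
      = (expR (t * Re_eta xi) * sin (t * Im_eta xi))%:E)%E }.

End triplet.

Definition levy_measure (N : {measure set E -> \bar R}) : Prop :=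
  exists b A, levy_triplet b A N.

(* Levy measures do not charge 0, so the value nu 0 is immaterial. *)
Definition levy_density (nu : E -> R) : Prop :=
  [/\ measurable_fun setT nu, (forall x, x != 0 -> 0 < nu x) &
      exists2 N, levy_measure N &
        forall B, measurable B -> N B = (\int[leb]_(x in B `\ 0%R) (nu x)%:E)%E].

Definition comparable_shift (nu : E -> R) : Prop :=
  forall r, 0 < r <= 1 / 2 -> exists2 C, 1 <= C &
    forall x y, r <= enorm y -> enorm y <= enorm x -> enorm x <= enorm y + 1 ->
      C^-1 * nu y <= nu x <= C * nu y.

Definition almost_decreasing (nu : E -> R) : Prop :=
  exists2 C, 1 <= C &
    forall x y, 1 / 2 <= enorm y -> enorm y <= enorm x -> nu x <= C * nu y.

Definition direct_jump (nu : E -> R) : Prop :=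
  exists2 C, 1 <= C & forall x y, 1 <= enorm (y - x) ->
    (\int[leb]_(z in [set z | 1 / 2 < enorm (z - x) /\ 1 / 2 < enorm (z - y)]%R)
       (nu (x - z) * nu (z - y))%:E <= (C * nu (x - y))%:E)%E.

Definition A1 : Prop :=
  symmetric_process /\ exists nu, [/\ levy_density nu,
    comparable_shift nu, almost_decreasing nu & direct_jump nu].

Definition strong_feller : Prop :=
  forall t, 0 < t -> forall f : E -> R, measurable_fun setT f ->
    (exists M, forall x, `|f x| <= M) ->
    continuous (fun x => fine (Ex x (fun w => (f (w t))%:E))).

Definition transition_density (p : R -> E -> R) : Prop :=
  forall t, 0 < t -> [/\ measurable_fun setT (p t), (forall y, 0 <= p t y) &
    forall x (A : set E), measurable A ->
      P [set w | A (x + X t w)] = (\int[leb]_(y in A) (p t (y - x)%R)%:E)%E].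

Definition A2 (p : R -> E -> R) (tb : R) : Prop :=
  [/\ strong_feller, transition_density p, 0 < tb &
      exists C, forall x, 0 < p tb x <= C].

Definition exit_time (D : set E) (w : R -> E) : \bar R :=
  ereal_inf [set t%:E | t in [set t | 0 <= t /\ ~ D (w t)]].

Definition killed_density (D : set E) (pD : R -> E -> E -> R) : Prop :=
  [/\ measurable_fun setT (fun z : R * (E * E) => pD z.1 z.2.1 z.2.2),
      (forall t x y, 0 <= pD t x y),
      (forall t x y, ~ (D x /\ D y) -> pD t x y = 0) &
      forall t x (A : set E), 0 < t -> D x -> measurable A ->
        Px x [set w | A (w t) /\ (t%:E < exit_time D w)%E]
        = (\int[leb]_(y in A) (pD t x y)%:E)%E].

Definition green (pD : R -> E -> E -> R) (x y : E) : \bar R :=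
  (\int[lebesgue_measure]_(t in `]0%R, +oo[) (pD t x y)%:E)%E.

(* Densities are determined only up to null sets: the condition asks for one
   version of p_{B(0,r)}, the same for all p and q. *)
Definition A3 : Prop :=
  forall r, 0 < r <= 1 -> exists2 pD, killed_density (eball 0 r) pD &
    forall p q, 0 < p -> p < q -> q < r ->
      (ereal_sup [set green pD z.1 z.2 | z in eball 0%R p `*` ~` eball 0%R q]
        < +oo)%E.

Record regular_jump_levy (p : R -> E -> R) (tb : R) : Prop := RegularJumpLevy {
  regular_levy : levy_process ;
  regular_A1 : A1 ;
  regular_A2 : A2 p tb ;
  regular_A3 : A3 }.

Definition kato (V : E -> R) : Prop :=
  measurable_fun setT V /\
  ereal_sup [set Ex x (fun w =>
      \int[lebesgue_measure]_(s in `[0%R, t]) `|V (w s)|%:E)%E | x in setT]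
    @[t --> 0^'+] --> 0%E.

Definition kato_loc (V : E -> R) : Prop :=
  measurable_fun setT V /\
  forall x r, 0 < r -> kato (V \* \1_(eball x r)).

Definition kato_potential (V : E -> R) : Prop :=
  kato (V^\-)%R /\ kato_loc (V^\+)%R.

Definition confining (V : E -> R) : Prop :=
  forall M, exists r, forall x, r <= enorm x -> M <= V x.

(* For a Kato class potential the time integral is almost surely a real
   number. *)
Definition feynman_kac (V : E -> R) (t : R) (f : E -> R) (x : E) : \bar R :=
  Ex x (fun w =>
    expeR (- \int[lebesgue_measure]_(s in `[0%R, t]) (V (w s))%:E)
    * (f (w t))%:E)%E.

Definition l2dot (f g : E -> R) : R := (\int[leb]_x (f x * g x))%R.

Definition orthonormal_basis (phi : nat -> E -> R) : Prop :=
  [/\ (forall n, phi n \in Lfun leb 2%:E),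
      (forall m n, l2dot (phi m) (phi n) = (m == n)%:R) &
      forall f, f \in Lfun leb 2%:E ->
        'N[leb]_2%:E[EFin \o
            (f \- (fun x => \sum_(k < n) l2dot f (phi k) * phi k x))%R]%E
          @[n --> \oo] --> 0%E].

Record eigenbasis (V : E -> R) (lambda : nat -> R) (phi : nat -> E -> R) : Prop
  := Eigenbasis {
  eigen_basis : orthonormal_basis phi ;
  eigen_eq : forall n t, 0 < t ->
    {ae leb, forall x,
      feynman_kac V t (phi n) x = (expR (- lambda n * t) * phi n x)%:E} ;
  eigen_lt01 : lambda 0%N < lambda 1%N ;
  eigen_le : forall n, lambda n <= lambda n.+1 ;
  eigen_cvg : lambda n @[n --> \oo] --> +oo ;
  eigen_bounded : forall n, exists M, forall x, `|phi n x| <= M ;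
  eigen_continuous : forall n, continuous (phi n) ;
  ground_state_gt0 : forall x, 0 < phi 0%N x }.

Section intrinsic.
Variables (V : E -> R) (lambda0 : R) (phi0 : E -> R).

Definition intrinsic_sg (t : R) (f : E -> R) (x : E) : \bar R :=
  ((expR (lambda0 * t) / phi0 x)%:E * feynman_kac V t (phi0 \* f)%R x)%E.

(* The norm of L^2(R^d, phi0^2 dx). *)
Definition weighted_norm2 (f : E -> R) : \bar R :=
  ((\int[leb]_x (f x ^+ 2 * phi0 x ^+ 2)%:E) `^ 2^-1)%E.

Definition IUC_at (t : R) : Prop := exists2 C, 0 < C &
  forall f, measurable_fun setT f -> (weighted_norm2 f < +oo)%E ->
    ('N[leb]_+oo[intrinsic_sg t f] <= C%:E * weighted_norm2 f)%E.

Definition IUC : Prop := forall t, 0 < t -> IUC_at t.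

Definition AIUC : Prop := exists2 t, 0 < t & IUC_at t.

Definition GSD_at (t : R) : Prop := exists2 C, 0 < C &
  forall x, (feynman_kac V t (cst 1%R) x <= (C * phi0 x)%:E)%E.

Definition GSD : Prop := forall t, 0 < t -> GSD_at t.

Definition AGSD : Prop := exists2 t, 0 < t & GSD_at t.

End intrinsic.

End levy.

(* Main.v *)
(* Write T_t for the Feynman--Kac semigroup, V = a - b with a = V^+ and b = V^-,
   and h for the ground state.

   IUC at t implies GSD at 2t.  IUC at t says T_t g <= C |g|_2 h almost
   everywhere.  The ground state is integrable: for any box F,
   g = sum_k 2^-(k+1) P_{kt} 1_F (P the free semigroup) satisfies P_t g <= 2 g,
   and by AM-GM T_t sqrt(g) is at most a small multiple of sqrt(g) outside a box
   B, independent of F, off which a is large; symmetry then bounds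
   <h, sqrt(g)>, hence int_F h, by a multiple of int_B h.  Testing T_t 1 against
   its own truncations q = 1_B T_t 1, symmetry gives
   |q|_2^2 <= <T_t q, 1> <= C |q|_2 |h|_1, hence T_t 1 is square integrable and
   T_2t 1 <= C' h almost everywhere.  One more step T_e removes the null set, and
   monotone convergence lets e tend to 0.

   GSD at t >= t_b implies IUC at 2t.  By AM-GM along the path,
   2 T_t g <= theta E[exp(2 int (b - a))] + theta^-1 P_t (g^2); the first term is
   bounded by Khasminskii's lemma and the second by the bounded density, so
   T_t g <= C |g|_2, and applying T_t again T_2t g <= C |g|_2 T_t 1.

   Everything is computed with expectations of nonnegative extended real
   functionals of the path.  The Markov property and the symmetry of T_t are both
   equalities in law of two processes on [0, t], obtained by comparing their
   independent increments: the functional exp(int b - int a) is a limit of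
   polynomials in the occupation integrals, whose moments only involve
   finite-dimensional distributions. *)
Require Import Defs.
From HB Require Import structures.
From mathcomp Require Import all_boot all_order all_algebra.
From mathcomp Require Import all_classical all_reals all_analysis.
From mathcomp Require Import measurable_realfun measurable_fun_approximation.
From mathcomp Require Import ess_sup_inf ring lra.

Import Order.TTheory GRing.Theory Num.Theory.
Import numFieldNormedType.Exports.

Local Open Scope classical_set_scope.
Local Open Scope ring_scope.

Set Implicit Arguments.
Unset Strict Implicit.
Unset Printing Implicit Defensive.

(** * Integration lemmas *)

(** The difficulty is to integrate the ground state h, known only to be square integrable. Half of
    <h, sqrt(g)> has to be absorbed, so this number must be finite beforehand: hence g is built to
    be integrable, and phi q <= phi^2 + q^2 does the rest. The square root is dictated by AM-GM,
    which leaves P_t acting on the square of the test function without any weight; the square must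
    therefore be a function that P_t enlarges by at most a constant. Summing over all multiples of t
    makes P_t a shift of the index, and the ratio of consecutive weights is the factor 2. The lower
    bound g >= 1/2 on F returns from sqrt(g) to F. A second obstacle is that the eigenvalue equation
    is given almost everywhere while domination is claimed at every point. The pointwise form T_t h
    <= exp(- lambda t) h comes from one extra short step, using that the law at a positive time
    charges no null set and that h is continuous. Finally, V^+ is only locally in the Kato class, so
    its integral along a path may be infinite. Nothing is ever subtracted: V^+ enters through exp(-
    int a), which may vanish. *)

Section tonelli_on.
Context d (T : measurableType d) (R : realType).
Local Open Scope ereal_scope.
Local Notation mu := (@lebesgue_measure R).
Variables (D : set R) (mD : measurable D).
Variable f : T * R -> \bar R.
Hypotheses (mf : measurable_fun [set: T * R] f) (f0 : forall z, 0 <= f z).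

Let fD (z : T * R) := f z * (\1_D z.2)%:E.

Let mfD : measurable_fun [set: T * R] fD.
Proof.
apply: emeasurable_funM => //; apply/measurable_EFinP.
by apply: measurableT_comp => //; exact: measurable_indic.
Qed.

Let fD0 z : 0 <= fD z.
Proof. by rewrite mule_ge0// lee_fin. Qed.

Let intD w : \int[mu]_(s in D) f (w, s) = \int[mu]_s fD (w, s).
Proof.
rewrite integral_mkcond; apply: eq_integral => s _.
rewrite /fD /= patchE indicE; case: ifP => sD; first by rewrite mule1.
by rewrite mule0.
Qed.

Lemma measurable_fun_integral_in :
  measurable_fun setT (fun w => \int[mu]_(s in D) f (w, s)).
Proof.
under eq_fun do rewrite intD.
exact: (@measurable_fun_fubini_tonelli_F _ _ _ _ R mu fD).
Qed.

Lemma tonelli_in (P : {sigma_finite_measure set T -> \bar R}) :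
  \int[P]_w \int[mu]_(s in D) f (w, s) = \int[mu]_(s in D) \int[P]_w f (w, s).
Proof.
under eq_integral do rewrite intD.
rewrite (@fubini_tonelli _ _ _ _ R P mu fD)//.
rewrite [RHS]integral_mkcond; apply: eq_integral => s _.
rewrite patchE; case: ifPn => sD.
  by apply: eq_integral => w _; rewrite /fD /= indicE sD mule1.
by rewrite integral0_eq// => w _; rewrite /fD /= indicE (negbTE sD) mule0.
Qed.

End tonelli_on.

(** * Translations and reflections of the time axis *)

Section lebesgue_shift.
Context (R : realType).
Local Open Scope ereal_scope.
Local Notation mu := (@lebesgue_measure R).
Local Notation TR := (measurableTypeR R).

(** Lebesgue measure is determined by its values on half-open intervals, and these keep their length
    under translation. *)
Lemma lebesgue_measure_shift (c : R) (A : set TR) : measurable A ->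
  pushforward mu ((fun x => x + c)%R : TR -> TR) A = mu A.
Proof.
have mc : measurable_fun setT ((fun x => x + c)%R : TR -> TR).
  exact: measurable_funD.
pose mm := isMeasurableFun.Build _ _ _ _ _ mc.
pose mp : {mfun TR >-> TR} := HB.pack ((fun x => x + c)%R : TR -> TR) mm.
move=> mA; apply/esym/(@lebesgue_measure_unique R (pushforward mu mp)) => // _ [[a b]] _ <- /=.
rewrite /pushforward.
rewrite (_ : _ @^-1` _ = `](a - c)%R, (b - c)%R]%classic); last first.
  by apply/seteqP; split => x /=; rewrite !in_itv/= ltrBlDr lerBrDr.
rewrite !lebesgue_measure_itv/= !lte_fin ltrD2r; case: ifP => // _.
by rewrite -!EFinD; congr (_ %:E); ring.
Qed.

Lemma ge0_integral_shift (c : R) (D : set TR) (f : TR -> \bar R) :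
  measurable D -> measurable_fun setT f -> (forall s, 0 <= f s) ->
  \int[mu]_(s in [set s | D (s + c)%R]) f (s + c)%R = \int[mu]_(s in D) f s.
Proof.
move=> mD mf f0.
have mc : measurable_fun setT ((fun x => x + c)%R : TR -> TR).
  exact: measurable_funD.
transitivity (\int[pushforward mu ((fun x => x + c)%R : TR -> TR)]_(s in D) f s).
  by rewrite (ge0_integral_pushforward mc)//; exact: measurable_funTS.
pose mm := isMeasurableFun.Build _ _ _ _ _ mc.
pose mp : {mfun TR >-> TR} := HB.pack ((fun x => x + c)%R : TR -> TR) mm.
apply: (@eq_measure_integral _ _ R D mu (pushforward mu mp)) => A mA _.
exact: lebesgue_measure_shift.
Qed.

Lemma ge0_integral_opp (D : set TR) (f : TR -> \bar R) :
  measurable D -> measurable_fun setT f -> (forall s, 0 <= f s) ->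
  \int[mu]_(s in [set s | D (- s)%R]) f (- s)%R = \int[mu]_(s in D) f s.
Proof.
move=> mD mf f0.
have mc : measurable_fun setT ((fun x => - x)%R : TR -> TR).
  exact: measurable_funN.
transitivity (\int[pushforward mu ((fun x => - x)%R : TR -> TR)]_(s in D) f s).
  by rewrite (ge0_integral_pushforward mc)//; exact: measurable_funTS.
pose mm := isMeasurableFun.Build _ _ _ _ _ mc.
pose mp : {mfun TR >-> TR} := HB.pack ((fun x => - x)%R : TR -> TR) mm.
apply: (@eq_measure_integral _ _ R D mu (pushforward mu mp)) => A mA _.
exact: lebesgue_measureN.
Qed.

(** A reflection about 0 followed by a translation. It serves to compare the occupation integral of
    a reversed path with that of the path itself. *)
Lemma ge0_integral_rev (t : R) (f : R -> \bar R) :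
  measurable_fun [set: R] f -> (forall s, 0 <= f s) ->
  \int[mu]_(s in `[0%R, t]) f (t - s)%R = \int[mu]_(s in `[0%R, t]) f s.
Proof.
move=> mf f0.
have mg : measurable_fun [set: R] (fun s : R => f (s + t)%R).
  by apply: (measurableT_comp mf); exact: measurable_funD.
rewrite -(@ge0_integral_shift t `[0%R, t]%classic f)//.
rewrite -(@ge0_integral_opp [set s : R | `[0%R, t]%classic (s + t)%R]
  (fun s => f (s + t)%R))//; last first.
  rewrite -[X in measurable X]setTI.
  exact: (@measurable_funD _ _ R _ id (cst t)).
rewrite (_ : [set s | _] = `[0%R, t]%classic); last first.
  apply/seteqP; split => s /=; rewrite !in_itv/=; lra.
by apply: eq_integral => s _; rewrite addrC.
Qed.

End lebesgue_shift.

Section rV_measurability.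
Context (R : realType) (n : nat) d (T : measurableType d).
Implicit Types f g : T -> 'rV[R]_n.

Lemma measurable_funDrV f g : measurable_fun [set: T] f ->
  measurable_fun [set: T] g -> measurable_fun [set: T] (fun x => f x + g x).
Proof.
move=> mf mg; apply: measurable_fun_rV => i; under eq_fun do rewrite mxE.
apply: measurable_funD.
  exact: (measurableT_comp (@measurable_coord_rV R n i)).
exact: (measurableT_comp (@measurable_coord_rV R n i)).
Qed.

Lemma measurable_funNrV f : measurable_fun [set: T] f ->
  measurable_fun [set: T] (fun x => - f x).
Proof.
move=> mf; apply: measurable_fun_rV => i; under eq_fun do rewrite mxE.
by apply: measurable_funN; exact: (measurableT_comp (@measurable_coord_rV R n i)).
Qed.

Lemma measurable_funBrV f g : measurable_fun [set: T] f ->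
  measurable_fun [set: T] g -> measurable_fun [set: T] (fun x => f x - g x).
Proof. by move=> mf mg; apply: measurable_funDrV => //; exact: measurable_funNrV. Qed.

Lemma measurable_sum_rV m (f : 'I_m -> T -> 'rV[R]_n) (p : pred 'I_m) :
  (forall i, measurable_fun [set: T] (f i)) ->
  measurable_fun [set: T] (fun x => \sum_(i < m | p i) f i x).
Proof.
move=> mf; apply: measurable_fun_rV => i.
under eq_fun do rewrite summxE -big_filter.
apply: measurable_sum => j; exact: (measurableT_comp (@measurable_coord_rV R n i)).
Qed.

End rV_measurability.

(** * Lebesgue measure on R^n: translation invariance and exhaustion by boxes *)

Section lebesgue_rV_theory.
Context (R : realType).
Local Open Scope ereal_scope.

Lemma ge0_integral_lebesgue_rVS n (f : 'rV[R]_n.+1 -> \bar R) :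
  measurable_fun [set: 'rV[R]_n.+1] f -> (forall x, 0 <= f x) ->
  \int[lebesgue_rV]_x f x =
  \int[@lebesgue_measure R]_u \int[lebesgue_rV]_v f (cons_rV (u, v)).
Proof.
move=> mf f0.
transitivity (\int[@lebesgue_measure R \x @lebesgue_rV R n]_z f (cons_rV z)).
  have f0' : {in [set: 'rV[R]_n.+1], forall y, 0 <= f y} by move=> y _.
  have mc : measurable_fun [set: measurableTypeR R * 'rV[R]_n] (@cons_rV R n).
    exact: measurable_cons_rV.
  exact: (ge0_integral_pushforward mc (@lebesgue_measure R \x @lebesgue_rV R n)
    measurableT mf f0').
apply: (@fubini_tonelli1 _ _ _ _ R (@lebesgue_measure R) (@lebesgue_rV R n)
  (fun z => f (cons_rV z))) => //.
exact: (measurableT_comp mf (@measurable_cons_rV R n)).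
Qed.

Lemma cons_rVD n (u : R) (v : 'rV[R]_n) (a : 'rV[R]_n.+1) :
  (cons_rV (u, v) + a = cons_rV (u + (uncons_rV a).1, v + (uncons_rV a).2))%R.
Proof.
apply/rowP => j; rewrite /cons_rV /uncons_rV /= !mxE; case: splitP => k jk.
  rewrite !ord1 !mxE !mulr1n; congr (_ + a _ _)%R.
  by apply/val_inj => /=; rewrite jk ord1.
by rewrite !mxE; congr (_ + a _ _)%R; apply/val_inj => /=; rewrite jk.
Qed.

(** Induction on the dimension: Tonelli peels off the first coordinate, the induction hypothesis
    translates the inner integral and the one-dimensional invariance the outer one. *)
Lemma ge0_integral_lebesgue_rV_shift n (a : 'rV[R]_n) (f : 'rV[R]_n -> \bar R) :
  measurable_fun [set: 'rV[R]_n] f -> (forall x, 0 <= f x) ->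
  \int[lebesgue_rV]_x f (x + a)%R = \int[lebesgue_rV]_x f x.
Proof.
elim: n a f => [|n IHn] a f mf f0.
  by apply: eq_integral => x _; congr f; apply/rowP => -[].
have mfa : measurable_fun [set: 'rV[R]_n.+1] (fun x => f (x + a)%R).
  by apply: (measurableT_comp mf); exact: measurable_funDrV.
rewrite ge0_integral_lebesgue_rVS// [RHS]ge0_integral_lebesgue_rVS//.
have mfc : measurable_fun [set: R * 'rV[R]_n] (fun z => f (cons_rV z)).
  exact: (measurableT_comp mf (@measurable_cons_rV R n)).
pose F u := \int[lebesgue_rV]_v f (cons_rV (u, v)).
have mF : measurable_fun [set: R] F.
  by apply: (@measurable_fun_fubini_tonelli_F _ _ _ _ R (@lebesgue_rV R n)
    (fun z => f (cons_rV z))).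
transitivity (\int[@lebesgue_measure R]_u F (u + (uncons_rV a).1)%R).
  apply: eq_integral => u _; rewrite /F.
  under eq_integral do rewrite cons_rVD.
  apply: (IHn (uncons_rV a).2
    (fun v => f (cons_rV ((u + (uncons_rV a).1)%R, v)))) => //.
  exact: (measurableT_comp mfc (pair1_measurable _)).
have := @ge0_integral_shift R (uncons_rV a).1 setT F measurableT mF.
by apply => u; apply: integral_ge0.
Qed.

Definition box n (r : R) : set 'rV[R]_n := [set x | forall i, `|x 0%R i| <= r]%R.

Lemma measurable_box n r : measurable (@box n r).
Proof.
rewrite (_ : @box n r = \bigcap_(i in [set: 'I_n])
   (coord_rV i @^-1` [set u | (`|u| <= r)%R])); last first.
  by apply/seteqP; split => x /=; [move=> + i _; exact|move=> + i; exact].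
apply: fin_bigcap_measurable => // i _.
rewrite -[X in measurable X]setTI; apply: measurable_coord_rV => //.
rewrite (_ : [set u | _] = `[(- r)%R, r]%classic)//.
by apply/seteqP; split => u /=; rewrite in_itv/= ler_norml.
Qed.

Lemma lebesgue_rV_box n r : lebesgue_rV (@box n r) < +oo.
Proof.
elim: n => [|n IHn].
  by rewrite /= diracE ltry.
rewrite -[X in X < _]/((@lebesgue_measure R \x @lebesgue_rV R n)
   (@cons_rV R n @^-1` @box n.+1 r)).
rewrite (_ : _ @^-1` _ = `[(-r)%R, r]%classic `*` @box n r); last first.
  apply/seteqP; split => -[u v]; rewrite /box /cons_rV /= in_itv /= -ler_norml.
    move=> h; split.
      by have := h ord0; rewrite mxE; case: splitP => // j _; rewrite mxE ord1 mulr1n.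
    move=> i; have := h (lift ord0 i); rewrite mxE; case: splitP => [j|j /eqP].
      by rewrite ord1.
    by rewrite eqSS => /eqP/val_inj ->.
  move=> [hu hv] i; rewrite mxE; case: splitP => j _; last exact: hv.
  by rewrite mxE ord1 mulr1n.
rewrite product_measure1E//; last exact: measurable_box.
rewrite lte_mul_pinfty//.
  by rewrite /= lebesgue_measure_itv/=; case: ifP.
Qed.

(** Monotone convergence along boxes. It turns bounds proved on sets of finite measure, where
    quantities can be divided and absorbed, into integrability on the whole space. *)
Lemma integral_box_le n (f : 'rV[R]_n -> \bar R) (C : \bar R) :
  measurable_fun [set: 'rV[R]_n] f -> (forall x, 0 <= f x) ->
  (forall k : nat, \int[lebesgue_rV]_(x in box k%:R) f x <= C) ->
  \int[lebesgue_rV]_x f x <= C.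
Proof.
move=> mf f0 fC.
have cvgF : \int[lebesgue_rV]_(x in box k%:R) f x @[k --> \oo] -->
    \int[lebesgue_rV]_(x in \bigcup_k (@box n k%:R)) f x.
  apply: ge0_nondecreasing_set_cvg_integral => //.
  - move=> i j ij; apply/subsetPset => x hx l.
    by apply: (le_trans (hx l)); rewrite ler_nat.
  - by move=> k; exact: measurable_box.
  - by move=> k; exact: measurable_funTS.
have cover : \bigcup_k (@box n k%:R) = setT.
  apply/seteqP; split => // x _.
  pose S := (\sum_j `|x 0%R j|)%R.
  exists (Num.truncn S).+1 => // l.
  apply: (@le_trans _ _ S).
    by rewrite /S (bigD1 l)//= lerDl sumr_ge0.
  by apply: ltW; exact: truncnS_gt.
rewrite cover in cvgF.
rewrite -(cvg_lim (@ereal_hausdorff R) cvgF).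
apply: lime_le; first by apply/cvg_ex; eexists; exact: cvgF.
exact: nearW.
Qed.

End lebesgue_rV_theory.

(** * Finite-dimensional distributions *)

Section tuple_law.
Context (R : realType) d (E : measurableType d) (m : nat).

Definition rectangles : set (set (m.-tuple E)) :=
  [set S | exists2 B : nat -> set E, (forall i, measurable (B i)) &
    S = [set s | forall i : 'I_m, B i (tnth s i)]].

Lemma measurable_rectangle (B : nat -> set E) : (forall i, measurable (B i)) ->
  measurable [set s : m.-tuple E | forall i : 'I_m, B i (tnth s i)].
Proof.
move=> mB.
rewrite (_ : mkset _ = \bigcap_(i in [set: 'I_m])
   ((fun s : m.-tuple E => tnth s i) @^-1` B i)); last first.
  by apply/seteqP; split => x /=; [move=> + i _; exact|move=> + i; exact].
apply: fin_bigcap_measurable => // i _.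
by rewrite -[X in measurable X]setTI; exact: measurable_tnth.
Qed.

Lemma measurable_tuple_rectangles :
  @measurable _ (m.-tuple E) = <<s rectangles >>.
Proof.
apply/seteqP; split => A.
  apply: smallest_sub; first exact: smallest_sigma_algebra.
  move=> B; rewrite -bigcup_seq => -[i _ [C mC <-]].
  apply: sub_sigma_algebra.
  exists (fun j : nat => if j == i :> nat then C else setT) => [j|]; first by case: ifP.
  apply/seteqP; split => s /=.
    by move=> [_ Cs] j; case: ifPn => // /eqP/val_inj ->.
  by move=> /(_ i); rewrite eqxx.
apply: smallest_sub; first exact: sigma_algebra_measurable.
by move=> _ [B mB ->]; exact: measurable_rectangle.
Qed.

(** Rectangles are stable under intersection, generate the product sigma-algebra and include the
    whole space, where [m1] is finite. *)
Lemma tuple_law_unique (m1 m2 : {measure set (m.-tuple E) -> \bar R}) :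
  (m1 setT < +oo)%E ->
  (forall B : nat -> set E, (forall i, measurable (B i)) ->
    m1 [set s | forall i : 'I_m, B i (tnth s i)] =
    m2 [set s | forall i : 'I_m, B i (tnth s i)]) ->
  forall A, measurable A -> m1 A = m2 A.
Proof.
move=> m1oo m12 A mA.
apply: (measure_unique rectangles (fun=> setT)) => //.
- exact: measurable_tuple_rectangles.
- move=> _ _ [B mB ->] [C mC ->].
  exists (fun i => B i `&` C i) => [i|]; first exact: measurableI.
  apply/seteqP; split => s /=; first by move=> [? ?] i; split.
  by move=> h; split=> i; have [] := h i.
- by move=> _; exists (fun=> setT) => //; apply/seteqP; split.
- by rewrite bigcup_const.
- by move=> _ [B mB ->]; exact: m12.
Qed.

End tuple_law.

(** * Processes with prescribed independent increments *)

Section increments.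
Context (R : realType) (n : nat).
Local Notation E := 'rV[R]_n.

(** Only subdivisions passing through [c] are tested. For a process glued at time [c] no increment
    then straddles the junction, and with c = T the subdivision must end at T. Finite-dimensional
    distributions are still determined, since any finite set of times can be completed by [c]. *)
Definition has_increments (law : R -> set E -> \bar R) (c T : R)
    dO (Omega : measurableType dO) (P : probability Omega R)
    (Z : R -> Omega -> E) : Prop :=
  forall m (u : nat -> R) (A : nat -> set E), u 0%N = 0 ->
    (forall i, (i < m)%N -> u i < u i.+1) -> u m <= T ->
    (exists2 i, (i <= m)%N & u i = c) -> (forall i, measurable (A i)) ->
  P [set w | forall i, (i < m)%N -> A i (Z (u i.+1) w - Z (u i) w)] =
  (\prod_(0 <= i < m) law (u i.+1 - u i)%R (A i))%E.

(** Joint measurability is what Tonelli requires for occupation integrals. The start at 0 holds for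
    every path, so that positions are exactly sums of increments. *)
Record process dO (Omega : measurableType dO) (Z : R -> Omega -> E) : Prop :=
  Process {
    process_measurable :
      measurable_fun [set: R * Omega] (fun z => Z z.1 z.2) ;
    process_start : forall w, Z 0 w = 0 }.

Lemma process_at dO (Omega : measurableType dO) (Z : R -> Omega -> E) t :
  process Z -> measurable_fun [set: Omega] (Z t).
Proof.
by move=> [mZ _]; exact: (measurableT_comp mZ (pair1_measurable t)).
Qed.

Section partition.
Variables (c T : R) (k : nat) (tau : 'I_k -> R).
Hypotheses (cT : 0 <= c <= T) (tauT : forall i, 0 <= tau i <= T).

Let ts := sort <=%R (undup (0 :: c :: [seq tau i | i <- enum 'I_k])).
Let m := (size ts).-1.
Let u i := nth 0 ts i.

Let mem_ts s : (s \in ts) = (s \in 0 :: c :: [seq tau i | i <- enum 'I_k]).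
Proof. by rewrite mem_sort mem_undup. Qed.

Let ts_sorted : sorted <%R ts.
Proof.
by rewrite lt_sorted_uniq_le sort_uniq undup_uniq sort_le_sorted.
Qed.

Let size_ts : size ts = m.+1.
Proof.
by rewrite /m prednK// -has_predT; apply/hasP; exists 0 => //;
  rewrite mem_ts inE eqxx.
Qed.

Let ts_ge0 s : s \in ts -> 0 <= s <= T.
Proof.
have T0 : 0 <= T by case/andP : cT => ?; exact: le_trans.
rewrite mem_ts !inE => /or3P[/eqP ->|/eqP ->//|/mapP[i _ ->]//].
by rewrite lexx.
Qed.

Let u0 : u 0%N = 0.
Proof.
have h0 : 0 \in ts by rewrite mem_ts inE eqxx.
have hu : u 0%N \in ts by rewrite mem_nth// size_ts.
apply/eqP; rewrite eq_le; have /andP[-> _] := ts_ge0 hu; rewrite andbT.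
rewrite -[leRHS](nth_index 0 h0).
by rewrite (sorted_leq_nth le_trans le_refl)// ?inE ?index_mem ?size_ts//
  (sub_sorted _ ts_sorted)// => ? ? /ltW.
Qed.

Let u_incr i : (i < m)%N -> u i < u i.+1.
Proof.
move=> im; rewrite /u (sorted_ltn_nth lt_trans)// inE size_ts.
  by rewrite ltnS ltnW.
by rewrite ltnS.
Qed.

(** The subdivision is the sorted list of the distinct values among 0, [c] and the [tau i]; it
    begins with 0 because all of them are nonnegative. *)
Lemma partition_exists : exists m (u : nat -> R) (idx : 'I_k -> nat),
  [/\ u 0%N = 0, (forall i, (i < m)%N -> u i < u i.+1), u m <= T,
      exists2 i, (i <= m)%N & u i = c &
      forall i, (idx i <= m)%N /\ u (idx i) = tau i].
Proof.
exists m, u, (fun i => index (tau i) ts); split => //.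
- have hu : u m \in ts by rewrite mem_nth// size_ts.
  by have /andP[] := ts_ge0 hu.
- have hc : c \in ts by rewrite mem_ts !inE eqxx orbT.
  by exists (index c ts); [rewrite -ltnS -size_ts index_mem|exact: nth_index].
- move=> i; have hi : tau i \in ts.
    by rewrite mem_ts !inE map_f ?orbT// mem_enum.
  by split; [rewrite -ltnS -size_ts index_mem|exact: nth_index].
Qed.

End partition.

Section fdd.
Variables (law : R -> set E -> \bar R) (c T : R).
Hypothesis cT : 0 <= c <= T.
Context dO (Omega : measurableType dO) (P : probability Omega R).
Context dO' (Omega' : measurableType dO') (P' : probability Omega' R).
Variables (Z : R -> Omega -> E) (Z' : R -> Omega' -> E).
Hypotheses (pZ : process Z) (pZ' : process Z').
Hypotheses (hZ : has_increments law c T P Z) (hZ' : has_increments law c T P' Z').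
Variables (k : nat) (tau : 'I_k -> R).
Hypothesis tauT : forall i, 0 <= tau i <= T.

(** The positions at the times [tau i] are partial sums, through [Psi], of the increments [D] along
    a common subdivision, and these have the same product law for both processes. *)
Lemma fdd_eq (A : set (k.-tuple E)) : measurable A ->
  P ((fun w => [tuple Z (tau i) w | i < k]) @^-1` A) =
  P' ((fun w => [tuple Z' (tau i) w | i < k]) @^-1` A).
Proof.
move=> mA.
have [m [u [idx [u0 u_incr umT uc uidx]]]] := partition_exists cT tauT.
pose D dX (X : measurableType dX) (Y : R -> X -> E) w :=
  [tuple Y (u i.+1) w - Y (u i) w | i < m].
have mD dX (X : measurableType dX) (Y : R -> X -> E) : process Y ->
    measurable_fun [set: X] (D _ X Y).
  move=> pY; apply/measurable_fun_tnthP => i.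
  rewrite (_ : _ \o _ = fun w => Y (u i.+1) w - Y (u i) w); last first.
    by apply/funext => w /=; rewrite tnth_mktuple.
  by apply: measurable_funBrV; exact: process_at.
pose Psi (s : m.-tuple E) :=
  [tuple \sum_(j < m | (j < idx i)%N) tnth s j | i < k].
have mPsi : measurable_fun [set: m.-tuple E] Psi.
  apply/measurable_fun_tnthP => i.
  rewrite (_ : _ \o _ =
      fun s : m.-tuple E => \sum_(j < m | (j < idx i)%N) tnth s j).
    by apply: measurable_sum_rV => j; exact: measurable_tnth.
  by apply/funext => w /=; rewrite tnth_mktuple.
have PsiD dX (X : measurableType dX) (Y : R -> X -> E) : process Y ->
    (fun w => [tuple Y (tau i) w | i < k]) = Psi \o D _ X Y.
  move=> [_ Y0]; apply/funext => w; apply/eq_from_tnth => i /=.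
  rewrite !tnth_mktuple.
  under eq_bigr do rewrite tnth_mktuple.
  rewrite -(big_ord_widen m (fun j => Y (u j.+1) w - Y (u j) w) (uidx i).1).
  rewrite -(big_mkord xpredT (fun j => Y (u j.+1) w - Y (u j) w)).
  by rewrite (telescope_sumr (fun j => Y (u j) w))// u0 Y0 subr0 (uidx i).2.
rewrite (PsiD _ _ _ pZ) (PsiD _ _ _ pZ') !comp_preimage.
have mPA : measurable (Psi @^-1` A).
  by rewrite -[X in measurable X]setTI; exact: mPsi.
pose DZ : {mfun Omega >-> m.-tuple E} :=
  HB.pack (D _ _ Z) (isMeasurableFun.Build _ _ _ _ _ (mD _ _ _ pZ)).
pose DZ' : {mfun Omega' >-> m.-tuple E} :=
  HB.pack (D _ _ Z') (isMeasurableFun.Build _ _ _ _ _ (mD _ _ _ pZ')).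
apply: (@tuple_law_unique R _ E m (pushforward P DZ) (pushforward P' DZ')) => //.
  by rewrite /= /pushforward preimage_setT probability_setT ltry.
move=> B mB; rewrite /= /pushforward.
have H dX (X : measurableType dX) (Q : probability X R) (Y : R -> X -> E) :
    has_increments law c T Q Y ->
    Q (D _ X Y @^-1` [set s | forall i : 'I_m, B i (tnth s i)]) =
    (\prod_(0 <= i < m) law (u i.+1 - u i)%R (B i))%E.
  move=> hY; rewrite -(hY m u B)//; congr (Q _).
  apply/seteqP; split => w /=.
    by move=> h i im; have := h (Ordinal im); rewrite tnth_mktuple.
  by move=> h i; rewrite tnth_mktuple; exact: h.
by rewrite !H.
Qed.

Lemma fdd_integral (Phi : k.-tuple E -> \bar R) :
  measurable_fun [set: k.-tuple E] Phi -> (forall s, 0 <= Phi s)%E ->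
  (\int[P]_w Phi [tuple Z (tau i) w | i < k] =
   \int[P']_w Phi [tuple Z' (tau i) w | i < k])%E.
Proof.
move=> mPhi Phi0.
have mS dX (X : measurableType dX) (Y : R -> X -> E) : process Y ->
    measurable_fun [set: X] (fun w => [tuple Y (tau i) w | i < k]).
  move=> pY; apply/measurable_fun_tnthP => i.
  rewrite (_ : _ \o _ = Y (tau i)); first exact: process_at.
  by apply/funext => w /=; rewrite tnth_mktuple.
have H dX (X : measurableType dX) (Q : probability X R) (Y : R -> X -> E) :
    process Y -> (\int[Q]_w Phi [tuple Y (tau i) w | i < k] =
    \int[pushforward Q (fun w => [tuple Y (tau i) w | i < k])]_s Phi s)%E.
  by move=> pY; rewrite (ge0_integral_pushforward (mS _ _ _ pY)).
rewrite !H//.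
pose SZ : {mfun Omega >-> k.-tuple E} :=
  HB.pack (fun w => [tuple Z (tau i) w | i < k])
   (isMeasurableFun.Build _ _ _ _ _ (mS _ _ _ pZ)).
pose SZ' : {mfun Omega' >-> k.-tuple E} :=
  HB.pack (fun w => [tuple Z' (tau i) w | i < k])
   (isMeasurableFun.Build _ _ _ _ _ (mS _ _ _ pZ')).
apply: (@eq_measure_integral _ _ R setT (pushforward P' SZ')
  (pushforward P SZ)) => A mA _.
exact: fdd_eq.
Qed.

End fdd.

End increments.

(** * Monotone limits in the extended reals *)

Section ereal_limits.
Context (R : realType).
Local Open Scope ereal_scope.

(** [er_map expR] leaves -oo unchanged where [expeR] gives 0; the indicator factor corrects this, as
    -oo times 0 is 0. *)
Lemma measurable_expeR : measurable_fun [set: \bar R] (@expeR R).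
Proof.
rewrite (_ : expeR = (fun x => er_map expR x * ((\1_(~` [set -oo%E]) : \bar R -> R) x)%:E)).
  apply: emeasurable_funM; first exact: (@measurable_er_map _ (measurableTypeR R) R _ (@measurable_expR R)).
  by apply/measurable_EFinP; apply: measurable_indic; apply: measurableC.
apply/funext => -[r| |] /=; rewrite indicE.
- by rewrite mem_set// mule1.
- by rewrite mem_set// mule1.
- by rewrite memNset ?mule0//= => /(_ erefl).
Qed.

(** Monotone limits are suprema. The supremum of the images is itself some [expeR y], because
    [expeR] is onto the nonnegative extended reals, and y bounds the sequence. The limit +oo is thus
    included. *)
Lemma cvg_expeR_nd (u : (\bar R)^nat) (l : \bar R) :
  nondecreasing_seq u -> u @ \oo --> l -> expeR (u n) @[n --> \oo] --> expeR l.
Proof.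
move=> ndu ul.
have lE : l = ereal_sup (range u).
  by apply: (cvg_unique _ ul) => //; exact: ereal_nondecreasing_cvgn.
have ndv : nondecreasing_seq (fun n => expeR (u n)).
  by move=> m n mn; rewrite lee_expeR; exact: ndu.
rewrite [X in _ --> X](_ : _ = ereal_sup (range (fun n => expeR (u n)))).
  exact: ereal_nondecreasing_cvgn.
apply/eqP; rewrite eq_le; apply/andP; split; last first.
  apply: ge_ereal_sup => _ [n _ <-]; rewrite lee_expeR lE.
  by apply: ereal_sup_ubound; exists n.
have [|y Ly] := @expeR_total R (ereal_sup (range (fun n => expeR (u n)))).
  by apply: le_trans (expeR_ge0 (u 0%N)) _; apply: ereal_sup_ubound; exists 0%N.
rewrite -Ly lee_expeR lE; apply: ge_ereal_sup => _ [n _ <-].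
by rewrite -lee_expeR Ly; apply: ereal_sup_ubound; exists n.
Qed.

Lemma cvg_expeRN_nd (u : (\bar R)^nat) (l : \bar R) :
  nondecreasing_seq u -> u @ \oo --> l ->
  expeR (- u n) @[n --> \oo] --> expeR (- l).
Proof.
move=> ndu ul.
have lE : l = ereal_sup (range u).
  by apply: (cvg_unique _ ul) => //; exact: ereal_nondecreasing_cvgn.
have niv : nonincreasing_seq (fun n => expeR (- u n)).
  by move=> m n mn; rewrite lee_expeR leeN2; exact: ndu.
rewrite [X in _ --> X](_ : _ = ereal_inf (range (fun n => expeR (- u n)))).
  exact: ereal_nonincreasing_cvgn.
apply/eqP; rewrite eq_le; apply/andP; split.
  apply: le_ereal_inf_tmp => _ [n _ <-]; rewrite lee_expeR leeN2 lE.
  by apply: ereal_sup_ubound; exists n.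
have [|y Ly] := @expeR_total R (ereal_inf (range (fun n => expeR (- u n)))).
  by apply: le_ereal_inf_tmp => _ [n _ <-]; exact: expeR_ge0.
rewrite -Ly lee_expeR leeNr lE; apply: ge_ereal_sup => _ [n _ <-].
by rewrite leeNr -lee_expeR Ly; apply: ereal_inf_lbound; exists n.
Qed.

(** The only danger is 0 times +oo. A nondecreasing nonnegative sequence with limit 0 is identically
    0, so the convention that this product is 0 agrees with the limit. *)
Lemma nd_cvgeM (u v : (\bar R)^nat) (k l : \bar R) :
  (forall n, 0 <= u n) -> (forall n, 0 <= v n) ->
  nondecreasing_seq u -> nondecreasing_seq v ->
  u @ \oo --> k -> v @ \oo --> l -> u n * v n @[n --> \oo] --> k * l.
Proof.
move=> u0 v0 ndu ndv uk vl.
have kE : k = ereal_sup (range u).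
  by apply: (cvg_unique _ uk) => //; exact: ereal_nondecreasing_cvgn.
have lE : l = ereal_sup (range v).
  by apply: (cvg_unique _ vl) => //; exact: ereal_nondecreasing_cvgn.
have uk' n : u n <= k by rewrite kE; apply: ereal_sup_ubound; exists n.
have vl' n : v n <= l by rewrite lE; apply: ereal_sup_ubound; exists n.
have [k0|k0] := eqVneq k 0.
  rewrite k0 mul0e; under eq_fun => n.
    have -> : u n = 0 by apply/eqP; rewrite eq_le u0 -k0 uk'.
    rewrite mul0e; over.
  exact: cvg_cst.
have [l0|l0] := eqVneq l 0.
  rewrite l0 mule0; under eq_fun => n.
    have -> : v n = 0 by apply/eqP; rewrite eq_le v0 -l0 vl'.
    rewrite mule0; over.
  exact: cvg_cst.
by apply: cvgeM => //; rewrite mule_defE (negbTE k0) (negbTE l0).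
Qed.

Lemma nneseriesMr (c : (\bar R)^nat) (x : \bar R) :
  (forall k, 0 <= c k) -> 0 <= x ->
  \sum_(0 <= k <oo) c k * x = (\sum_(0 <= k <oo) c k) * x.
Proof.
move=> c0 x0; apply/cvg_lim => //.
under eq_fun do rewrite -ge0_sume_distrl//.
apply: (@nd_cvgeM (fun n => \sum_(0 <= k < n) c k) (fun=> x)) => //.
- by move=> n; exact: sume_ge0.
- by apply: ereal_nondecreasing_series.
- by apply: is_cvg_nneseries => k _ _.
- exact: cvg_cst.
Qed.

Lemma mine_nat_nd (x : \bar R) : nondecreasing_seq (fun n => mine x n%:R%:E).
Proof.
move=> m n mn; rewrite le_min ge_min lexx/= ge_min; apply/orP; right.
by rewrite lee_fin ler_nat.
Qed.

Lemma cvg_mine_nat (x : \bar R) : mine x n%:R%:E @[n --> \oo] --> x.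
Proof.
case: x => [r| |].
- apply: cvg_near_cst; near=> n; apply/min_idPl; rewrite lee_fin.
  near: n; exact: nbhs_infty_ger.
- under eq_fun do rewrite minC minEle leey.
  by apply/cvgenyP; exact: cvg_id.
- by under eq_fun do rewrite minEle leNye; exact: cvg_cst.
Unshelve. all: by end_near. Qed.

Lemma expR_nneseries (a : R) : (0 <= a)%R ->
  (expR a)%:E = \sum_(0 <= k <oo) (a ^+ k / k`!%:R)%:E.
Proof.
move=> a0; rewrite /expR -EFin_lim; last exact: is_cvg_series_exp_coeff.
apply: congr_lim; apply/funext => n /=.
by rewrite /series /= /exp_coeff sumEFin.
Qed.

End ereal_limits.

(** * Feynman-Kac functionals *)

Section feynman_kac_functional.
Context (R : realType) (n : nat).
Local Notation E := 'rV[R]_n.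
Local Notation mu := (@lebesgue_measure R).
Local Open Scope ereal_scope.

Section definitions.
Context dO (Omega : measurableType dO) (P : probability Omega R)
  (Z : R -> Omega -> E).

Definition time_int (b : E -> R) (t : R) (x : E) (w : Omega) : \bar R :=
  \int[mu]_(s in `[0%R, t]) (b (x + Z s w)%R)%:E.

(* The potential V is given by the pair a = V^+, b = V^-, so that no
   indeterminate form occurs in the exponent. *)
Definition fk (a b : E -> R) (t : R) (f : E -> \bar R) (x : E) : \bar R :=
  \int[P]_w (expeR (time_int b t x w) * expeR (- time_int a t x w)
             * f (x + Z t w)%R).

End definitions.

Section basic.
Context dO (Omega : measurableType dO) (P : probability Omega R)
  (Z : R -> Omega -> E).
Hypothesis pZ : process Z.
Implicit Types (a b v : E -> R) (f g : E -> \bar R).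

Lemma measurable_path :
  measurable_fun [set: (E * Omega) * R] (fun z => (z.1.1 + Z z.2 z.1.2)%R).
Proof.
case: pZ => mZ _; apply: measurable_funDrV.
  exact: measurableT_comp.
apply: (measurableT_comp mZ (g := fun z : (E * Omega) * R => (z.2, z.1.2))).
apply: measurable_fun_pair => //=.
exact: (measurableT_comp measurable_snd).
Qed.

Lemma measurable_path2 x :
  measurable_fun [set: Omega * R] (fun z => (x + Z z.2 z.1)%R).
Proof.
case: pZ => mZ _; apply: measurable_funDrV => //.
apply: (measurableT_comp mZ (g := fun z : Omega * R => (z.2, z.1))).
exact: measurable_fun_pair.
Qed.

Lemma measurable_path1 x w : measurable_fun [set: R] (fun s => (x + Z s w)%R).
Proof. exact: (measurableT_comp (measurable_path2 x) (pair1_measurable w)). Qed.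

Lemma time_int_ge0 b t x w : (forall y, 0 <= b y)%R -> 0 <= time_int Z b t x w.
Proof. by move=> b0; apply: integral_ge0 => s _; rewrite lee_fin. Qed.

Lemma measurable_time_int b t : measurable_fun [set: E] b ->
  (forall y, 0 <= b y)%R ->
  measurable_fun [set: E * Omega] (fun q => time_int Z b t q.1 q.2).
Proof.
move=> mb b0.
apply: (@measurable_fun_integral_in _ (E * Omega)%type R `[0%R, t]%classic _
  (fun z => (b (z.1.1 + Z z.2 z.1.2)%R)%:E)) => //.
- by apply/measurable_EFinP; exact: (measurableT_comp mb measurable_path).
- by move=> z; rewrite lee_fin.
Qed.

Lemma measurable_time_integrand b x w : measurable_fun [set: E] b ->
  measurable_fun [set: R] (fun s => (b (x + Z s w)%R)%:E).
Proof.
by move=> mb; apply/measurable_EFinP; apply: (measurableT_comp mb);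
  exact: measurable_path1.
Qed.

Lemma time_int_cst K t x w : (0 <= t)%R ->
  time_int Z (cst K) t x w = (K * t)%:E.
Proof.
move=> t0; transitivity (K%:E * mu `[0%R, t]%classic).
  by rewrite -integral_cst.
rewrite lebesgue_measure_itv/= lte_fin.
case: ltP => [_|t0']; first by rewrite sube0 -EFinM.
by have -> : t = 0%R by [apply/eqP; rewrite eq_le t0 t0']; rewrite mule0 mulr0.
Qed.

Lemma le_time_int b b' t x w : measurable_fun [set: E] b ->
  measurable_fun [set: E] b' -> (forall y, 0 <= b y <= b' y)%R ->
  time_int Z b t x w <= time_int Z b' t x w.
Proof.
move=> mb mb' bb'; apply: ge0_le_integral => //.
- by move=> s _; rewrite lee_fin; have /andP[] := bb' (x + Z s w)%R.
- by apply: measurable_funTS; exact: measurable_time_integrand.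
- by apply: measurable_funTS; exact: measurable_time_integrand.
- by move=> s _; rewrite lee_fin; have /andP[] := bb' (x + Z s w)%R.
Qed.

Lemma time_int_le b K t x w : measurable_fun [set: E] b ->
  (forall y, 0 <= b y <= K)%R -> (0 <= t)%R ->
  time_int Z b t x w <= (K * t)%:E.
Proof. by move=> mb bK t0; rewrite -(time_int_cst K x w t0); exact: le_time_int. Qed.

Lemma time_int_fin b K t x w : measurable_fun [set: E] b ->
  (forall y, 0 <= b y <= K)%R -> (0 <= t)%R ->
  time_int Z b t x w \is a fin_num.
Proof.
move=> mb bK t0; rewrite ge0_fin_numE; last first.
  by apply: time_int_ge0 => y; have /andP[] := bK y.
by rewrite (le_lt_trans (time_int_le x w mb bK t0))// ltry.
Qed.

Lemma time_intD b b' t x w : measurable_fun [set: E] b ->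
  measurable_fun [set: E] b' -> (forall y, 0 <= b y)%R ->
  (forall y, 0 <= b' y)%R ->
  time_int Z (b \+ b')%R t x w = time_int Z b t x w + time_int Z b' t x w.
Proof.
move=> mb mb' b0 b'0; rewrite /time_int -ge0_integralD//.
- by move=> s _; rewrite lee_fin.
- by apply: measurable_funTS; exact: measurable_time_integrand.
- by move=> s _; rewrite lee_fin.
- by apply: measurable_funTS; exact: measurable_time_integrand.
Qed.

Lemma minr_nat_nd (b : E -> R) y :
  nondecreasing_seq (fun m => (Num.min (b y) m%:R)%:E : \bar R).
Proof. by move=> i j ij; rewrite !EFin_min; exact: mine_nat_nd. Qed.

Lemma cvg_minr_nat (b : E -> R) y :
  (Num.min (b y) m%:R)%:E @[m --> \oo] --> (b y)%:E.
Proof. by under eq_fun do rewrite EFin_min; exact: cvg_mine_nat. Qed.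

Lemma measurable_minr_nat b m : measurable_fun [set: E] b ->
  measurable_fun [set: E] (fun y => Num.min (b y) m%:R).
Proof. by move=> mb; apply: measurable_minr => //; exact: measurable_cst. Qed.

Lemma minr_nat_ge0 b m y : (forall y, 0 <= b y)%R -> (0 <= Num.min (b y) m%:R)%R.
Proof. by move=> b0; rewrite le_min b0/=. Qed.

Lemma time_int_trunc_nd b t x w : measurable_fun [set: E] b ->
  (forall y, 0 <= b y)%R ->
  nondecreasing_seq (fun m => time_int Z (fun y => Num.min (b y) m%:R) t x w).
Proof.
move=> mb b0 i j ij; apply: le_time_int; try exact: measurable_minr_nat.
by move=> y; rewrite minr_nat_ge0//= -lee_fin; exact: minr_nat_nd.
Qed.

Lemma time_int_trunc_cvg b t x w : measurable_fun [set: E] b ->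
  (forall y, 0 <= b y)%R ->
  time_int Z (fun y => Num.min (b y) m%:R) t x w @[m --> \oo]
    --> time_int Z b t x w.
Proof.
move=> mb b0; rewrite /time_int.
rewrite [X in _ --> X](_ : _ = \int[mu]_(s in `[0%R, t])
   limn (fun m => (Num.min (b (x + Z s w)%R) m%:R)%:E)); last first.
  by apply: eq_integral => s _; apply/esym/cvg_lim => //; exact: cvg_minr_nat.
apply: cvg_monotone_convergence => //.
- move=> m; apply: measurable_funTS.
  apply: (measurable_time_integrand (b := fun y => Num.min (b y) m%:R)).
  exact: measurable_minr_nat.
- by move=> m s _; rewrite lee_fin minr_nat_ge0.
- by move=> s _; exact: minr_nat_nd.
Qed.

Lemma measurable_time_int2 b t x : measurable_fun [set: E] b ->
  (forall y, 0 <= b y)%R -> measurable_fun [set: Omega] (time_int Z b t x).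
Proof.
by move=> mb b0; exact: (measurableT_comp (measurable_time_int t mb b0)
  (pair1_measurable x)).
Qed.

Lemma measurable_path_at f t : measurable_fun [set: E] f ->
  measurable_fun [set: E * Omega] (fun q => f (q.1 + Z t q.2)%R).
Proof.
move=> mf; apply: (measurableT_comp mf); apply: measurable_funDrV => //.
exact: (measurableT_comp (process_at t pZ)).
Qed.

Lemma measurable_path_at2 f t x : measurable_fun [set: E] f ->
  measurable_fun [set: Omega] (fun w => f (x + Z t w)%R).
Proof.
by move=> mf; exact: (measurableT_comp (measurable_path_at t mf)
  (pair1_measurable x)).
Qed.

Lemma measurable_rpath_at2 b t x : measurable_fun [set: E] b ->
  measurable_fun [set: Omega] (fun w => b (x + Z t w)%R).
Proof.
move=> mb; apply: (measurableT_comp mb); apply: measurable_funDrV => //.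
exact: process_at.
Qed.

Section with_ab.
Variables (a b : E -> R).
Hypotheses (ma : measurable_fun [set: E] a) (mb : measurable_fun [set: E] b).
Hypotheses (a0 : forall y, (0 <= a y)%R) (b0 : forall y, (0 <= b y)%R).

Lemma measurable_fk_integrand t f : measurable_fun [set: E] f ->
  measurable_fun [set: E * Omega] (fun q =>
    expeR (time_int Z b t q.1 q.2) * expeR (- time_int Z a t q.1 q.2)
    * f (q.1 + Z t q.2)%R).
Proof.
move=> mf; apply: emeasurable_funM; last exact: measurable_path_at.
apply: emeasurable_funM; apply: measurableT_comp (@measurable_expeR R) _.
  exact: measurable_time_int.
by apply: (measurableT_comp (@oppe_measurable R _)) => //; exact: measurable_time_int.
Qed.

Lemma measurable_fk_integrand2 t f x : measurable_fun [set: E] f ->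
  measurable_fun [set: Omega] (fun w =>
    expeR (time_int Z b t x w) * expeR (- time_int Z a t x w)
    * f (x + Z t w)%R).
Proof.
by move=> mf; exact: (measurableT_comp (measurable_fk_integrand t mf)
  (pair1_measurable x)).
Qed.

Lemma fk_integrand_ge0 t f x w : (forall y, 0 <= f y) ->
  0 <= expeR (time_int Z b t x w) * expeR (- time_int Z a t x w)
       * f (x + Z t w)%R.
Proof. by move=> f0; rewrite !mule_ge0// expeR_ge0. Qed.

Lemma fk_ge0 t f x : (forall y, 0 <= f y) -> 0 <= fk P Z a b t f x.
Proof. by move=> f0; apply: integral_ge0 => w _; exact: fk_integrand_ge0. Qed.

Lemma measurable_fk t f : measurable_fun [set: E] f -> (forall y, 0 <= f y) ->
  measurable_fun [set: E] (fk P Z a b t f).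
Proof.
move=> mf f0.
apply: (@measurable_fun_fubini_tonelli_F _ _ E Omega R P (fun q =>
    expeR (time_int Z b t q.1 q.2) * expeR (- time_int Z a t q.1 q.2)
    * f (q.1 + Z t q.2)%R)); first exact: measurable_fk_integrand.
by move=> q; exact: fk_integrand_ge0.
Qed.

End with_ab.

End basic.

(** * Feynman-Kac functionals depend only on the law of the increments *)

Section comparison.
Variables (law : R -> set E -> \bar R) (c T : R).
Hypothesis cT : (0 <= c <= T)%R.
Context dO (Omega : measurableType dO) (P : probability Omega R).
Context dO' (Omega' : measurableType dO') (P' : probability Omega' R).
Variables (Z : R -> Omega -> E) (Z' : R -> Omega' -> E).
Hypotheses (pZ : process Z) (pZ' : process Z').
Hypotheses (hZ : has_increments law c T P Z) (hZ' : has_increments law c T P' Z').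
Variable t : R.
Hypothesis tT : (0 <= t <= T)%R.

Section bounded_potential.
Variables (v : E -> R) (f : E -> \bar R) (x : E).
Hypotheses (mv : measurable_fun [set: E] v) (v0 : forall y, (0 <= v y)%R).
Hypotheses (mf : measurable_fun [set: E] f) (f0 : forall y, 0 <= f y).

(** A power of the occupation integral, weighted by [v] at the times of [l]. The list collects the
    times already extracted from the power. *)
Let mom dX (X : measurableType dX) (Q : probability X R) (Y : R -> X -> E)
    (l : seq R) k :=
  \int[Q]_w ((\prod_(u <- l) v (x + Y u w))%:E * (time_int Y v t x w) ^+ k
    * f (x + Y t w)%R).

Let meas_prod dX (X : measurableType dX) (Y : R -> X -> E) l : process Y ->
  measurable_fun [set: X] (fun w => (\prod_(u <- l) v (x + Y u w)%R)%:E).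
Proof.
move=> pY; apply/measurable_EFinP; apply: measurable_prod => u _.
exact: (measurable_rpath_at2 pY u x mv).
Qed.

Let meas_pow dX (X : measurableType dX) (Y : R -> X -> E) k : process Y ->
  measurable_fun [set: X] (fun w => (time_int Y v t x w) ^+ k).
Proof.
move=> pY; elim: k => [|k IHk]; first exact: measurable_cst.
under eq_fun do rewrite expeS.
by apply: emeasurable_funM => //; exact: measurable_time_int2.
Qed.

Let pow_ge0 dX (X : measurableType dX) (Y : R -> X -> E) k w :
  0 <= (time_int Y v t x w) ^+ k.
Proof. by rewrite expe_ge0// time_int_ge0. Qed.

Let prod_ge0 dX (X : measurableType dX) (Y : R -> X -> E) l w :
  0 <= (\prod_(u <- l) v (x + Y u w)%R)%:E.
Proof. by rewrite lee_fin prodr_ge0. Qed.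

(** One factor of the power is an integral over a time s. Tonelli moves this integral outside the
    expectation, and s joins the list. *)
Let momS dX (X : measurableType dX) (Q : probability X R) (Y : R -> X -> E)
    l k : process Y ->
  mom Q Y l k.+1 = \int[mu]_(s in `[0%R, t]) mom Q Y (s :: l) k.
Proof.
move=> pY; rewrite /mom.
rewrite -(@tonelli_in _ X R `[0%R, t]%classic _ (fun z =>
   ((\prod_(u <- z.2 :: l) v (x + Y u z.1))%:E *
     (time_int Y v t x z.1) ^+ k * f (x + Y t z.1)%R)))//; first last.
- by move=> z; rewrite !mule_ge0.
- apply: emeasurable_funM; last first.
    exact: (measurableT_comp (measurable_path_at2 pY t x mf)).
  apply: emeasurable_funM; last exact: (measurableT_comp (meas_pow k pY)).
  apply/measurable_EFinP; under eq_fun do rewrite big_cons.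
  apply: measurable_funM; last first.
    have /measurable_EFinP := @meas_prod _ _ _ l pY.
    by move=> /measurableT_comp; apply.
  apply: (measurableT_comp mv).
  exact: measurable_path2.
apply: eq_integral => w _; rewrite expeS /=.
transitivity (\int[mu]_(s in `[0%R, t]) ((v (x + Y s w))%:E *
   ((\prod_(u <- l) v (x + Y u w))%:E * time_int Y v t x w ^+ k
     * f (x + Y t w)%R))); last first.
  by apply: eq_integral => s _; rewrite big_cons EFinM !muleA.
rewrite ge0_integralZr//; first by rewrite muleCA !muleA.
- apply/measurable_EFinP; apply: measurable_funTS; apply: (measurableT_comp mv).
  exact: measurable_path1.
- by move=> s _; rewrite lee_fin.
- by rewrite !mule_ge0.
Qed.

Lemma moment_eq l k : all (fun u => 0 <= u <= t)%R l ->
  mom P Z l k = mom P' Z' l k.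
Proof.
elim: k l => [|k IHk] l hl; last first.
  rewrite !momS//; apply: eq_integral => s; rewrite inE /= in_itv /= => st.
  by apply: IHk; rewrite /= st.
(* Once the power is exhausted, the integrand is a function of finitely many positions: entry 0 is
   the one at t, the others those at the times of [l]. *)
pose Phi (s : (size l).+1.-tuple E) :=
  (\prod_(i < size l) v (x + tnth s (lift ord0 i)))%:E
  * f (x + tnth s ord0)%R.
have mPhi : measurable_fun [set: (size l).+1.-tuple E] Phi.
  apply: emeasurable_funM.
    apply/measurable_EFinP; apply: measurable_prod => i _.
    by apply: (measurableT_comp mv); apply: measurable_funDrV => //;
      exact: measurable_tnth.
  by apply: (measurableT_comp mf); apply: measurable_funDrV => //;
      exact: measurable_tnth.
have momE dX (X : measurableType dX) (Q : probability X R) (Y : R -> X -> E) :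
  mom Q Y l 0 = \int[Q]_w Phi [tuple Y (nth 0%R (t :: l) i) w | i < (size l).+1].
  apply: eq_integral => w _; rewrite /Phi !tnth_mktuple /= mule1; congr (_%:E * _).
  rewrite (big_nth 0%R) big_mkord; apply: eq_bigr => i _.
  by rewrite tnth_mktuple.
rewrite !momE; apply: (fdd_integral cT pZ pZ' hZ hZ') => //.
  case/andP : tT => t0 tT' -[[|i] /= il]; first exact/andP.
  move/allP : hl => /(_ (nth 0%R l i)); rewrite mem_nth// => /(_ isT)/andP[-> /=].
  by move=> /le_trans; apply.
by move=> s; rewrite mule_ge0// lee_fin prodr_ge0.
Qed.

(** For bounded [v] the occupation integral is finite, so its exponential is a power series with
    nonnegative terms, which is integrated term by term. *)
Lemma expeR_time_int_eq (K : R) : (forall y, v y <= K)%R ->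
  \int[P]_w (expeR (time_int Z v t x w) * f (x + Z t w)%R) =
  \int[P']_w (expeR (time_int Z' v t x w) * f (x + Z' t w)%R).
Proof.
move=> vK.
have H dX (X : measurableType dX) (Q : probability X R) (Y : R -> X -> E) :
    process Y ->
  \int[Q]_w (expeR (time_int Y v t x w) * f (x + Y t w)%R) =
  \sum_(0 <= k <oo) (k`!%:R^-1)%:E * mom Q Y [::] k.
  move=> pY; transitivity (\int[Q]_w \sum_(0 <= k <oo)
    ((k`!%:R^-1)%:E * ((\prod_(u <- [::]) v (x + Y u w))%:E *
      (time_int Y v t x w) ^+ k * f (x + Y t w)%R))).
    apply: eq_integral => w _.
    have Afin : time_int Y v t x w \is a fin_num.
      apply: (time_int_fin pY x w mv (K := K)); last by case/andP : tT.
      by move=> y; rewrite v0 vK.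
    have A0 := @time_int_ge0 _ X Y v t x w v0; move: (time_int Y v t x w) A0 Afin => [A||]//=.
    rewrite lee_fin => A0 _; rewrite expR_nneseries// -nneseriesMr//; last first.
      by move=> k; rewrite lee_fin divr_ge0// exprn_ge0.
    apply: eq_eseriesr => k _; rewrite big_nil mul1e -EFin_expe muleA -EFinM.
    by rewrite mulrC.
  have mm k : measurable_fun [set: X] (fun w =>
      (\prod_(u <- [::]) v (x + Y u w))%:E * (time_int Y v t x w) ^+ k
      * f (x + Y t w)%R).
    apply: emeasurable_funM; last exact: (measurable_path_at2 pY t x mf).
    by apply: emeasurable_funM; [exact: meas_prod|exact: meas_pow].
  have m0 k w : 0 <= (\prod_(u <- [::]) v (x + Y u w))%:E
      * (time_int Y v t x w) ^+ k * f (x + Y t w)%R.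
    by rewrite !mule_ge0.
  rewrite integral_nneseries//.
  - by apply: eq_eseriesr => k _; rewrite ge0_integralZl.
  - by move=> k; exact: measurable_funeM.
  - by move=> k w _; rewrite mule_ge0.
by rewrite !H//; apply: eq_eseriesr => k _; rewrite moment_eq.
Qed.

End bounded_potential.

Section fk_eq.
Variables (a b : E -> R).
Hypotheses (ma : measurable_fun [set: E] a) (mb : measurable_fun [set: E] b).
Hypotheses (a0 : forall y, (0 <= a y)%R) (b0 : forall y, (0 <= b y)%R).

Let t0 : (0 <= t)%R. Proof. by case/andP : tT. Qed.

Lemma fk_eq_bounded (A B : R) f x : (forall y, a y <= A)%R ->
  (forall y, b y <= B)%R ->
  measurable_fun [set: E] f -> (forall y, 0 <= f y) ->
  fk P Z a b t f x = fk P' Z' a b t f x.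
Proof.
move=> aA bB mf f0.
(* Adding the constant [A] makes b - a nonnegative, at the price of a factor exp(- A t). *)
pose v y := (A - a y + b y)%R.
have mv : measurable_fun [set: E] v.
  by apply: measurable_funD => //; exact: measurable_funB.
have v0 y : (0 <= v y)%R by rewrite addr_ge0// subr_ge0.
have vK y : (v y <= A + B)%R.
  by rewrite lerD// lerBlDr lerDl.
have H dX (X : measurableType dX) (Q : probability X R) (Y : R -> X -> E) :
    process Y -> fk Q Y a b t f x =
  (expR (- (A * t)))%:E * \int[Q]_w (expeR (time_int Y v t x w) * f (x + Y t w)%R).
  move=> pY; rewrite -ge0_integralZl//; first last.
  - by move=> w _; rewrite mule_ge0// expeR_ge0.
  - apply: emeasurable_funM; last exact: (measurable_path_at2 pY t x mf).
    apply: (measurableT_comp (@measurable_expeR R)).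
    exact: measurable_time_int2.
  apply: eq_integral => w _; rewrite muleA; congr (_ * _).
  have fv : time_int Y v t x w \is a fin_num.
    by apply: (time_int_fin pY x w mv (K := (A + B)%R)) => // y; rewrite v0 vK.
  have fa : time_int Y a t x w \is a fin_num.
    by apply: (time_int_fin pY x w ma (K := A)) => // y; rewrite a0 aA.
  have fb : time_int Y b t x w \is a fin_num.
    by apply: (time_int_fin pY x w mb (K := B)) => // y; rewrite b0 bB.
  have : time_int Y v t x w + time_int Y a t x w =
         (A * t)%:E + time_int Y b t x w.
    rewrite -time_intD// -(time_int_cst Y A x w t0) -time_intD//.
      by apply: eq_integral => s _; congr (_%:E); rewrite /v /=; ring.
    by move=> y; rewrite (le_trans (a0 x))//= aA.
  rewrite -(fineK fv) -(fineK fa) -(fineK fb) -!EFinD => -[h] /=.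
  rewrite -!EFinM -!expRD; congr (expR _)%:E; lra.
by rewrite !H// (@expeR_time_int_eq v f x mv v0 mf f0 (A + B)%R).
Qed.

End fk_eq.

End comparison.

Section fk_limits.
Context dO (Omega : measurableType dO) (P : probability Omega R)
  (Z : R -> Omega -> E).
Hypothesis pZ : process Z.
Variables (a b : E -> R) (t : R).
Hypotheses (ma : measurable_fun [set: E] a) (mb : measurable_fun [set: E] b).
Hypotheses (a0 : forall y, (0 <= a y)%R) (b0 : forall y, (0 <= b y)%R).
Hypothesis t0 : (0 <= t)%R.

(** Raising the truncation level of [a] decreases the functional, so the limit is taken by
    domination; the bounds on [b] and [f] supply the dominating constant. *)
Lemma fk_cvg_pos (B : R) f (M : R) x : (forall y, b y <= B)%R ->
  measurable_fun [set: E] f -> (forall y, 0 <= f y <= M%:E) ->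
  fk P Z (fun y => Num.min (a y) m%:R) b t f x @[m --> \oo]
    --> fk P Z a b t f x.
Proof.
move=> bB mf fM; apply: (@dominated_cvg _ _ _ _ _ _ _ _
    (cst (expR (B * t) * M)%:E)) => //.
- move=> m; apply: measurable_fk_integrand2 => //; first exact: measurable_minr_nat.
  by move=> y; exact: minr_nat_ge0.
- move=> w _; apply: cvgeZr.
    have /andP[h1 h2] := fM (x + Z t w)%R.
    by rewrite ge0_fin_numE// (le_lt_trans h2)// ltry.
  apply: cvgeZl.
    have fb : time_int Z b t x w \is a fin_num.
      by apply: (time_int_fin pZ x w mb (K := B)) => // y; rewrite b0 bB.
    by rewrite -(fineK fb).
  apply: cvg_expeRN_nd; first exact: time_int_trunc_nd.
  exact: time_int_trunc_cvg.
- exact: finite_measure_integrable_cst.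
- move=> m w _; have /andP[h1 h2] := fM (x + Z t w)%R.
  rewrite gee0_abs ?mule_ge0 ?expeR_ge0//= EFinM.
  apply: lee_pmul => //; first by rewrite mule_ge0// expeR_ge0.
  rewrite -[leRHS]mule1; apply: lee_pmul; rewrite ?expeR_ge0//.
    rewrite -[leRHS]/(expeR (B * t)%:E) lee_expeR; apply: time_int_le => // y.
    by rewrite b0 bB.
  rewrite -expeR0 lee_expeR oppe_le0; apply: time_int_ge0 => y.
  exact: minr_nat_ge0.
Qed.

(** Truncating [b] and [f] approximates the functional from below, so monotone convergence applies
    and the limit may be infinite. *)
Lemma fk_cvg_neg f x : measurable_fun [set: E] f -> (forall y, 0 <= f y) ->
  fk P Z a (fun y => Num.min (b y) m%:R) t (fun y => mine (f y) m%:R%:E) x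
    @[m --> \oo] --> fk P Z a b t f x.
Proof.
move=> mf f0.
pose g m w := expeR (time_int Z (fun y => Num.min (b y) m%:R) t x w) *
  expeR (- time_int Z a t x w) * mine (f (x + Z t w)%R) m%:R%:E.
have ndb w : nondecreasing_seq (fun m =>
     expeR (time_int Z (fun y => Num.min (b y) m%:R) t x w) *
  expeR (- time_int Z a t x w)).
  move=> i j ij; apply: lee_pmul; rewrite ?expeR_ge0// lee_expeR.
  exact: time_int_trunc_nd.
have g0 (m : nat) y : 0 <= mine (f y) m%:R%:E by rewrite le_min f0 lee_fin/=.
rewrite [X in _ --> X](_ : _ = \int[P]_w limn (g ^~ w)).
  apply: cvg_monotone_convergence => //.
  - move=> m; apply: (@measurable_fk_integrand2 _ _ Z pZ _ _ _ _ _ _ t (fun y => mine (f y) m%:R%:E)) => //.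
    + exact: measurable_minr_nat.
    + by move=> y; exact: minr_nat_ge0.
    + exact: measurable_mine.
  - by move=> m w _; rewrite !mule_ge0// expeR_ge0.
  - move=> w _ i j ij; apply: lee_pmul => //.
    + by rewrite !mule_ge0// expeR_ge0.
    + exact: ndb.
    + exact: mine_nat_nd.
apply: eq_integral => w _; apply/esym/cvg_lim => //.
apply: nd_cvgeM => //.
- by move=> m; rewrite !mule_ge0// expeR_ge0.
- exact: mine_nat_nd.
- apply: (@nd_cvgeM _ _ (fun=> _)) => //; try by move=> m; exact: expeR_ge0.
  + move=> i j ij; rewrite lee_expeR; exact: time_int_trunc_nd.
  + apply: cvg_expeR_nd; [exact: time_int_trunc_nd|exact: time_int_trunc_cvg].
  + exact: cvg_cst.
- exact: cvg_mine_nat.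
Qed.

End fk_limits.

Section comparison_unbounded.
Variables (law : R -> set E -> \bar R) (c T : R).
Hypothesis cT : (0 <= c <= T)%R.
Context dO (Omega : measurableType dO) (P : probability Omega R).
Context dO' (Omega' : measurableType dO') (P' : probability Omega' R).
Variables (Z : R -> Omega -> E) (Z' : R -> Omega' -> E).
Hypotheses (pZ : process Z) (pZ' : process Z').
Hypotheses (hZ : has_increments law c T P Z) (hZ' : has_increments law c T P' Z').

(** The truncation of [a] is removed first, while [b] and [f] are still cut at m and domination is
    available; then m tends to infinity monotonically. *)
Lemma fk_eq (a b : E -> R) t f x : (0 <= t <= T)%R ->
  measurable_fun [set: E] a -> measurable_fun [set: E] b ->
  (forall y, (0 <= a y)%R) -> (forall y, (0 <= b y)%R) ->
  measurable_fun [set: E] f -> (forall y, 0 <= f y) ->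
  fk P Z a b t f x = fk P' Z' a b t f x.
Proof.
move=> tT ma mb a0 b0 mf f0.
have t0 : (0 <= t)%R by case/andP : tT.
pose u dX (X : measurableType dX) (Q : probability X R) (Y : R -> X -> E) m :=
  fk Q Y a (fun y => Num.min (b y) m%:R) t (fun y => mine (f y) m%:R%:E) x.
have uE : u _ _ P Z = u _ _ P' Z'.
  apply/funext => m; rewrite /u.
  set b' := fun y => Num.min (b y) m%:R; set f' := fun y => mine (f y) m%:R%:E.
  have mb' : measurable_fun [set: E] b' by exact: measurable_minr_nat.
  have b'0 y : (0 <= b' y)%R by exact: minr_nat_ge0.
  have b'm y : (b' y <= m%:R)%R by rewrite /b' ge_min lexx orbT.
  have mf' : measurable_fun [set: E] f' by exact: measurable_mine.
  have f'm y : 0 <= f' y <= m%:R%:E.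
    by rewrite /f' le_min f0 lee_fin/= ler0n/= ge_min lexx orbT.
  pose w dX (X : measurableType dX) (Q : probability X R) (Y : R -> X -> E) k :=
    fk Q Y (fun y => Num.min (a y) k%:R) b' t f' x.
  have wE : w _ _ P Z = w _ _ P' Z'.
    apply/funext => k.
    apply: (fk_eq_bounded cT pZ pZ' hZ hZ' tT _ _ _ b'0 (A := k%:R) (B := m%:R)) => //.
    - exact: measurable_minr_nat.
    - by move=> y; exact: minr_nat_ge0.
    - by move=> y; rewrite ge_min lexx orbT.
    - by move=> y; have /andP[] := f'm y.
  have h : w _ _ P Z @ \oo --> fk P Z a b' t f' x.
    exact: fk_cvg_pos b'm mf' f'm.
  have h' : w _ _ P Z @ \oo --> fk P' Z' a b' t f' x.
    by rewrite wE; exact: fk_cvg_pos b'm mf' f'm.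
  exact: (cvg_unique _ h h').
have h : u _ _ P Z @ \oo --> fk P Z a b t f x by exact: fk_cvg_neg.
have h' : u _ _ P Z @ \oo --> fk P' Z' a b t f x.
  by rewrite uE; exact: fk_cvg_neg.
exact: (cvg_unique _ h h').
Qed.

End comparison_unbounded.

End feynman_kac_functional.

(** * Semigroup property and symmetry *)

Section levy_semigroup.
Context (R : realType) (n : nat).
Local Notation E := 'rV[R]_n.
Local Notation mu := (@lebesgue_measure R).
Local Open Scope ereal_scope.
Context dO (Omega : measurableType dO) (P : probability Omega R)
  (Z : R -> Omega -> E).

Definition law (h : R) (A : set E) : \bar R := P (Z h @^-1` A).

Record levy : Prop := Levy {
  levy_process_of : process Z ;
  levy_increments : forall c T, has_increments law c T P Z ;
  levy_symmetric : forall h (A : set E), (0 <= h)%R -> measurable A ->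
    law h [set x : E | A (- x)%R] = law h A ;
  levy_rc : forall w t, (0 <= t)%R -> Z s w @[s --> t^'+] --> Z t w }.

Hypothesis hZ : levy.
Let pZ := levy_process_of hZ.

Lemma increments_mono m (u : nat -> R) i j :
  (forall i, (i < m)%N -> (u i < u i.+1)%R) -> (i <= j)%N -> (j <= m)%N ->
  (u i <= u j)%R.
Proof.
move=> um; elim: j => [|j IHj]; first by rewrite leqn0 => /eqP ->.
rewrite leq_eqVlt ltnS => /predU1P[-> //|ij] jm.
by rewrite (le_trans (IHj ij (ltnW jm)))// ltW// um.
Qed.

Lemma measurable_increments m (u : nat -> R) (A : nat -> set E) k :
  (forall i, measurable (A i)) ->
  measurable [set w | forall i, (k <= i < m)%N -> A i (Z (u i.+1) w - Z (u i) w)%R].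
Proof.
move=> mA.
rewrite (_ : mkset _ = \bigcap_(i in [set i | (k <= i < m)%N])
  (fun w => (Z (u i.+1) w - Z (u i) w)%R) @^-1` A i); last first.
  by apply/seteqP; split => w /= h i; exact: h.
apply: bigcap_measurableType => i _; rewrite -[X in measurable X]setTI.
by apply: measurable_funBrV => //; exact: process_at.
Qed.

Section semigroup.
Variables (t s : R).
Hypotheses (t0 : (0 <= t)%R) (s0 : (0 <= s)%R).

(** Two independent copies glued at time t: the second one restarts from the position reached by the
    first. *)
Let Y (u : R) (z : Omega * Omega) : E :=
  if (u <= t)%R then Z u z.1 else (Z t z.1 + Z (u - t) z.2)%R.

Let YE u z : (t <= u)%R -> Y u z = (Z t z.1 + Z (u - t) z.2)%R.
Proof.
rewrite /Y le_eqVlt => /predU1P[<-|tu]; last by rewrite leNgt tu.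
by rewrite lexx subrr (process_start pZ) addr0.
Qed.

Let pY : process Y.
Proof.
split; last by move=> z; rewrite /Y t0; exact: process_start.
case: pZ => mZ _.
apply: measurable_fun_ifT.
- exact: measurable_fun_ler.
- apply: (measurableT_comp mZ (g := fun z : R * (Omega * Omega) => (z.1, z.2.1))).
  apply: measurable_fun_pair => //.
  exact: (measurableT_comp measurable_fst).
- apply: measurable_funDrV.
    apply: (measurableT_comp (process_at t pZ)).
    exact: (measurableT_comp measurable_fst).
  apply: (measurableT_comp mZ
    (g := fun z : R * (Omega * Omega) => ((z.1 - t)%R, z.2.2))).
  apply: measurable_fun_pair; first exact: measurable_funB.
  exact: (measurableT_comp measurable_snd).
Qed.

Let PP : probability (Omega * Omega)%type R := (P \x P).

(** The subdivision meets t at index [k], so earlier increments belong to the first copy and later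
    ones to the second. The event is a product set, and both factors are given by the increments of
    [Z]. *)
Let hY : has_increments law t (t + s) PP Y.
Proof.
move=> m u A u0 um umT [k km uk] mA.
rewrite (_ : [set w | _] =
  [set w | forall i, (0 <= i < k)%N -> A i (Z (u i.+1) w - Z (u i) w)%R] `*`
  [set w | forall i, (0 <= i < m - k)%N -> A (i + k)%N
     (Z (u (i + k).+1 - t) w - Z (u (i + k)%N - t) w)%R]); last first.
  apply/seteqP; split => -[w1 w2] /=.
    move=> h; split=> i ik.
      have := h i (leq_trans ik km); rewrite /Y /=.
      have -> : (u i.+1 <= t)%R by rewrite -uk (increments_mono um).
      by have -> : (u i <= t)%R by rewrite -uk (increments_mono um)// ltnW.
    have ikm : (i + k < m)%N by rewrite -ltn_subRL -subn_gt0 -subnDA addnC subnDA subn_gt0.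
    have := h (i + k)%N ikm; rewrite !YE /=.
    - by rewrite opprD addrACA subrr add0r.
    - by rewrite -uk (increments_mono um)// ?leq_addl// ltnW.
    - by rewrite -uk (increments_mono um)// leqW// leq_addl.
  move=> [h1 h2] i im; have [ik|ki] := ltnP i k.
    rewrite /Y /=.
    have -> : (u i.+1 <= t)%R by rewrite -uk (increments_mono um).
    have -> : (u i <= t)%R by rewrite -uk (increments_mono um)// ltnW.
    exact: h1.
  rewrite !YE /=; first last.
  - by rewrite -uk (increments_mono um)// ?leqW// ltnW.
  - by rewrite -uk (increments_mono um)// ?leqW// ltnW.
  rewrite opprD addrACA subrr add0r.
  by have := h2 (i - k)%N; rewrite subnK//; apply; rewrite ltn_sub2r// (leq_ltn_trans ki).
rewrite /= product_measure1E; first last.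
- exact: (@measurable_increments (m - k) (fun i => u (i + k)%N - t)%R
    (fun i => A (i + k)%N) 0%N (fun i => mA (i + k)%N)).
- exact: (@measurable_increments k u A 0%N mA).
rewrite (big_cat_nat (leq0n k) km)/=; congr (_ * _).
  have := @levy_increments hZ t t k u A u0; rewrite uk; apply => //.
  - by move=> i ik; apply: um; exact: leq_trans km.
  - by exists k.
rewrite -[in RHS](add0n k) big_addn.
have := @levy_increments hZ 0%R s (m - k)%N (fun i => u (i + k)%N - t)%R
  (fun i => A (i + k)%N).
rewrite /= add0n uk subrr => ->//.
- by apply: eq_bigr => i _; rewrite addSn opprB addrA subrK.
- by move=> i ik; rewrite ltrD2r addSn um// -ltn_subRL -subn_gt0 -subnDA addnC subnDA subn_gt0.
- by rewrite subnK// lerBlDr addrC.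
- by exists 0%N => //; rewrite add0n uk subrr.
Qed.

Variables (a b : E -> R).
Hypotheses (ma : measurable_fun [set: E] a) (mb : measurable_fun [set: E] b).
Hypotheses (a0 : forall y, (0 <= a y)%R) (b0 : forall y, (0 <= b y)%R).

Let time_intY (v : E -> R) x w w' : measurable_fun [set: E] v -> (forall y, (0 <= v y)%R) ->
  time_int Y v (t + s) x (w, w') =
  time_int Z v t x w + time_int Z v s (x + Z t w)%R w'.
Proof.
move=> mv v0; rewrite /time_int.
have tts : (t <= t + s)%R by rewrite lerDl.
rewrite (_ : `[0%R, (t + s)%R]%classic = `[0%R, t]%classic `|` `]t, (t + s)%R]%classic); last first.
  by rewrite -itv_bndbnd_setU// bnd_simp.
rewrite ge0_integral_setU//; first last.
- apply/disj_setPLR => u /=; rewrite !in_itv /= => /andP[_ ut].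
  by apply/negP; rewrite negb_and -leNgt ut.
- by move=> u _; rewrite lee_fin.
- apply: measurable_funTS; exact: measurable_time_integrand.
congr (_ + _).
  apply: eq_integral => u; rewrite inE /= in_itv /= => /andP[_ ut].
  by rewrite /Y ut.
rewrite -(@ge0_integral_shift R (- t) `[0%R, s]%classic
  (fun u => (v (x + Z t w + Z u w')%R)%:E))//; first last.
- by move=> u; rewrite lee_fin.
- exact: (measurable_time_integrand pZ).
rewrite (_ : [set u | `[0%R, s]%classic (u - t)%R] = `[t, (t + s)%R]%classic); last first.
  by apply/seteqP; split => u /=; rewrite !in_itv /= subr_ge0 lerBlDr (addrC s).
(* The shift produces the interval closed at t and the decomposition the one open at t; they differ
   by one point. *)
rewrite -[RHS]integral_itv_obnd_cbnd; last first.
  apply: measurable_funTS; apply/measurable_EFinP; apply: (measurableT_comp mv).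
  apply: (measurableT_comp (measurable_path1 pZ (x + Z t w)%R w')).
  exact: measurable_funB.
apply: eq_integral => u; rewrite inE /= in_itv /= => /andP[tu _].
by rewrite YE ?ltW// addrA.
Qed.

(** The Markov property: [Z] may be replaced by the glued process [Y], whose functional is a factor
    of the first copy times a functional of the second, and Tonelli integrates the second copy
    first. *)
Lemma fk_semigroup f x : measurable_fun [set: E] f -> (forall y, 0 <= f y) ->
  fk P Z a b (t + s)%R f x = fk P Z a b t (fk P Z a b s f) x.
Proof.
move=> mf f0.
have tts : (0 <= t <= t + s)%R by rewrite t0/= lerDl.
have ts0 : (0 <= t + s <= t + s)%R by rewrite lexx addr_ge0.
rewrite (fk_eq tts pZ pY (@levy_increments hZ t (t + s)%R) hY x ts0 ma mb a0 b0 mf f0).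
rewrite {1}/fk.
rewrite (@fubini_tonelli1 _ _ Omega Omega R P P (fun z =>
  expeR (time_int Y b (t + s) x z) * expeR (- time_int Y a (t + s) x z) *
   f (x + Y (t + s) z)%R)) /=; first last.
- by move=> z; exact: fk_integrand_ge0.
- exact: measurable_fk_integrand2.
apply: eq_integral => w _; rewrite /fubini_F /=.
rewrite -ge0_integralZl//; first last.
- by rewrite mule_ge0// expeR_ge0.
- by move=> w' _; exact: fk_integrand_ge0.
- exact: measurable_fk_integrand2.
apply: eq_integral => w' _.
rewrite !time_intY// YE; last by case/andP : tts.
rewrite /= [in X in Z X w'](addrC t) addrK (addrA x).
have A1 : 0 <= time_int Z a t x w by exact: time_int_ge0.
have A2 : 0 <= time_int Z a s (x + Z t w)%R w' by exact: time_int_ge0.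
(* Both integrals of [a] are nonnegative, so their sum may be +oo but is never indeterminate. *)
rewrite (@oppeD _ (time_int Z a t x w)); last by rewrite ge0_adde_def// inE.
rewrite (expeRD (time_int Z b t x w)) (expeRD (- time_int Z a t x w)).
by rewrite muleACA -!muleA.
Qed.

End semigroup.

Section symmetry.
Variable t : R.
Hypothesis t0 : (0 <= t)%R.

(** The path run backwards from time t, recentred so as to start at 0. *)
Let W (u : R) (w : Omega) : E := (Z (t - u) w - Z t w)%R.

Let pW : process W.
Proof.
split; last by move=> w; rewrite /W subr0 subrr.
case: pZ => mZ _; apply: measurable_funBrV.
  apply: (measurableT_comp mZ (g := fun z : R * Omega => ((t - z.1)%R, z.2))).
  by apply: measurable_fun_pair => //; exact: measurable_funB.
exact: (measurableT_comp (process_at t pZ)).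
Qed.

(** The increments of [W] are the opposites of those of [Z] along the reflected subdivision, in
    reverse order; symmetry of the law removes the sign. Taking c = T = t forces the subdivision to
    end at t, so that its reflection starts at 0. *)
Let hW : has_increments law t t P W.
Proof.
move=> m u A u0 um umt [k km uk] mA.
have uE : u m = t.
  by apply/eqP; rewrite eq_le umt -uk (increments_mono um).
pose r j := (t - u (m - j)%N)%R.
pose B j := [set x : E | A (m - j.+1)%N (- x)%R].
have mB j : measurable (B j).
  rewrite -[X in measurable X]setTI.
  by apply: (@measurable_funNrV R n _ E id) => //.
have E i w : (i < m)%N -> B i (Z (r i.+1) w - Z (r i) w)%R =
    A (m - i.+1)%N (W (u (m - i.+1).+1) w - W (u (m - i.+1)%N) w)%R.
  move=> im; rewrite /B /r /W /= subnSK//; congr (A _ _).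
  by rewrite !opprB addrA subrK.
rewrite (_ : [set w | _] =
  [set w | forall i, (i < m)%N -> B i (Z (r i.+1) w - Z (r i) w)%R]); last first.
  apply/seteqP; split => w /= h i im.
    by rewrite E//; apply: h; rewrite ltn_subrL/= (leq_ltn_trans _ im).
  have im' : (m - i.+1 < m)%N by rewrite ltn_subrL/= (leq_ltn_trans _ im).
  have := h (m - i.+1)%N im'; rewrite E//.
  by rewrite subnSK// subKn// ltnW.
rewrite (@levy_increments hZ 0%R t)//.
- rewrite [RHS]big_nat_rev /= add0n; apply: eq_big_nat => i /andP[_ im].
  rewrite /r subnSK// (_ : (_ - _ - _ = u (m - i)%N - u (m - i.+1)%N)%R).
    apply: (levy_symmetric hZ) => //.
    by rewrite subr_ge0 (increments_mono um)// ?leq_subr// leq_sub2l.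
  by rewrite opprB addrC addrA subrK.
- by rewrite /r subn0 uE subrr.
- move=> i im; rewrite /r ltrD2l ltrN2 -(subnSK im); apply: um.
  by rewrite ltn_subrL/= (leq_ltn_trans _ im).
- by rewrite /r subnn u0 subr0.
- by exists 0%N => //; rewrite /r subn0 uE subrr.
Qed.

Let time_intW (b : E -> R) y w : measurable_fun [set: E] b ->
  (forall z, (0 <= b z)%R) ->
  time_int W b t y w = time_int Z b t (y - Z t w)%R w.
Proof.
move=> mb b0; rewrite /time_int.
rewrite -(@ge0_integral_rev R t (fun s => (b (y - Z t w + Z s w)%R)%:E)).
- by apply: eq_integral => s _; rewrite /W addrA addrAC.
- exact: (measurable_time_integrand pZ).
- by move=> s; rewrite lee_fin.
Qed.

(** For a fixed path, replacing x by x - Z_t exchanges the two ends: [f] is taken at x, [g] at x +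
    W_t, and the occupation integrals become those of [W]. Translation invariance of Lebesgue
    measure allows this, and [W] may then be replaced by [Z]. *)
Lemma fk_symmetric (a b : E -> R) (f g : E -> \bar R) :
  measurable_fun [set: E] a -> measurable_fun [set: E] b ->
  (forall y, (0 <= a y)%R) -> (forall y, (0 <= b y)%R) ->
  measurable_fun [set: E] f -> (forall y, 0 <= f y) ->
  measurable_fun [set: E] g -> (forall y, 0 <= g y) ->
  \int[lebesgue_rV]_x (g x * fk P Z a b t f x) =
  \int[lebesgue_rV]_x (f x * fk P Z a b t g x).
Proof.
move=> ma mb a0 b0 mf f0 mg g0.
have mF (h k : E -> \bar R) (Y : R -> Omega -> E) : process Y ->
    measurable_fun [set: E] h -> measurable_fun [set: E] k ->
    measurable_fun [set: E * Omega] (fun q => h q.1 *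
      (expeR (time_int Y b t q.1 q.2) * expeR (- time_int Y a t q.1 q.2)
    * k (q.1 + Y t q.2)%R)).
  move=> pY mh mk; apply: emeasurable_funM; first exact: (measurableT_comp mh).
  exact: measurable_fk_integrand.
have F0 (h k : E -> \bar R) (Y : R -> Omega -> E) x w :
    (forall y, 0 <= h y) -> (forall y, 0 <= k y) ->
    0 <= h x * (expeR (time_int Y b t x w) * expeR (- time_int Y a t x w)
    * k (x + Y t w)%R).
  by move=> h0 k0; rewrite mule_ge0// fk_integrand_ge0.
have H (h k : E -> \bar R) (Y : R -> Omega -> E) : process Y ->
    measurable_fun [set: E] h -> (forall y, 0 <= h y) ->
    measurable_fun [set: E] k -> (forall y, 0 <= k y) ->
    \int[lebesgue_rV]_x (h x * fk P Y a b t k x) =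
    \int[P]_w \int[lebesgue_rV]_x (h x *
      (expeR (time_int Y b t x w) * expeR (- time_int Y a t x w)
    * k (x + Y t w)%R)).
  move=> pY mh h0 mk k0.
  rewrite -(@fubini_tonelli _ _ E Omega R lebesgue_rV P (fun q => h q.1 *
      (expeR (time_int Y b t q.1 q.2) * expeR (- time_int Y a t q.1 q.2)
    * k (q.1 + Y t q.2)%R)))//=; first last.
  - by move=> z; exact: F0.
  - exact: mF.
  apply: eq_integral => x _; rewrite -ge0_integralZl//.
  - exact: measurable_fk_integrand2.
  - by move=> w _; exact: fk_integrand_ge0.
rewrite H//.
transitivity (\int[lebesgue_rV]_x (f x * fk P W a b t g x)); last first.
  apply: eq_integral => x _; congr (_ * _).
  have tt : (0 <= t <= t)%R by rewrite t0 lexx.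
  exact: (fk_eq tt pW pZ hW (@levy_increments hZ t t) x tt ma mb a0 b0 mg g0).
rewrite H//; apply: eq_integral => w _.
have mFw : measurable_fun [set: E] (fun x => g x *
      (expeR (time_int Z b t x w) * expeR (- time_int Z a t x w)
    * f (x + Z t w)%R)).
  exact: (measurableT_comp (mF g f Z pZ mg mf) (pair2_measurable w)).
rewrite -(@ge0_integral_lebesgue_rV_shift R n (- Z t w) _ mFw); last first.
  by move=> x; exact: F0.
apply: eq_integral => x _; rewrite subrK !time_intW//.
rewrite /W subrr (process_start pZ) add0r.
by rewrite [LHS]muleC -[LHS]muleA [LHS]muleCA.
Qed.

End symmetry.

End levy_semigroup.

(** * Levy processes centered at their initial value *)

Section right_continuous_measurable.
Context (R : realType) (n : nat).
Local Notation E := 'rV[R]_n.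
Context dO (Omega : measurableType dO) (X : R -> Omega -> E).
Hypothesis mX : forall t, measurable_fun [set: Omega] (X t).
Hypothesis rcX : forall w t, 0 <= t -> X s w @[s --> t^'+] --> X t w.

(** This rounds down; [node] adds one step, so that [node k (ceil k s)] lies strictly to the right
    of the positive part of s, at distance at most 1/(k+1). Strictness is what a right limit
    requires. *)
Let ceil (k : nat) (s : R) : nat := Num.truncn (k.+1%:R * Num.max s 0).
Let node (k j : nat) : R := j.+1%:R / k.+1%:R.

Lemma measurable_step k :
  measurable_fun [set: R * Omega] (fun z => X (node k (ceil k z.1)) z.2).
Proof.
move=> _ A mA; rewrite setTI.
rewrite (_ : _ @^-1` _ =
  \bigcup_j ((fun s : R => k.+1%:R * Num.max s 0) @^-1` `[j%:R, j.+1%:R[ `*`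
             (X (node k j) @^-1` A))).
  apply: bigcup_measurable => j _; apply: measurableX.
    rewrite -[X in measurable X]setTI.
    have mm : measurable_fun [set: R] (fun s : R => k.+1%:R * Num.max s 0).
      by apply: measurable_funM => //; apply: measurable_maxr.
    by apply: mm => //; exact: measurable_itv.
  by rewrite -[X in measurable X]setTI; exact: mX.
have max0 (s : R) : 0 <= k.+1%:R * Num.max s 0.
  by rewrite mulr_ge0// le_max lexx orbT.
apply/seteqP; split => -[s w] /=.
  by move=> h; exists (ceil k s) => //=; split; [rewrite in_itv/= truncn_itv|].
by move=> [j _ [/=]]; rewrite in_itv/= => /truncn_def; rewrite /ceil => ->.
Qed.

Lemma measurable_right_continuous :
  measurable_fun [set: R * Omega] (fun z => X (Num.max z.1 0) z.2).
Proof.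
apply: measurable_fun_rV => i.
apply: (@measurable_fun_cvg _ _ R setT
  (fun k z => X (node k (ceil k z.1)) z.2 0 i)) => //.
- move=> k; exact: (measurableT_comp (@measurable_coord_rV R n i) (measurable_step k)).
- move=> [s w] _ /=; set m := Num.max s 0.
  have m0 : 0 <= m by rewrite le_max lexx orbT.
  have h : X u w 0 i @[u --> m^'+] --> X m w 0 i.
    apply: (@cvg_comp _ _ _ (fun u => X u w) (fun x : E => x 0 i) _ (nbhs (X m w))).
      exact: rcX.
    exact: coord_continuous.
  move/cvg_at_rightP : h; apply.
  have h k : m < node k (ceil k s) <= m + k.+1%:R^-1.
    have km0 : 0 <= k.+1%:R * m by rewrite mulr_ge0.
    have /andP[h1 h2] := truncn_itv km0.
    rewrite /node /ceil -/m ltr_pdivlMr// mulrC h2/=.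
    by rewrite ler_pdivrMr// mulrDl mulVf ?pnatr_eq0// -[leLHS]natr1 lerD2r (mulrC m).
  split=> [k|]; first by have /andP[] := h k.
  apply: (@squeeze_cvgr _ _ _ _ (cst m) (fun k => m + k.+1%:R^-1)).
  - by apply: nearW => k; have /andP[/ltW -> ->] := h k.
  - exact: cvg_cst.
  - rewrite -[X in _ --> X]addr0; apply: cvgD; [exact: cvg_cst|exact: cvg_harmonic].
Qed.

End right_continuous_measurable.

Section levy_of_levy_process.
Context (R : realType) (n : nat).
Local Notation E := 'rV[R]_n.
Context dO (Omega : measurableType dO) (P : probability Omega R)
  (X : R -> {RV P >-> E}).
Hypotheses (lX : levy_process X) (sX : symmetric_process X).

(** The given process vanishes at time 0 only almost surely, and its values at negative times are
    arbitrary. Subtracting the initial value and freezing negative times removes both defects on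
    every path. *)
Definition centered (s : R) (w : Omega) : E := X (Num.max s 0) w - X 0 w.

Lemma centered_law h (A : set E) : 0 <= h -> measurable A ->
  law P centered h A = P (X h @^-1` A).
Proof.
move=> h0 mA; rewrite -(levy_stationary lX (lexx 0) h0 mA) /law; congr (P _).
by apply/seteqP; split => w; rewrite /= /centered add0r max_l.
Qed.

Lemma centered_process : process centered.
Proof.
split; last by move=> w; rewrite /centered maxxx subrr.
apply: measurable_funBrV.
  apply: (@measurable_right_continuous R n _ Omega (fun s w => X s w)).
    by move=> t; exact: measurable_funP.
  by move=> w t t0; exact: (levy_right_continuous lX).
exact: (measurableT_comp (measurable_funP (X 0))).
Qed.

Lemma centered_increments c T : has_increments (law P centered) c T P centered.
Proof.
move=> m u A u0 um umT _ mA.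
(* Independence is given for infinite increasing sequences of times, so the subdivision is continued
   by unit steps beyond [m]. *)
pose u' i := if (i <= m)%N then u i else u m + (i - m)%:R.
have u'0 : 0 <= u' 0%N by rewrite /u' /= u0.
have u'S i : u' i < u' i.+1.
  rewrite /u'; have [im|mi] := ltnP i m; first by rewrite (ltnW im) um.
  have [im|im] := leqP i m.
    by rewrite (@anti_leq i m) ?im ?mi// subSnn ltrDl.
  by rewrite ltrD2l ltr_nat ltn_sub2r// ltnS leqW // ltnW.
have u_ge0 i : (i <= m)%N -> 0 <= u i.
  by move=> im; rewrite -u0 (increments_mono um).
have := @levy_independent _ _ _ _ _ _ lX m u' u'0 u'S (fun i : 'I_m => A i)
  (fun i => mA i).
rewrite (_ : [set w | _] = [set w | forall i, (i < m)%N ->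
    A i (centered (u i.+1) w - centered (u i) w)]); last first.
  have E w i : (i < m)%N -> centered (u i.+1) w - centered (u i) w =
      X (u' i.+1) w - X (u' i) w.
    move=> im; rewrite /centered /u' im (ltnW im) opprB addrA subrK.
    by rewrite !max_l ?u_ge0// ltnW.
  apply/seteqP; split => w /= h i; last by rewrite -E//; exact: h.
  by move=> im; rewrite E//; exact: (h (Ordinal im)).
move=> ->; rewrite big_mkord; apply: eq_bigr => i _.
have im := ltn_ord i.
rewrite centered_law//; last by rewrite subr_ge0 ltW// um.
have h0 : 0 <= u i.+1 - u i by rewrite subr_ge0 ltW// um.
rewrite -(levy_stationary lX (u_ge0 _ (ltnW im)) h0 (mA i)); congr (P _).
by apply/seteqP; split => w /=; rewrite /u' im (ltnW im) (addrC (u i)) subrK.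
Qed.

Lemma centered_levy : levy P centered.
Proof.
split.
- exact: centered_process.
- exact: centered_increments.
- move=> h A h0 mA.
  have mA' : measurable [set x : E | A (- x)].
    rewrite -[X in measurable X]setTI.
    by apply: (@measurable_funNrV R n _ E id).
  rewrite !centered_law//.
  exact: sX.
- move=> w t t0; rewrite /centered max_l//.
  apply: cvgB; last exact: cvg_cst.
  have E : \forall s \near t^'+, X s w = X (Num.max s 0) w.
    near=> s; rewrite max_l//.
    by apply: ltW; apply: (le_lt_trans t0); near: s; exact: nbhs_right_gt.
  apply: cvg_trans (near_eq_cvg E) _.
  exact: (levy_right_continuous lX t0).
Unshelve. all: by end_near. Qed.

End levy_of_levy_process.

(** * Khasminskii's lemma *)

Section exponential_moments.
Context (R : realType) (n : nat).
Local Notation E := 'rV[R]_n.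
Local Notation mu := (@lebesgue_measure R).
Local Open Scope ereal_scope.
Context dO (Omega : measurableType dO) (P : probability Omega R)
  (Z : R -> Omega -> E).
Hypothesis hZ : levy P Z.
Let pZ := levy_process_of hZ.
Local Notation fk := (fk P Z).
Local Notation cst0 := (cst 0%R : E -> R).
Local Notation one := (cst 1 : E -> \bar R).

(** The free semigroup. It is [fk] with zero potentials, and inherits its properties from there. *)
Definition heat (t : R) (f : E -> \bar R) (x : E) : \bar R :=
  \int[P]_w f (x + Z t w)%R.

Definition occ (b : E -> R) (t : R) (x : E) : \bar R :=
  \int[P]_w time_int Z b t x w.

Lemma time_int0 t x w : time_int Z cst0 t x w = 0.
Proof. by rewrite /time_int integral0_eq. Qed.

Lemma fk_cst0 t f x : fk cst0 cst0 t f x = heat t f x.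
Proof.
by apply: eq_integral => w _; rewrite time_int0 oppe0 expeR0 !mul1e.
Qed.

Lemma fk0b b t f x :
  fk cst0 b t f x = \int[P]_w (expeR (time_int Z b t x w) * f (x + Z t w)%R).
Proof.
by apply: eq_integral => w _; rewrite time_int0 oppe0 expeR0 mule1.
Qed.

Lemma heat_ge0 t f x : (forall y, 0 <= f y) -> 0 <= heat t f x.
Proof. by move=> f0; apply: integral_ge0. Qed.

Lemma measurable_heat t f : measurable_fun [set: E] f -> (forall y, 0 <= f y) ->
  measurable_fun [set: E] (heat t f).
Proof.
move=> mf f0; rewrite (_ : heat t f = fk cst0 cst0 t f).
  exact: measurable_fk.
by apply/funext => x; rewrite fk_cst0.
Qed.

Lemma heat_semigroup t s f x : (0 <= t)%R -> (0 <= s)%R ->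
  measurable_fun [set: E] f -> (forall y, 0 <= f y) ->
  heat (t + s) f x = heat t (heat s f) x.
Proof.
move=> t0 s0 mf f0.
have m0 : measurable_fun [set: E] cst0 by exact: measurable_cst.
have p0 y : (0 <= cst0 y)%R by exact: lexx.
rewrite -(fk_cst0 (t + s)) (fk_semigroup hZ t0 s0 m0 m0 p0 p0 x mf f0) fk_cst0.
by apply: eq_integral => w _; rewrite fk_cst0.
Qed.

Section monotone.
Variables (a b : E -> R).
Hypotheses (ma : measurable_fun [set: E] a) (mb : measurable_fun [set: E] b).
Hypotheses (a0 : forall y, (0 <= a y)%R) (b0 : forall y, (0 <= b y)%R).

Lemma le_fk t f g x : measurable_fun [set: E] f -> measurable_fun [set: E] g ->
  (forall y, 0 <= f y) -> (forall y, f y <= g y) ->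
  fk a b t f x <= fk a b t g x.
Proof.
move=> mf mg f0 fg; apply: ge0_le_integral => //.
- by move=> w _; exact: fk_integrand_ge0.
- exact: measurable_fk_integrand2.
- exact: measurable_fk_integrand2.
- by move=> w _; rewrite lee_wpmul2l// mule_ge0// expeR_ge0.
Qed.

Lemma fkZl t (k : R) f x : (0 <= k)%R -> measurable_fun [set: E] f ->
  (forall y, 0 <= f y) ->
  fk a b t (fun y => k%:E * f y) x = k%:E * fk a b t f x.
Proof.
move=> k0 mf f0; rewrite -ge0_integralZl//.
- by apply: eq_integral => w _; rewrite muleCA.
- exact: measurable_fk_integrand2.
- by move=> w _; exact: fk_integrand_ge0.
Qed.

Lemma fkD t f g x : measurable_fun [set: E] f -> measurable_fun [set: E] g ->
  (forall y, 0 <= f y) -> (forall y, 0 <= g y) ->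
  fk a b t (fun y => f y + g y) x = fk a b t f x + fk a b t g x.
Proof.
move=> mf mg f0 g0; rewrite -ge0_integralD//.
- by apply: eq_integral => w _; rewrite ge0_muleDr.
- by move=> w _; exact: fk_integrand_ge0.
- exact: measurable_fk_integrand2.
- by move=> w _; exact: fk_integrand_ge0.
- exact: measurable_fk_integrand2.
Qed.

End monotone.

Lemma fk_le_cst0 (a b : E -> R) t (f : E -> \bar R) x : measurable_fun [set: E] a ->
  measurable_fun [set: E] b -> (forall y, (0 <= a y)%R) ->
  (forall y, (0 <= b y)%R) -> measurable_fun [set: E] f ->
  (forall y, 0 <= f y) -> fk a b t f x <= fk cst0 b t f x.
Proof.
move=> ma mb a0 b0 mf f0; apply: ge0_le_integral => //.
- by move=> w _; exact: fk_integrand_ge0.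
- exact: measurable_fk_integrand2.
- exact: measurable_fk_integrand2.
- move=> w _; apply: lee_wpmul2r => //; apply: lee_wpmul2l; first exact: expeR_ge0.
  by rewrite lee_expeR leeN2 time_int0 time_int_ge0.
Qed.

Lemma le_heat t f g x : measurable_fun [set: E] f -> measurable_fun [set: E] g ->
  (forall y, 0 <= f y) -> (forall y, f y <= g y) -> heat t f x <= heat t g x.
Proof. by move=> mf mg f0 fg; rewrite -!fk_cst0; exact: le_fk. Qed.

Lemma heatZl t (k : R) f x : (0 <= k)%R -> measurable_fun [set: E] f ->
  (forall y, 0 <= f y) -> heat t (fun y => k%:E * f y) x = k%:E * heat t f x.
Proof. by move=> k0 mf f0; rewrite -!fk_cst0; exact: fkZl. Qed.

Lemma heatD t f g x : measurable_fun [set: E] f -> measurable_fun [set: E] g ->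
  (forall y, 0 <= f y) -> (forall y, 0 <= g y) ->
  heat t (fun y => f y + g y) x = heat t f x + heat t g x.
Proof. by move=> mf mg f0 g0; rewrite -!fk_cst0; exact: fkD. Qed.

Lemma heat_cst t (k : R) x : heat t (cst k%:E) x = k%:E.
Proof. by rewrite -[RHS]mule1 -(probability_setT P) -integral_cst. Qed.

Section occupation.
Variable b : E -> R.
Hypotheses (mb : measurable_fun [set: E] b) (b0 : forall y, (0 <= b y)%R).

Lemma occ_ge0 t x : 0 <= occ b t x.
Proof. by apply: integral_ge0 => w _; exact: time_int_ge0. Qed.

Lemma measurable_occ t : measurable_fun [set: E] (occ b t).
Proof.
apply: (@measurable_fun_fubini_tonelli_F _ _ E Omega R P (fun q =>
    time_int Z b t q.1 q.2)); first exact: measurable_time_int.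
by move=> q; exact: time_int_ge0.
Qed.

Lemma occE t x : occ b t x = \int[mu]_(s in `[0%R, t]) heat s (EFin \o b) x.
Proof.
rewrite /occ /time_int (@tonelli_in _ Omega R `[0%R, t]%classic _
  (fun z => (b (x + Z z.2 z.1)%R)%:E))//.
- apply/measurable_EFinP; apply: (measurableT_comp mb).
  exact: measurable_path2.
- by move=> z; rewrite lee_fin.
Qed.

Let measurable_heat2 :
  measurable_fun [set: R * E] (fun q => heat q.1 (EFin \o b) q.2).
Proof.
apply: (@measurable_fun_fubini_tonelli_F _ _ (R * E)%type Omega R P (fun z =>
    (b (z.1.2 + Z z.1.1 z.2)%R)%:E)).
  apply/measurable_EFinP; apply: (measurableT_comp mb).
  apply: measurable_funDrV; first exact: (measurableT_comp measurable_snd).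
  apply: (measurableT_comp (process_measurable pZ)
    (g := fun z : (R * E) * Omega => (z.1.1, z.2))).
  by apply: measurable_fun_pair => //; exact: (measurableT_comp measurable_fst).
by move=> z; rewrite lee_fin.
Qed.

Let measurable_heat_time x : measurable_fun [set: R] (fun s => heat s (EFin \o b) x).
Proof. exact: (measurableT_comp measurable_heat2 (pair2_measurable x)). Qed.

(** The Markov property of an additive functional, obtained by integrating the semigroup property of
    [heat] in time. *)
Lemma occD t s x : (0 <= t)%R -> (0 <= s)%R ->
  occ b (t + s) x = occ b t x + heat t (occ b s) x.
Proof.
move=> t0 s0; rewrite !occE.
have b0' y : 0 <= (EFin \o b) y by rewrite lee_fin.
have mb' : measurable_fun [set: E] (EFin \o b) by exact/measurable_EFinP.
have tts : (t <= t + s)%R by rewrite lerDl.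
rewrite (_ : `[0%R, (t + s)%R]%classic = `[0%R, t]%classic `|` `]t, (t + s)%R]%classic); last first.
  by rewrite -itv_bndbnd_setU// bnd_simp.
rewrite ge0_integral_setU//; first last.
- apply/disj_setPLR => u /=; rewrite !in_itv /= => /andP[_ ut].
  by apply/negP; rewrite negb_and -leNgt ut.
- by move=> u _; exact: heat_ge0.
- by apply: measurable_funTS; exact: measurable_heat_time.
congr (_ + _).
rewrite integral_itv_obnd_cbnd; last first.
  by apply: measurable_funTS; exact: measurable_heat_time.
transitivity (\int[mu]_(u in `[0%R, s]) heat t (heat u (EFin \o b)) x).
  transitivity (\int[mu]_(u in `[0%R, s]) heat (u + t)%R (EFin \o b) x).
    rewrite -(@ge0_integral_shift R t `[t, (t + s)%R]%classic
     (fun u => heat u (EFin \o b) x) _ (measurable_heat_time x))//; last first.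
      by move=> u; exact: heat_ge0.
    rewrite (_ : [set u | `[t, (t + s)%R]%classic (u + t)%R] =
        `[0%R, s]%classic)//.
    by apply/seteqP; split => u /=; rewrite !in_itv /= lerDr (addrC t) lerD2r.
  apply: eq_integral => u; rewrite inE /= in_itv /= => /andP[u0 _].
  by rewrite addrC heat_semigroup.
rewrite /heat.
under [RHS]eq_integral do rewrite occE.
rewrite (@tonelli_in _ Omega R `[0%R, s]%classic _
  (fun z => heat z.2 (EFin \o b) (x + Z t z.1)%R))//.
- apply: (measurableT_comp measurable_heat2
    (g := fun z : Omega * R => (z.2, (x + Z t z.1)%R))).
  apply: measurable_fun_pair => //; apply: measurable_funDrV => //.
  exact: (measurableT_comp (process_at t pZ)).
- by move=> z; exact: heat_ge0.
Qed.

Lemma le_time_int_time t s x w : (t <= s)%R ->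
  time_int Z b t x w <= time_int Z b s x w.
Proof.
move=> ts; apply: ge0_subset_integral => //.
- apply: measurable_funTS; exact: (measurable_time_integrand pZ).
- by move=> u _; rewrite lee_fin.
- by apply: subset_itvl; rewrite bnd_simp.
Qed.

Lemma le_occ t s x : (t <= s)%R -> occ b t x <= occ b s x.
Proof.
move=> ts; apply: ge0_le_integral => //.
- by move=> w _; exact: time_int_ge0.
- exact: measurable_time_int2.
- exact: measurable_time_int2.
- by move=> w _; exact: le_time_int_time.
Qed.

End occupation.

(** From exp(- A) >= 1 - A follows exp(A) (1 - A) <= 1, and 1/(1 - A) <= 1 + 2 A for A <= 1/2. *)
Lemma expeR_le_1D2x (A : \bar R) : 0 <= A <= (1 / 2)%:E ->
  expeR A <= 1 + 2%:E * A.
Proof.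
case: A => [A| |]; [|by rewrite leye_eq andbF|by []].
rewrite -EFinM -EFinD !lee_fin => /andP[A0 A2].
have h1 := expR_ge1Dx (- A).
have h2 : (expR A * expR (- A) = 1)%R by rewrite -expRD subrr expR0.
have h3 := expR_gt0 A.
suff : (expR A * (1 - A) <= 1)%R by nra.
by rewrite -[leRHS]h2 ler_wpM2l// ltW.
Qed.

(** Induction over short steps. The functional F of the remaining time is at most 1 + 4 (1/4) = 2,
    and the occupation integral A of one step is at most 1/2, so exp(A) F <= F + 2 A F <= F + 4 A.
    Taking expectations, [occD] adds up the occupations. *)
Lemma khasminskii_bounded (b : E -> R) (K h : R) :
  measurable_fun [set: E] b -> (forall y, (0 <= b y <= K)%R) -> (0 < h)%R ->
  (forall x, occ b h x <= (1 / 4)%:E) ->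
  forall x, fk cst0 b h one x <= 1 + 4%:E * occ b h x.
Proof.
move=> mb bK h0 hocc.
have b0 y : (0 <= b y)%R by have /andP[] := bK y.
have K0 : (0 <= K)%R by have /andP[/le_trans h1 /h1] := bK 0%R.
have one0 (y : E) : 0 <= one y by rewrite lee_fin.
(* N + 1 exceeds 2 K h, so that K delta <= 1/2. *)
pose N := Num.truncn (2 * K * h).
pose delta := (h / N.+1%:R)%R.
have d0 : (0 < delta)%R by rewrite divr_gt0.
have Kd : (K * delta <= 1 / 2)%R.
  have KH : (0 <= 2 * K * h)%R by rewrite !mulr_ge0// ltW.
  have /andP[_ /ltW HN] := truncn_itv KH.
  rewrite /delta mulrA ler_pdivrMr//; lra.
have Nd : (N.+1%:R * delta = h)%R by rewrite /delta mulrC divfK.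
have step j : (j <= N.+1)%N ->
    forall x, fk cst0 b (j%:R * delta)%R one x <= 1 + 4%:E * occ b (j%:R * delta)%R x.
  elim: j => [|j IHj] jN x.
    rewrite mul0r fk0b (eq_integral (cst 1)); last first.
      move=> w _; rewrite /time_int set_itv1 integral_set1 expeR0 mule1//.
    have := heat_cst 0 1 x; rewrite /heat /= => ->.
    by rewrite leeDl// mule_ge0// occ_ge0.
  have jh : (j%:R * delta <= h)%R.
    by rewrite -Nd; apply: ler_wpM2r; [exact: ltW|rewrite ler_nat ltnW].
  have jd0 : (0 <= j%:R * delta)%R by rewrite mulr_ge0// ltW.
  rewrite (_ : (j.+1%:R * delta = delta + j%:R * delta)%R); last first.
    by rewrite -natr1; ring.
  rewrite (fk_semigroup hZ)//; try exact: ltW.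
  set F := fk cst0 b (j%:R * delta)%R one.
  have mF : measurable_fun [set: E] F by exact: measurable_fk.
  have F0 y : 0 <= F y by exact: fk_ge0.
  have FH y : F y <= 1 + 4%:E * occ b (j%:R * delta)%R y by apply: IHj; exact: ltnW.
  have mO t : measurable_fun [set: E] (fun y => 1 + 4%:E * occ b t y).
    apply: emeasurable_funD => //; apply: measurable_funeM.
    exact: measurable_occ.
  have F2 y : F y <= 2%:E.
    apply: (le_trans (FH y)).
    apply: (@le_trans _ _ (1 + 4%:E * (1 / 4)%:E)).
      apply: leeD2l; apply: lee_wpmul2l => //.
      by apply: le_trans (hocc y); exact: le_occ.
    by rewrite -EFinM -EFinD lee_fin; lra.
  apply: (@le_trans _ _ (heat delta F x + 4%:E * occ b delta x)).
    rewrite fk0b /heat /occ -ge0_integralZl//; first last.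
    - by move=> w _; exact: time_int_ge0.
    - exact: measurable_time_int2.
    have mI : measurable_fun [set: Omega] (fun w => 4%:E * time_int Z b delta x w).
      by apply: measurable_funeM; exact: measurable_time_int2.
    have I0 w : [set: Omega] w -> 0 <= 4%:E * time_int Z b delta x w.
      by move=> _; rewrite mule_ge0// time_int_ge0.
    have mFx : measurable_fun [set: Omega] (fun w => F (x + Z delta w)%R).
      exact: measurable_path_at2.
    rewrite -(ge0_integralD _ measurableT (fun w _ => F0 _) mFx I0 mI).
    apply: ge0_le_integral => //.
    - by move=> w _; rewrite mule_ge0// expeR_ge0.
    - apply: emeasurable_funM; last exact: measurable_path_at2.
      apply: (measurableT_comp (@measurable_expeR R)).
      exact: measurable_time_int2.
    - apply: emeasurable_funD; first exact: measurable_path_at2.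
      by apply: measurable_funeM; exact: measurable_time_int2.
    - move=> w _.
      set A := time_int Z b delta x w.
      have A0 : 0 <= A by exact: time_int_ge0.
      have A2 : A <= (1 / 2)%:E.
        by apply: (le_trans (time_int_le pZ x w mb bK (ltW d0))); rewrite lee_fin.
      apply: (@le_trans _ _ ((1 + 2%:E * A) * F (x + Z delta w)%R)).
        by rewrite lee_wpmul2r// expeR_le_1D2x// A0.
      rewrite ge0_muleDl// ?mule_ge0// mul1e leeD2l//.
      rewrite (_ : 4%:E = 2%:E * 2%:E); last by rewrite -EFinM -natrM.
      by rewrite -!muleA lee_wpmul2l// muleC lee_wpmul2r.
  apply: (@le_trans _ _ (1 + 4%:E * heat delta (occ b (j%:R * delta)) x +
     4%:E * occ b delta x)).
    rewrite leeD2r// -heatZl//; first last.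
    - by move=> y; exact: occ_ge0.
    - exact: measurable_occ.
    rewrite -{1}(heat_cst delta 1 x) -heatD//.
    - by apply: le_heat.
    - by apply: measurable_funeM; exact: measurable_occ.
    - by move=> y; rewrite mule_ge0// occ_ge0.
  rewrite occD//; last exact: ltW.
  rewrite -addeA leeD2l// -ge0_muleDr.
  - by rewrite addeC.
  - by apply: heat_ge0 => y; exact: occ_ge0.
  - exact: occ_ge0.
by move=> x; have := step N.+1 (leqnn _) x; rewrite Nd.
Qed.

End exponential_moments.

(** For finite values the difference is (theta u - v)^2 / (2 theta); if one value is infinite, so is
    the right-hand side. *)
Lemma mule_amgm (R : realType) (theta : R) (u v : \bar R) : (0 < theta)%R ->
  (0 <= u -> 0 <= v ->
  u * v <= (theta / 2)%:E * (u * u) + ((2 * theta)^-1)%:E * (v * v))%E.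
Proof.
move=> t0.
have c1 : (0 < (theta / 2)%:E)%E by rewrite lte_fin divr_gt0.
have c2 : (0 < ((2 * theta)^-1)%:E)%E by rewrite lte_fin invr_gt0 mulr_gt0.
case: u => [u| |]//; case: v => [v| |]// u0 v0.
- rewrite -!EFinM -EFinD lee_fin.
  rewrite (_ : _ + _ = u * v + (2 * theta)^-1 * (theta * u - v) ^+ 2); last first.
    by field; rewrite gt_eqF.
  by rewrite lerDl mulr_ge0 ?sqr_ge0// ltW// -lte_fin.
- rewrite [X in (_ <= X)%E](_ : _ = +oo%E) ?leey// mulyy (gt0_muley c2).
  by rewrite addey// -!EFinM.
- rewrite [X in (_ <= X)%E](_ : _ = +oo%E) ?leey// mulyy (gt0_muley c1).
  by rewrite addye// -!EFinM.
- by rewrite !mulyy (gt0_muley c1) (gt0_muley c2) addye.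
Qed.

(** * Exponential moments for unbounded potentials and AM-GM along the path *)

Section exponential_moments.
Context (R : realType) (n : nat).
Local Notation E := 'rV[R]_n.
Local Notation mu := (@lebesgue_measure R).
Local Open Scope ereal_scope.
Context dO (Omega : measurableType dO) (P : probability Omega R)
  (Z : R -> Omega -> E).
Hypothesis hZ : levy P Z.
Let pZ := levy_process_of hZ.
Local Notation fk := (fk P Z).
Local Notation heatZ := (heat P Z).
Local Notation occZ := (occ P Z).
Local Notation cst0 := (cst 0%R : E -> R).
Local Notation one := (cst 1 : E -> \bar R).

Definition small_occupation (b : E -> R) : Prop :=
  forall e : R, (0 < e)%R -> exists2 h : R, (0 < h)%R &
    forall x, occZ b h x <= e%:E.

Section khasminskii.
Variable b : E -> R.
Hypotheses (mb : measurable_fun [set: E] b) (b0 : forall y, (0 <= b y)%R).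

Lemma khasminskii h : (0 < h)%R -> (forall x, occZ b h x <= (1 / 4)%:E) ->
  forall x, fk cst0 b h one x <= 1 + 4%:E * occZ b h x.
Proof.
move=> h0 hocc x.
have one0 (y : E) : 0 <= one y by rewrite lee_fin.
have H : fk cst0 (fun y => Num.min (b y) m%:R) h
   (fun y => mine (one y) m%:R%:E) x @[m --> \oo] --> fk cst0 b h one x.
  by apply: fk_cvg_neg.
rewrite -(cvg_lim _ H)//; apply: lime_le; first by apply/cvg_ex; eexists; exact: H.
apply: nearW => m.
have mbm := measurable_minr_nat m mb.
have bm0 y : (0 <= Num.min (b y) m%:R)%R by exact: minr_nat_ge0.
(* The approximation also cuts the constant 1 at m, which gives 0 when m = 0. *)
apply: (@le_trans _ _ (fk cst0 (fun y => Num.min (b y) m%:R) h one x)).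
  apply: le_fk => //.
  - exact: (measurable_cst (mine 1 m%:R%:E)).
  - by move=> y; rewrite le_min one0 lee_fin/=.
  - by move=> y; rewrite ge_min lexx.
have le_occ_min y : occZ (fun z => Num.min (b z) m%:R) h y <= occZ b h y.
  apply: ge0_le_integral => //.
  - by move=> w _; exact: time_int_ge0.
  - exact: measurable_time_int2.
  - exact: measurable_time_int2.
  - move=> w _; apply: le_time_int => // z.
    by rewrite bm0 ge_min lexx.
apply: (@le_trans _ _ (1 + 4%:E * occZ (fun z => Num.min (b z) m%:R) h x)).
  apply: (khasminskii_bounded hZ mbm (K := m%:R)) => // [y|y].
    by rewrite bm0 ge_min lexx orbT.
  exact: le_trans (hocc y).
by rewrite leeD2l// lee_wpmul2l.
Qed.

(** By the semigroup property each further time interval of length h multiplies the bound by 1 + 4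
    (1/4) = 2. *)
Lemma fk_exp_moment : small_occupation b -> forall t, (0 <= t)%R ->
  exists2 M : R, (0 < M)%R & forall x, fk cst0 b t one x <= M%:E.
Proof.
move=> sb t t0.
have one0 (y : E) : 0 <= one y by rewrite lee_fin.
have [h h0 hocc] := sb (1 / 4)%R ltac:(lra).
have iter k x : fk cst0 b (k%:R * h)%R one x <= (2 ^+ k)%:E.
  elim: k x => [|k IHk] x.
    rewrite mul0r (fk0b P Z) (eq_integral (cst 1)); last first.
      by move=> w _; rewrite /time_int set_itv1 integral_set1 expeR0 mule1.
    by have := heat_cst P Z 0 1 x; rewrite /heat /= expr0 => ->.
  rewrite (_ : (k.+1%:R * h = h + k%:R * h)%R); last by rewrite -natr1; ring.
  rewrite (fk_semigroup hZ)//; [|exact: ltW|by rewrite mulr_ge0// ltW].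
  apply: (@le_trans _ _ (fk cst0 b h (fun y => (2 ^+ k)%:E * one y) x)).
    apply: le_fk => //.
    - exact: measurable_fk.
    - by move=> y; exact: fk_ge0.
    - by move=> y; rewrite mule1.
  rewrite fkZl// ?exprn_ge0// exprSr EFinM lee_wpmul2l ?lee_fin ?exprn_ge0//.
  apply: (le_trans (khasminskii h0 hocc x)).
  apply: (@le_trans _ _ (1 + 4%:E * (1 / 4)%:E)).
    by rewrite leeD2l// lee_wpmul2l.
  by rewrite -EFinM -EFinD lee_fin; lra.
pose k := Num.truncn (t / h).
have tk : (t <= k.+1%:R * h)%R.
  have th0 : (0 <= t / h)%R by rewrite divr_ge0// ltW.
  by have /andP[_ /ltW] := truncn_itv th0; rewrite ler_pdivrMr.
exists (2 ^+ k.+1)%R; first by rewrite exprn_gt0.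
move=> x; apply: le_trans (iter k.+1 x); rewrite !fk0b.
apply: ge0_le_integral => //.
- by move=> w _; rewrite mule1 expeR_ge0.
- apply: emeasurable_funM => //; apply: (measurableT_comp (@measurable_expeR R)).
  exact: measurable_time_int2.
- apply: emeasurable_funM => //; apply: (measurableT_comp (@measurable_expeR R)).
  exact: measurable_time_int2.
- by move=> w _; rewrite !mule1 lee_expeR (le_time_int_time hZ).
Qed.

End khasminskii.

(** AM-GM squares the exponential weight, which doubles both potentials. *)
Definition dbl (v : E -> R) : E -> R := (v \+ v)%R.

Lemma dbl_ge0 (v : E -> R) : (forall y, (0 <= v y)%R) -> forall y, (0 <= dbl v y)%R.
Proof. by move=> v0 y; rewrite addr_ge0. Qed.

Lemma measurable_dbl (v : E -> R) : measurable_fun [set: E] v ->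
  measurable_fun [set: E] (dbl v).
Proof. by move=> mv; exact: measurable_funD. Qed.

Lemma time_int_dbl (v : E -> R) t x w : measurable_fun [set: E] v ->
  (forall y, (0 <= v y)%R) ->
  time_int Z (dbl v) t x w = time_int Z v t x w + time_int Z v t x w.
Proof. by move=> mv v0; exact: time_intD. Qed.

Lemma small_occupation_dbl (v : E -> R) : measurable_fun [set: E] v ->
  (forall y, (0 <= v y)%R) -> small_occupation v -> small_occupation (dbl v).
Proof.
move=> mv v0 sv e e0; have [h h0 hv] := sv (e / 2)%R ltac:(by rewrite divr_gt0).
exists h; first exact: h0.
move=> x.
rewrite (_ : occZ (dbl v) h x = occZ v h x + occZ v h x).
  by apply: (le_trans (leeD (hv x) (hv x))); rewrite -EFinD lee_fin; lra.
rewrite /occ -ge0_integralD//.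
- by apply: eq_integral => w _; rewrite time_int_dbl.
- by move=> w _; exact: time_int_ge0.
- exact: measurable_time_int2.
- by move=> w _; exact: time_int_ge0.
- exact: measurable_time_int2.
Qed.

Section amgm.
Variables (a b : E -> R).
Hypotheses (ma : measurable_fun [set: E] a) (mb : measurable_fun [set: E] b).
Hypotheses (a0 : forall y, (0 <= a y)%R) (b0 : forall y, (0 <= b y)%R).
Variables (t theta : R) (x : E).
Hypothesis theta0 : (0 < theta)%R.

Let theta2 : (0 <= theta / 2)%R. Proof. by rewrite divr_ge0// ltW. Qed.
Let thetaV : (0 <= (2 * theta)^-1)%R. Proof. by rewrite invr_ge0 mulr_ge0// ltW. Qed.

Lemma expeR_dbl (v : E -> R) w : measurable_fun [set: E] v -> (forall y, (0 <= v y)%R) ->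
  expeR (time_int Z (dbl v) t x w) =
  expeR (time_int Z v t x w) * expeR (time_int Z v t x w).
Proof. by move=> mv v0; rewrite time_int_dbl// expeRD. Qed.

Lemma expeRN_dbl (v : E -> R) w : measurable_fun [set: E] v -> (forall y, (0 <= v y)%R) ->
  expeR (- time_int Z (dbl v) t x w) =
  expeR (- time_int Z v t x w) * expeR (- time_int Z v t x w).
Proof.
move=> mv v0; rewrite time_int_dbl// -expeRD; congr expeR.
by rewrite oppeD// ge0_adde_def// inE time_int_ge0.
Qed.

(** The weight is one factor and the value of [f] the other, so that only the free semigroup acts on
    the square of [f]. *)
Lemma fk_amgm f : measurable_fun [set: E] f -> (forall y, 0 <= f y) ->
  fk a b t f x <= (theta / 2)%:E * fk (dbl a) (dbl b) t one x +
    ((2 * theta)^-1)%:E * heatZ t (fun y => f y * f y) x.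
Proof.
move=> mf f0.
have mff : measurable_fun [set: E] (fun y => f y * f y) by exact: emeasurable_funM.
have md := measurable_dbl; have d0 := dbl_ge0.
have m1 : measurable_fun [set: Omega] (fun w =>
    expeR (time_int Z (dbl b) t x w) * expeR (- time_int Z (dbl a) t x w)
    * one (x + Z t w)%R).
  by apply: measurable_fk_integrand2 => //; [exact: md|exact: md|exact: d0|exact: d0].
have m2 : measurable_fun [set: Omega] (fun w => f (x + Z t w)%R * f (x + Z t w)%R).
  exact: (measurable_path_at2 pZ t x mff).
rewrite -ge0_integralZl//; last by move=> w _; exact: fk_integrand_ge0.
rewrite -ge0_integralZl//; last by move=> w _; rewrite mule_ge0.
rewrite -ge0_integralD//; first last.
- exact: measurable_funeM.
- by move=> w _; rewrite !mule_ge0// lee_fin.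
- exact: measurable_funeM.
- by move=> w _; rewrite mule_ge0 ?lee_fin// fk_integrand_ge0.
apply: ge0_le_integral => //.
- by move=> w _; exact: fk_integrand_ge0.
- exact: measurable_fk_integrand2.
- by apply: emeasurable_funD; exact: measurable_funeM.
- move=> w _; rewrite mule1 expeR_dbl// expeRN_dbl// muleACA.
  by apply: mule_amgm => //; rewrite mule_ge0// expeR_ge0.
Qed.

(** Here the factors are exp(int b) and exp(- int a), which separates an exponential moment from a
    term that decays at infinity. *)
Lemma fk_one_amgm :
  fk a b t one x <= (theta / 2)%:E * fk cst0 (dbl b) t one x +
    ((2 * theta)^-1)%:E * fk (dbl a) cst0 t one x.
Proof.
have md := measurable_dbl; have d0 := dbl_ge0.
have one0 (y : E) : 0 <= one y by rewrite lee_fin.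
have m1 : measurable_fun [set: Omega] (fun w =>
    expeR (time_int Z (dbl b) t x w) * expeR (- time_int Z cst0 t x w)
    * one (x + Z t w)%R).
  by apply: measurable_fk_integrand2 => //; [exact: md|exact: d0].
have m2 : measurable_fun [set: Omega] (fun w =>
    expeR (time_int Z cst0 t x w) * expeR (- time_int Z (dbl a) t x w)
    * one (x + Z t w)%R).
  by apply: measurable_fk_integrand2 => //; [exact: md|exact: d0].
rewrite -ge0_integralZl//; last by move=> w _; exact: fk_integrand_ge0.
rewrite -ge0_integralZl//; last by move=> w _; exact: fk_integrand_ge0.
rewrite -ge0_integralD//; first last.
- exact: measurable_funeM.
- by move=> w _; rewrite mule_ge0 ?lee_fin// fk_integrand_ge0.
- exact: measurable_funeM.
- by move=> w _; rewrite mule_ge0 ?lee_fin// fk_integrand_ge0.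
apply: ge0_le_integral => //.
- by move=> w _; exact: fk_integrand_ge0.
- exact: measurable_fk_integrand2.
- by apply: emeasurable_funD; exact: measurable_funeM.
- move=> w _; rewrite !mule1 expeR_dbl// expeRN_dbl// time_int0 oppe0 expeR0 mule1 mul1e.
  by apply: mule_amgm => //; exact: expeR_ge0.
Qed.

End amgm.

End exponential_moments.

(** * Integrability of the ground state *)

Lemma limn_einf_pinfty (R : realType) (u : (\bar R)^nat) :
  limn_einf u = +oo%E -> u @ \oo --> +oo%E.
Proof.
rewrite limn_einf_lim => h.
have ndu : nondecreasing_seq (einfs u) by exact: nondecreasing_einfs.
have := ereal_nondecreasing_cvgn ndu.
move=> /(cvg_lim (@ereal_hausdorff R)); rewrite h => hs.
apply/cvgeyPge => A.
have /ereal_sup_gt[_ [m _ <-] Am] : (A%:E < ereal_sup (range (einfs u)))%E.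
  by rewrite -hs ltry.
exists m => // k /= mk; apply: (le_trans (ltW Am)).
by apply: ereal_inf_lbound; exists k.
Qed.

Section decay.
Context (R : realType) (n : nat).
Local Notation E := 'rV[R]_n.
Local Notation mu := (@lebesgue_measure R).
Local Open Scope ereal_scope.
Context dO (Omega : measurableType dO) (P : probability Omega R)
  (Z : R -> Omega -> E).
Hypothesis hZ : levy P Z.
Let pZ := levy_process_of hZ.
Local Notation cst0 := (cst 0%R : E -> R).
Local Notation one := (cst 1 : E -> \bar R).

Definition coercive (a : E -> R) : Prop :=
  forall M : R, exists r : R, forall x : E, ~ box r x -> (M <= a x)%R.

Lemma coercive_dbl (a : E -> R) : (forall y, (0 <= a y)%R) -> coercive a -> coercive (dbl a).
Proof.
move=> a0 ca M; have [r hr] := ca M; exists r => x /hr h.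
by rewrite /dbl /= (le_trans h)// lerDl.
Qed.

(** Otherwise there are points [x_ k] leaving every box with values above e. For a fixed path and a
    fixed time s, x_k + Z_s leaves every box as well, so [a] tends to infinity there; Fatou in time
    sends the occupation integrals to +oo, and domination by 1 sends the expectations to 0. *)
Lemma fk_decay (a : E -> R) t : measurable_fun [set: E] a -> (forall y, (0 <= a y)%R) ->
  coercive a -> (0 < t)%R -> forall e : R, (0 < e)%R ->
  exists r : R, forall x : E, ~ box r x -> fk P Z a cst0 t one x <= e%:E.
Proof.
move=> ma a0 ca t0 e e0; apply: contrapT => /forallNP H.
have /choice[x_ hx] : forall k : nat, exists x : E,
    ~ box k%:R x /\ e%:E < fk P Z a cst0 t one x.
  move=> k; have /existsNP[x /not_implyP[h1 /negP h2]] := H k%:R.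
  by exists x; split => //; rewrite ltNge.
have fkE x : fk P Z a cst0 t one x = \int[P]_w expeR (- time_int Z a t x w).
  by apply: eq_integral => w _; rewrite time_int0 expeR0 mule1 mul1e.
have lim0 : fk P Z a cst0 t one (x_ k) @[k --> \oo] --> 0.
  under eq_fun do rewrite fkE.
  rewrite -(@integral0 _ _ R P setT).
  apply: (@dominated_cvg _ _ _ _ _ _ _ _ (cst 1)) => //.
  - move=> k; apply: (measurableT_comp (@measurable_expeR R)).
    by apply: (measurableT_comp (@oppe_measurable R _)) => //;
      exact: measurable_time_int2.
  - move=> w _.
    have h : time_int Z a t (x_ k) w @[k --> \oo] --> +oo.
      apply: limn_einf_pinfty; apply/eqP; rewrite -leye_eq.
      have := @fatou _ _ R mu `[0%R, t]%classic _
        (fun k s => (a (x_ k + Z s w)%R)%:E).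
      rewrite -/(time_int Z a t _ w) => F.
      apply: le_trans (F _ _ _) => //.
      + rewrite (eq_integral (cst +oo)) ?integral_cst//.
          rewrite /= lebesgue_measure_itv/= lte_fin t0 sube0.
          by rewrite gt0_mulye ?lte_fin.
        move=> s _; apply: (cvg_limn_einf_sup _).1.
        apply/cvgeyPge => A; have [r hr] := ca A.
        near=> k; rewrite lee_fin; apply: hr => /= hb.
        have [hk _] := hx k; apply: hk => i.
        have := hb i; rewrite mxE => hi.
        have zi : (`|Z s w 0%R i| <= \sum_j `|Z s w 0%R j|)%R.
          by rewrite (bigD1 i)//= lerDl sumr_ge0.
        have tri : (`|x_ k 0%R i| <= `|x_ k 0%R i + Z s w 0%R i| + `|Z s w 0%R i|)%R.
          by rewrite -{1}[x_ k 0%R i](addrK (Z s w 0%R i)) ler_normB.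
        apply: (le_trans tri); apply: (le_trans (lerD hi zi)).
        by near: k; exact: nbhs_infty_ger.
      + by move=> k; apply: measurable_funTS; exact: (measurable_time_integrand pZ).
      + by move=> k s _; rewrite lee_fin.
    apply/fine_cvgP; split.
      near=> k; rewrite fin_numElt; apply/andP; split.
        by rewrite (lt_le_trans _ (expeR_ge0 _)).
      rewrite (@le_lt_trans _ _ 1)// ?ltry//.
      by rewrite -expeR0 lee_expeR oppe_le0 time_int_ge0.
    apply/cvgrPdist_le => d d0.
    move/cvgeyPge : h => /(_ (- ln d)%R) h.
    near=> k.
    have hk : (- ln d)%:E <= time_int Z a t (x_ k) w by near: k.
    have hd : expeR (- time_int Z a t (x_ k) w) <= d%:E.
      rewrite -(lnK d0) -[leRHS]/(expeR (ln d)%:E) lee_expeR leeNl.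
      exact: hk.
    rewrite sub0r normrN ger0_norm ?fine_ge0 ?expeR_ge0//.
    rewrite -lee_fin fineK//.
    rewrite fin_numElt (lt_le_trans _ (expeR_ge0 _))//=.
    by rewrite (le_lt_trans hd)// ltry.
  - exact: finite_measure_integrable_cst.
  - move=> k w _; rewrite gee0_abs ?expeR_ge0//.
    by rewrite -expeR0 lee_expeR oppe_le0 time_int_ge0.
have : e%:E <= 0.
  rewrite -(cvg_lim (@ereal_hausdorff R) lim0).
  apply: lime_ge; first by apply/cvg_ex; exists 0.
  by apply: nearW => k; have [_ /ltW] := hx k.
by rewrite lee_fin leNgt e0.
Unshelve. all: by end_near. Qed.

(** Symmetry tested against the constant 1, which the free semigroup preserves. *)
Lemma integral_heat t f : (0 <= t)%R -> measurable_fun [set: E] f ->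
  (forall y, 0 <= f y) ->
  \int[lebesgue_rV]_x heat P Z t f x = \int[lebesgue_rV]_x f x.
Proof.
move=> t0 mf f0.
have one0 (y : E) : 0 <= one y by rewrite lee_fin.
have := @fk_symmetric _ _ _ _ P Z hZ t t0 cst0 cst0 f one
   (measurable_cst _) (measurable_cst _) (fun=> lexx _) (fun=> lexx _)
   mf f0 (measurable_cst _) one0.
under eq_integral do rewrite mul1e fk_cst0.
move=> ->; apply: eq_integral => x _.
by rewrite fk_cst0 heat_cst mule1.
Qed.

End decay.

(** * An integrable majorant for the free semigroup *)

Section dyadic_average.
Context (R : realType).
Local Open Scope ereal_scope.

Definition half (k : nat) : R := (2^-1 ^+ k.+1)%R.

Lemma half_ge0 k : (0 <= half k)%R.
Proof. by rewrite exprn_ge0// invr_ge0. Qed.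

(** The origin of the factor 2 in [heat_majorant]. *)
Lemma halfS k : (half k = 2 * half k.+1)%R.
Proof. by rewrite /half [in RHS]exprS mulVKf. Qed.

Lemma sum_half m : (\sum_(0 <= k < m) half k = 1 - 2^-1 ^+ m)%R.
Proof.
elim: m => [|m IHm]; first by rewrite big_geq// expr0 subrr.
rewrite big_nat_recr//= IHm /half exprS; lra.
Qed.

Lemma dyadic_average_le (u : (\bar R)^nat) (C : \bar R) :
  (forall k, 0 <= u k <= C) -> \sum_(0 <= k <oo) (half k)%:E * u k <= C.
Proof.
move=> uC; have u0 k : 0 <= u k by have /andP[] := uC k.
have C0 : 0 <= C by have /andP[/le_trans h1 /h1] := uC 0%N.
have t0 k : 0 <= (half k)%:E * u k by rewrite mule_ge0// lee_fin half_ge0.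
apply: lime_le; first by apply: is_cvg_nneseries => k _ _.
apply: nearW => m.
apply: (@le_trans _ _ (\sum_(0 <= k < m) (half k)%:E * C)).
  apply: lee_sum => k _; rewrite lee_wpmul2l ?lee_fin ?half_ge0//.
  by have /andP[] := uC k.
rewrite -ge0_sume_distrl; last by move=> k _; rewrite lee_fin half_ge0.
rewrite sumEFin sum_half -[leRHS]mul1e lee_wpmul2r// lee_fin.
by rewrite lerBlDr lerDl exprn_ge0// invr_ge0.
Qed.

End dyadic_average.
Arguments half {R} k.

Section majorant.
Context (R : realType) (n : nat).
Local Notation E := 'rV[R]_n.
Local Open Scope ereal_scope.
Context dO (Omega : measurableType dO) (P : probability Omega R)
  (Z : R -> Omega -> E).
Hypothesis hZ : levy P Z.
Let pZ := levy_process_of hZ.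
Variables (F : set E) (t : R).
Hypotheses (mF : measurable F) (t0 : (0 <= t)%R).

Let ind (y : E) : \bar R := (\1_F y)%:E.

Let mind : measurable_fun [set: E] ind.
Proof. by apply/measurable_EFinP; exact: measurable_indic. Qed.

Let ind0 y : 0 <= ind y. Proof. by rewrite lee_fin. Qed.

Let kt0 k : (0 <= k%:R * t)%R. Proof. by rewrite mulr_ge0. Qed.

Let term k (x : E) : \bar R := (half k)%:E * heat P Z (k%:R * t)%R ind x.

Let term0 k x : 0 <= term k x.
Proof. by rewrite mule_ge0 ?heat_ge0// lee_fin half_ge0. Qed.

Let mterm k : measurable_fun [set: E] (term k).
Proof. by apply: measurable_funeM; exact: measurable_heat. Qed.

Definition majorant (x : E) : \bar R := \sum_(0 <= k <oo) term k x.

Lemma measurable_majorant : measurable_fun [set: E] majorant.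
Proof.
have := @ge0_emeasurable_sum _ _ R setT term xpredT.
by apply => // k x _ _.
Qed.

Lemma majorant_ge0 x : 0 <= majorant x.
Proof. exact: nneseries_ge0. Qed.

Lemma majorant_le1 x : majorant x <= 1.
Proof.
apply: dyadic_average_le => k; rewrite heat_ge0//=.
rewrite -[leRHS](heat_cst P Z (k%:R * t)%R 1 x); apply: le_heat => // y.
by rewrite lee_fin indicE; case: (_ \in _).
Qed.

Lemma integral_majorant : \int[lebesgue_rV]_x majorant x <= lebesgue_rV F.
Proof.
rewrite integral_nneseries//.
rewrite (@eq_eseriesr _ _ (fun k => (half k)%:E * lebesgue_rV F)).
  by apply: dyadic_average_le => k; rewrite lexx andbT.
move=> k _; rewrite ge0_integralZl// ?lee_fin ?half_ge0//.
- by rewrite integral_heat// integral_indic// setIT.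
- exact: measurable_heat.
- by move=> x _; exact: heat_ge0.
Qed.

(** The term k = 0 alone is half of the indicator of [F]. *)
Lemma majorant_ge x : F x -> (2^-1)%:E <= majorant x.
Proof.
move=> Fx.
apply: (@le_trans _ _ (\sum_(0 <= k < 1) term k x)); last first.
  exact: nneseries_lim_ge.
rewrite big_nat1 /term mul0r /heat.
rewrite (eq_integral (cst 1)); last first.
  by move=> w _; rewrite (process_start pZ) addr0 /ind indicE mem_set.
have := heat_cst P Z 0 1 x; rewrite /heat /= => ->.
by rewrite mule1 /half expr1.
Qed.

(** The free semigroup at time t moves each term to the next index, whose weight is half as large;
    the term k = 0 left out is nonnegative. *)
Lemma heat_majorant x : heat P Z t majorant x <= 2%:E * majorant x.
Proof.
have -> : heat P Z t majorant x = \sum_(0 <= k <oo) (2%:E * term k.+1 x).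
  rewrite {1}/heat integral_nneseries//.
    apply: eq_eseriesr => k _.
    rewrite ge0_integralZl// ?lee_fin ?half_ge0//; first last.
    - by move=> w _; exact: heat_ge0.
    - apply: (measurable_path_at2 pZ t x (f := heat P Z (k%:R * t)%R ind)).
      exact: measurable_heat.
    rewrite {1}halfS EFinM -muleA; congr (_ * (_ * _)).
    rewrite -[LHS]/(heat P Z t (heat P Z (k%:R * t)%R ind) x).
    by rewrite -(heat_semigroup hZ)// -natr1 mulrDl mul1r addrC.
  by move=> k; exact: (measurable_path_at2 pZ t x (mterm k)).
rewrite nneseriesZl; last by move=> k _; exact: term0.
apply: lee_wpmul2l; first by rewrite lee_fin.
apply: lime_le; first by apply: is_cvg_nneseries => k _ _.
apply: nearW => m.
apply: (@le_trans _ _ (\sum_(0 <= k < m.+1) term k x)).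
  by rewrite big_nat_recl// leeDr.
exact: nneseries_lim_ge.
Qed.

End majorant.

Lemma one_le_double (R : realFieldType) (u : R) :
  0 <= u -> 2^-1 <= u * u -> 1 <= 2 * u.
Proof. nra. Qed.

Section ground_state.
Context (R : realType) (n : nat).
Local Notation E := 'rV[R]_n.
Local Open Scope ereal_scope.
Context dO (Omega : measurableType dO) (P : probability Omega R)
  (Z : R -> Omega -> E).
Hypothesis hZ : levy P Z.
Let pZ := levy_process_of hZ.
Local Notation cst0 := (cst 0%R : E -> R).
Local Notation one := (cst 1 : E -> \bar R).
Local Notation leb := (@lebesgue_rV R n).
Variables (a b : E -> R).
Hypotheses (ma : measurable_fun [set: E] a) (mb : measurable_fun [set: E] b).
Hypotheses (a0 : forall y, (0 <= a y)%R) (b0 : forall y, (0 <= b y)%R).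
Hypotheses (sb : small_occupation P Z b) (ca : coercive a).
Local Notation T := (fk P Z a b).

Let one0 (y : E) : 0 <= one y. Proof. by rewrite lee_fin. Qed.

Lemma fk_one_bounded t : (0 <= t)%R ->
  exists2 M : R, (0 < M)%R & forall x, T t one x <= M%:E.
Proof.
move=> t0; have [M M0 hM] := fk_exp_moment hZ mb b0 sb t0.
exists M; first exact: M0.
move=> x; apply: le_trans (hM x).
exact: (fk_le_cst0 hZ t x ma mb a0 b0).
Qed.

Lemma fk_dbl_one_bounded t : (0 <= t)%R ->
  exists2 M : R, (0 < M)%R & forall x, fk P Z (dbl a) (dbl b) t one x <= M%:E.
Proof.
move=> t0.
have sb2 := small_occupation_dbl hZ mb b0 sb.
have [M M0 hM] := fk_exp_moment hZ (measurable_dbl mb) (dbl_ge0 b0) sb2 t0.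
exists M; first exact: M0.
move=> x; apply: le_trans (hM x).
exact: (fk_le_cst0 hZ t x (measurable_dbl ma) (measurable_dbl mb) (dbl_ge0 a0)
  (dbl_ge0 b0)).
Qed.

(** [fk_one_amgm] doubles the potentials once more. The exponential moment is at most [M], and the
    decaying term is at most e theta off a box; with theta = e / M each contributes e / 2. *)
Lemma fk_dbl_decay t (e : R) : (0 < t)%R -> (0 < e)%R ->
  exists r : R, forall x, ~ box r x -> fk P Z (dbl a) (dbl b) t one x <= e%:E.
Proof.
move=> t0 e0.
have ma2 := measurable_dbl ma; have mb2 := measurable_dbl mb.
have a20 := dbl_ge0 a0; have b20 := dbl_ge0 b0.
have sb4 := small_occupation_dbl hZ mb2 b20 (small_occupation_dbl hZ mb b0 sb).
have [M M0 hM] := fk_exp_moment hZ (measurable_dbl mb2) (dbl_ge0 b20) sb4 (ltW t0).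
pose theta := (e / M)%R.
have theta0 : (0 < theta)%R by rewrite divr_gt0.
have [r hr] := fk_decay hZ (measurable_dbl ma2) (dbl_ge0 a20)
  (coercive_dbl a20 (coercive_dbl a0 ca)) t0 (mulr_gt0 e0 theta0).
exists r => x /hr hx.
apply: (le_trans (fk_one_amgm hZ ma2 mb2 a20 b20 t x theta0)).
apply: (@le_trans _ _ ((theta / 2)%:E * M%:E + (2 * theta)^-1%:E * (e * theta)%:E)).
  apply: leeD; rewrite lee_wpmul2l// lee_fin; first by rewrite divr_ge0// ltW.
  by rewrite invr_ge0 mulr_ge0// ltW.
rewrite -!EFinM -EFinD lee_fin /theta.
have Mn : M != 0%R by rewrite gt_eqF.
have en : e != 0%R by rewrite gt_eqF.
rewrite le_eqVlt; apply/orP; left; apply/eqP; field.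
by rewrite Mn en.
Qed.

Section sqrt_majorant.
Variables (F : set E) (t : R).
Hypotheses (mF : measurable F) (t0 : (0 < t)%R).
Local Notation g := (majorant P Z F t).

Definition sqrt_majorant (y : E) : R := Num.sqrt (fine (g y)).
Local Notation q := sqrt_majorant.

Lemma sqrt_majorant_ge0 y : (0 <= q y)%R.
Proof. exact: sqrtr_ge0. Qed.

Lemma sqr_sqrt_majorant y : (q y)%:E * (q y)%:E = g y.
Proof.
have g0 := majorant_ge0 P Z F t y.
rewrite -EFinM -expr2 sqr_sqrtr ?fine_ge0// fineK//.
by rewrite ge0_fin_numE// (le_lt_trans (majorant_le1 hZ t mF y))// ltry.
Qed.

Lemma measurable_sqrt_majorant : measurable_fun [set: E] q.
Proof.
apply: (measurableT_comp (continuous_measurable_fun (@sqrt_continuous R))).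
apply: (measurableT_comp (fine_measurable _)) => //.
exact: (measurable_majorant hZ t mF).
Qed.

Lemma sqrt_majorant_le1 y : (q y <= 1)%R.
Proof.
have := majorant_le1 hZ t mF y; rewrite -sqr_sqrt_majorant -EFinM lee_fin.
by rewrite -expr2 expr_le1// sqrt_majorant_ge0.
Qed.

(** [key] combines AM-GM with [heat_majorant]. The choice theta = q(x) / eta gives eta q / 2 + eta
    q, whence the constant 3/2. *)
Lemma fk_sqrt_majorant (eta : R) x : (0 < eta)%R ->
  fk P Z (dbl a) (dbl b) t one x <= (eta ^+ 2)%:E ->
  T t (EFin \o q) x <= (3 / 2 * eta * q x)%:E.
Proof.
move=> eta0 hD.
have mq : measurable_fun [set: E] (EFin \o q).
  by apply/measurable_EFinP; exact: measurable_sqrt_majorant.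
have q0' y : 0 <= (EFin \o q) y by rewrite lee_fin sqrt_majorant_ge0.
have key (theta : R) : (0 < theta)%R ->
    T t (EFin \o q) x <= (theta / 2 * eta ^+ 2 + theta^-1 * q x ^+ 2)%:E.
  move=> th0; apply: (le_trans (fk_amgm hZ ma mb a0 b0 t x th0 mq q0')).
  rewrite EFinD; apply: leeD.
    by rewrite (EFinM (theta / 2)) lee_wpmul2l// lee_fin divr_ge0// ltW.
  rewrite (_ : (fun y => _) = g); last by apply/funext => y; exact: sqr_sqrt_majorant.
  apply: (@le_trans _ _ ((2 * theta)^-1%:E * (2%:E * g x))).
    apply: lee_wpmul2l; first by rewrite lee_fin invr_ge0 mulr_ge0// ltW.
    exact: (heat_majorant hZ mF (ltW t0) x).
  rewrite -sqr_sqrt_majorant -!EFinM lee_fin expr2.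
  rewrite le_eqVlt; apply/orP; left; apply/eqP; field.
  by rewrite gt_eqF.
have := sqrt_majorant_ge0 x; rewrite le_eqVlt => /predU1P[q0|q0]; last first.
  apply: (le_trans (key (q x / eta)%R _)); first by rewrite divr_gt0.
  rewrite lee_fin le_eqVlt; apply/orP; left; apply/eqP; field.
  by rewrite !gt_eqF.
(* Where q vanishes the previous choice is not positive; theta is now such that the first term of
   [key] equals an arbitrary e. *)
rewrite -q0 mulr0; apply/lee_addgt0Pr => e e0.
apply: (le_trans (key (2 * e / eta ^+ 2)%R _)).
  by rewrite divr_gt0 ?mulr_gt0 ?exprn_gt0.
rewrite -q0 add0e lee_fin expr0n/= mulr0 addr0.
rewrite le_eqVlt; apply/orP; left; apply/eqP; field.
by rewrite gt_eqF.
Qed.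

End sqrt_majorant.

Variables (phi : E -> R) (rho t : R).
Hypotheses (mphi : measurable_fun [set: E] phi) (phi0 : forall y, (0 < phi y)%R).
Hypothesis phi_bounded : exists K : R, forall y, (phi y <= K)%R.
Hypothesis phi_L2 : \int[leb]_x (phi x * phi x)%:E < +oo.
Hypotheses (t0 : (0 < t)%R) (rho0 : (0 < rho)%R).
Hypothesis eigen : {ae leb, forall x, T t (EFin \o phi) x = (rho * phi x)%:E}.

Lemma ground_state_integrable : \int[leb]_x (phi x)%:E < +oo.
Proof.
have [K phiK] := phi_bounded.
have [M M0 hM] := fk_one_bounded (ltW t0).
(* One third of the eigenvalue, so that the factor 3/2 eta of [fk_sqrt_majorant] is half of it. *)
pose eta := (rho / 3)%R.
have eta0 : (0 < eta)%R by rewrite divr_gt0.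
have [r hr] := fk_dbl_decay t0 (exprn_gt0 2 eta0).
have mphi' : measurable_fun [set: E] (EFin \o phi) by exact/measurable_EFinP.
have phi0' y : 0 <= (EFin \o phi) y by rewrite lee_fin ltW.
have pp0 y : 0 <= (phi y)%:E := phi0' y.
have ind0 (A : set E) y : 0 <= (\1_A y : R)%:E by rewrite lee_fin.
pose B := box r : set E.
have mB : measurable B by exact: measurable_box.
pose IB := \int[leb]_x ((phi x)%:E * (\1_B x)%:E).
have mphiB : measurable_fun [set: E] (fun x => (phi x)%:E * (\1_B x)%:E).
  apply: emeasurable_funM => //; apply/measurable_EFinP.
  exact: measurable_indic.
have IBoo : IB < +oo.
  apply: (@le_lt_trans _ _ (\int[leb]_x (K%:E * (\1_B x)%:E))).
    apply: ge0_le_integral => //.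
    - by move=> x _; rewrite mule_ge0.
    - apply: measurable_funeM; apply/measurable_EFinP; exact: measurable_indic.
    - by move=> x _; rewrite lee_wpmul2r// lee_fin.
  rewrite ge0_integralZl//; first last.
  - by rewrite lee_fin (le_trans _ (phiK 0%R))// ltW.
  - by apply/measurable_EFinP; exact: measurable_indic.
  rewrite integral_indic// setIT.
  apply: lte_mul_pinfty => //; last exact: lebesgue_rV_box.
  by rewrite lee_fin (le_trans _ (phiK 0%R))// ltW.
(* The constant does not involve the growing boxes, only the fixed box [B]. *)
pose C := (4 * M / rho)%:E * IB.
have Coo : C < +oo.
  rewrite /C; have IB0 : 0 <= IB.
    by apply: integral_ge0 => x _; rewrite mule_ge0.
  have /fineK <- : IB \is a fin_num by rewrite ge0_fin_numE.
  by rewrite -EFinM ltry.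
have main k : \int[leb]_(x in box k%:R) (phi x)%:E <= C.
  set F := box k%:R : set E.
  have mF : measurable F by exact: measurable_box.
  pose q := sqrt_majorant F t.
  have mq : measurable_fun [set: E] (EFin \o q).
    by apply/measurable_EFinP; exact: measurable_sqrt_majorant.
  have q0 y : 0 <= (EFin \o q) y by rewrite lee_fin sqrt_majorant_ge0.
  have qq0 y : 0 <= (q y)%:E := q0 y.
  pose I := \int[leb]_x ((phi x)%:E * (q x)%:E).
  have mI : measurable_fun [set: E] (fun x => (phi x)%:E * (q x)%:E).
    exact: emeasurable_funM.
  (* A priori finiteness, from phi q <= phi^2 + q^2 where both squares are integrable; without it,
     half of [I] could not be absorbed. *)
  have Ifin : I \is a fin_num.
    rewrite ge0_fin_numE; last by apply: integral_ge0 => x _; rewrite mule_ge0.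
    apply: (@le_lt_trans _ _ (\int[leb]_x ((phi x * phi x)%:E + majorant P Z F t x))).
      apply: ge0_le_integral => //.
      - by move=> x _; rewrite mule_ge0.
      - apply: emeasurable_funD; last exact: (measurable_majorant hZ t mF).
        by apply/measurable_EFinP; exact: measurable_funM.
      - move=> x _; rewrite -(sqr_sqrt_majorant t mF)// -/q -!EFinM -EFinD lee_fin.
        have := sqr_ge0 (phi x - q x); have := sqr_ge0 (phi x + q x); nra.
    rewrite ge0_integralD//; first last.
    - exact: (measurable_majorant hZ t mF).
    - by move=> x _; exact: majorant_ge0.
    - by apply/measurable_EFinP; exact: measurable_funM.
    - by move=> x _; rewrite lee_fin mulr_ge0// ltW.
    rewrite lte_add_pinfty//.
    apply: (le_lt_trans (integral_majorant hZ mF (ltW t0))).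
    exact: lebesgue_rV_box.
  (* The eigenvalue equation is paired with q and the operator moved to q by symmetry. In [B], q <=
     1 bounds its image by [M]; off [B] the image is at most (rho / 2) q. *)
  have step : rho%:E * I <= (rho / 2)%:E * I + M%:E * IB.
    have -> : rho%:E * I = \int[leb]_x ((EFin \o q) x * T t (EFin \o phi) x).
      rewrite -ge0_integralZl//; first last.
      - by rewrite lee_fin ltW.
      - by move=> x _; rewrite mule_ge0.
      apply: ae_eq_integral => //.
      - by apply: measurable_funeM.
      - by apply: emeasurable_funM => //; exact: measurable_fk.
      - by apply: filterS eigen => x -> _; rewrite /= EFinM muleA muleC.
    rewrite (fk_symmetric hZ (ltW t0))//.
    rewrite -ge0_integralZl//; first last.
    - by rewrite lee_fin divr_ge0// ltW.
    - by move=> x _; rewrite mule_ge0.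
    rewrite -ge0_integralZl//; first last.
    - by rewrite lee_fin ltW.
    - by move=> x _; rewrite mule_ge0.
    rewrite -ge0_integralD//; first last.
    - exact: measurable_funeM.
    - by move=> x _; rewrite !mule_ge0// lee_fin ltW.
    - exact: measurable_funeM.
    - by move=> x _; rewrite !mule_ge0// lee_fin ?divr_ge0// ltW.
    apply: ge0_le_integral => //.
    - by move=> x _; rewrite mule_ge0// fk_ge0.
    - by apply: emeasurable_funM => //; exact: measurable_fk.
    - by apply: emeasurable_funD; exact: measurable_funeM.
    - move=> x _ /=; rewrite muleCA [X in _ + X]muleCA -ge0_muleDr; first last.
      + by rewrite mule_ge0// lee_fin ltW.
      + by rewrite mule_ge0// lee_fin ?divr_ge0// ltW.
      apply: lee_wpmul2l; first by rewrite lee_fin ltW.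
      have [Bx|nBx] := pselect (B x).
        rewrite indicE mem_set// mule1.
        apply: (@le_trans _ _ M%:E).
          apply: le_trans (hM x); apply: le_fk => // y.
          by rewrite lee_fin sqrt_majorant_le1.
        by rewrite leeDr// mule_ge0// lee_fin divr_ge0// ltW.
      apply: (le_trans (fk_sqrt_majorant mF t0 eta0 (hr _ nBx))).
      rewrite indicE memNset// mule0 adde0 -EFinM lee_fin.
      rewrite (_ : (3 / 2 * eta = rho / 2)%R)//.
      by rewrite /eta; field.
  have I2 : I <= (2 * M / rho)%:E * IB.
    have IB0 : 0 <= IB.
      by apply: integral_ge0 => x _; rewrite mule_ge0.
    have IBfin : IB \is a fin_num by rewrite ge0_fin_numE.
    move: step; rewrite -(fineK Ifin) -(fineK IBfin) -!EFinM -EFinD !lee_fin => h.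
    rewrite mulrAC ler_pdivlMr//; lra.
  (* On [F] the square of q is at least 1/2, hence 2 q >= 1. *)
  apply: (@le_trans _ _ (2%:E * I)); last first.
    rewrite /C (_ : (4 * M / rho)%:E = 2%:E * (2 * M / rho)%:E); last first.
      by rewrite -EFinM; congr (_%:E); ring.
    by rewrite -muleA lee_wpmul2l.
  rewrite -ge0_integralZl//; last by move=> x _; rewrite mule_ge0.
  rewrite [leLHS]integral_mkcond; apply: ge0_le_integral => //.
  - by move=> x _; rewrite patchE; case: ifP => // _; rewrite lee_fin ltW.
  - by apply/(measurable_restrictT _ mF); apply: measurable_funTS.
  - exact: measurable_funeM.
  - move=> x _; rewrite patchE; case: ifPn => [xF|_]; last first.
      by rewrite !mule_ge0.
    rewrite muleCA -[leLHS]mule1; apply: lee_wpmul2l; first by rewrite lee_fin ltW.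
    have := majorant_ge hZ t (set_mem xF).
    rewrite -(sqr_sqrt_majorant t mF)// -/q -EFinM lee_fin => h.
    have : (0 <= q x)%R by exact: sqrt_majorant_ge0.
    by rewrite -EFinM lee_fin => /one_le_double; apply.
by apply: le_lt_trans Coo; exact: integral_box_le.
Qed.

End ground_state.

(** * From almost everywhere to everywhere *)

Section absolute_continuity.
Context (R : realType) (n : nat).
Local Notation E := 'rV[R]_n.
Local Open Scope ereal_scope.
Context dO (Omega : measurableType dO) (P : probability Omega R)
  (Z : R -> Omega -> E).
Hypothesis hZ : levy P Z.
Let pZ := levy_process_of hZ.
Local Notation cst0 := (cst 0%R : E -> R).
Local Notation one := (cst 1 : E -> \bar R).
Local Notation leb := (@lebesgue_rV R n).

Definition absolutely_continuous_law : Prop :=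
  forall t x (N : set E), (0 < t)%R -> measurable N -> leb N = 0 ->
    P [set w | N (x + Z t w)%R] = 0.

Hypothesis acZ : absolutely_continuous_law.
Variables (a b : E -> R).
Hypotheses (ma : measurable_fun [set: E] a) (mb : measurable_fun [set: E] b).
Hypotheses (a0 : forall y, (0 <= a y)%R) (b0 : forall y, (0 <= b y)%R).
Hypothesis sb : small_occupation P Z b.
Local Notation T := (fk P Z a b).

(** The path at a positive time almost surely avoids the exceptional null set, so the conclusion
    holds at every starting point. *)
Lemma fk_ae_le t f g x : (0 < t)%R ->
  measurable_fun [set: E] f -> measurable_fun [set: E] g ->
  (forall y, 0 <= f y) -> (forall y, 0 <= g y) ->
  {ae leb, forall y, f y <= g y} -> T t f x <= T t g x.
Proof.
move=> t0 mf mg f0 g0 [N [mN N0 fgN]].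
apply: ae_ge0_le_integral => //.
- by move=> w _; exact: fk_integrand_ge0.
- exact: measurable_fk_integrand2.
- by move=> w _; exact: fk_integrand_ge0.
- exact: measurable_fk_integrand2.
- exists [set w | N (x + Z t w)%R]; split.
  + rewrite -[X in measurable X]setTI.
    apply: (measurable_funDrV (f := fun=> x) (g := Z t)) => //.
    exact: process_at.
  + exact: acZ.
  + move=> w /= h; apply: fgN => /= fg; apply: h => _.
    by apply: lee_wpmul2l => //; rewrite mule_ge0// expeR_ge0.
Qed.

Lemma fk_ae_eq t f g x : (0 < t)%R ->
  measurable_fun [set: E] f -> measurable_fun [set: E] g ->
  (forall y, 0 <= f y) -> (forall y, 0 <= g y) ->
  {ae leb, forall y, f y = g y} -> T t f x = T t g x.
Proof.
move=> t0 mf mg f0 g0 fg; apply/eqP; rewrite eq_le !fk_ae_le//.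
  by apply: filterS fg => y ->.
by apply: filterS fg => y ->.
Qed.

Section eigenfunction.
Variables (phi : E -> R) (lambda K : R).
Hypotheses (mphi : measurable_fun [set: E] phi) (phi0 : forall y, (0 <= phi y)%R).
Hypotheses (phiK : forall y, (phi y <= K)%R) (cphi : continuous phi).
Hypothesis eigen : forall t, (0 < t)%R ->
  {ae leb, forall x, T t (EFin \o phi) x = (expR (- lambda * t) * phi x)%:E}.

Let mphi' : measurable_fun [set: E] (EFin \o phi).
Proof. exact/measurable_EFinP. Qed.

Let phi0' y : 0 <= (EFin \o phi) y. Proof. by rewrite lee_fin. Qed.

Let K0 : (0 <= K)%R. Proof. exact: le_trans (phi0 0%R) (phiK 0%R). Qed.

Lemma cvg_heat0 x :
  heat P Z k.+1%:R^-1 (EFin \o phi) x @[k --> \oo] --> (phi x)%:E.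
Proof.
have -> : (phi x)%:E = \int[P]_w (cst (phi x)%:E) w.
  by have := heat_cst P Z 0 (phi x) x; rewrite /heat /= => ->.
apply: (@dominated_cvg _ _ _ _ _ _ _ _ (cst K%:E)) => //.
- by move=> k; exact: (measurable_path_at2 pZ _ x mphi').
- move=> w _ /=; apply: cvg_EFin; first exact: nearW.
  have h : phi (x + Z s w)%R @[s --> (0:R)^'+] --> phi x.
    apply: (@cvg_comp _ _ _ (fun s => (x + Z s w)%R) phi _ (nbhs x)); last exact: cphi.
    have : (x + Z s w)%R @[s --> (0:R)^'+] --> (x + Z 0%R w)%R.
      by apply: cvgD; [exact: cvg_cst|exact: (levy_rc hZ)].
    by rewrite (process_start pZ) addr0.
  move/cvg_at_rightP : h; apply; split => [k|]; first by rewrite invr_gt0.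
  exact: cvg_harmonic.
- exact: finite_measure_integrable_cst.
- by move=> k w _; rewrite gee0_abs//= lee_fin.
Qed.

(** The eigenvalue equation at time t - delta holds almost everywhere; applying the semigroup for a
    time delta makes it an equality at every point. *)
Lemma eigen_shift delta t x : (0 < delta)%R -> (delta < t)%R ->
  T t (EFin \o phi) x = (expR (- lambda * (t - delta)))%:E * T delta (EFin \o phi) x.
Proof.
move=> d0 dt; have td0 : (0 < t - delta)%R by rewrite subr_gt0.
rewrite -{1}(subrK delta t) addrC (fk_semigroup hZ) ?ltW//.
rewrite -fkZl ?expR_ge0//.
apply: fk_ae_eq => //.
- exact: measurable_fk.
- exact: measurable_funeM.
- by move=> y; exact: fk_ge0.
- by move=> y; rewrite mule_ge0// lee_fin expR_ge0.
- by apply: filterS (eigen td0) => y ->; rewrite EFinM.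
Qed.

(** Subtraction is avoided by adding [K] to both sides: phi exp(B) + K <= phi + K exp(B), because (K
    - phi) (exp(B) - 1) >= 0, where B is the occupation integral. Khasminskii's lemma then bounds
    the expectation of exp(B) by 1 + 4 e. *)
Lemma fk_small_time_le delta x (e : R) : (0 < delta)%R ->
  (forall y, occ P Z b delta y <= (1 / 4)%:E) -> occ P Z b delta x <= e%:E ->
  T delta (EFin \o phi) x <= heat P Z delta (EFin \o phi) x + (4 * K * e)%:E.
Proof.
move=> d0 h4 he.
apply: (@le_trans _ _ (fk P Z cst0 b delta (EFin \o phi) x)).
  exact: fk_le_cst0.
rewrite -(@leeD2rE _ K%:E)//.
apply: (@le_trans _ _ (heat P Z delta (EFin \o phi) x +
    K%:E * fk P Z cst0 b delta one x)).
  rewrite !fk0b -{1}(heat_cst P Z delta K x) /heat.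
  have me : measurable_fun [set: Omega] (fun w => expeR (time_int Z b delta x w)).
    by apply: (measurableT_comp (@measurable_expeR R)); exact: measurable_time_int2.
  have mp := measurable_path_at2 pZ delta x mphi'.
  under [X in _ <= _ + _ * X]eq_integral do rewrite mule1.
  rewrite -ge0_integralZl//; last by move=> w _; exact: expeR_ge0.
  rewrite -ge0_integralD//; first last.
  - exact: emeasurable_funM.
  - by move=> w _; rewrite mule_ge0// expeR_ge0.
  rewrite -ge0_integralD//; first last.
  - exact: measurable_funeM.
  - by move=> w _; rewrite mule_ge0// expeR_ge0.
  apply: ge0_le_integral => //.
  - by move=> w _; rewrite adde_ge0// mule_ge0// expeR_ge0.
  - by apply: emeasurable_funD => //; exact: emeasurable_funM.
  - by apply: emeasurable_funD => //; exact: measurable_funeM.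
  - move=> w _ /=.
    have := phi0 (x + Z delta w)%R; have := phiK (x + Z delta w)%R.
    move: (phi _) => p pK p0.
    have : 0 <= time_int Z b delta x w by exact: time_int_ge0.
    case: (time_int Z b delta x w) => [A| |]//= A0.
      rewrite -!EFinM -!EFinD lee_fin.
      have : (1 <= expR A)%R by rewrite -expR0 ler_expR -lee_fin.
      nra.
    have [K00|K0'] := eqVneq K 0%R.
      have p00 : p = 0%R by apply/eqP; rewrite eq_le p0 -K00 pK.
      by rewrite K00 p00 mule0 mul0e.
    have K1 : 0 < K%:E by rewrite lte_fin lt0r K0' K0.
    by rewrite (gt0_muley K1) addey// leey.
move: (heat P Z delta (EFin \o phi) x) => H; rewrite -addeA leeD2l//.
apply: (@le_trans _ _ (K%:E * (1 + 4%:E * e%:E))).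
  apply: lee_wpmul2l => //.
  apply: (le_trans (khasminskii hZ mb b0 d0 h4 x)).
  by rewrite leeD2l// lee_wpmul2l.
have -> : K%:E * (1 + 4%:E * e%:E) = (K * (1 + 4 * e))%:E.
  by [].
by rewrite -EFinD lee_fin; lra.
Qed.

(** In [eigen_shift] let delta = 1/(k+1) tend to 0: the last short step exceeds the free semigroup
    by at most 4 K e, and the free semigroup converges to phi by [cvg_heat0]. *)
Lemma eigen_everywhere t x : (0 < t)%R ->
  T t (EFin \o phi) x <= (expR (- lambda * t) * phi x)%:E.
Proof.
move=> t0.
suff H (e : R) : (0 < e)%R ->
    T t (EFin \o phi) x <= (expR (- lambda * t) * (phi x + 4 * K * e))%:E.
  apply/lee_addgt0Pr => e e0.
  have c0 : (0 < expR (- lambda * t) * (4 * K + 1))%R.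
    by rewrite mulr_gt0 ?expR_gt0// ltr_wpDl// mulr_ge0.
  apply: (le_trans (H _ (divr_gt0 e0 c0))).
  rewrite -EFinD lee_fin mulrDr lerD2l.
  set c := (expR _ * (_ + 1))%R in c0 *.
  have cE : (c * (e / c) = e)%R by rewrite mulrC divfK// gt_eqF.
  rewrite -[leRHS]cE [leLHS]mulrA; apply: ler_wpM2r; first by rewrite divr_ge0// ltW.
  by rewrite /c ler_pM2l ?expR_gt0// lerDl.
move=> e0.
have [h1 h10 hh1] := sb e0.
have [h2 h20 hh2] := sb (ltac:(lra) : (0 < 1 / 4 :> R)%R).
have bnd : \forall k \near \oo, T t (EFin \o phi) x <=
    (expR (- lambda * (t - k.+1%:R^-1)))%:E *
    (heat P Z k.+1%:R^-1 (EFin \o phi) x + (4 * K * e)%:E).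
  near=> k.
  have d0 : (0 < k.+1%:R^-1 :> R)%R by rewrite invr_gt0.
  have dt : (k.+1%:R^-1 < t)%R by near: k; exact: near_infty_natSinv_lt (PosNum t0).
  have d1 : (k.+1%:R^-1 <= h1)%R.
    by apply: ltW; near: k; exact: near_infty_natSinv_lt (PosNum h10).
  have d2 : (k.+1%:R^-1 <= h2)%R.
    by apply: ltW; near: k; exact: near_infty_natSinv_lt (PosNum h20).
  rewrite (eigen_shift x d0 dt); apply: lee_wpmul2l; first by rewrite lee_fin expR_ge0.
  apply: (fk_small_time_le d0).
    by move=> y; apply: le_trans (hh2 y); exact: (le_occ hZ).
  by apply: le_trans (hh1 x); exact: (le_occ hZ).
have lim : (expR (- lambda * (t - k.+1%:R^-1)))%:E *
    (heat P Z k.+1%:R^-1 (EFin \o phi) x + (4 * K * e)%:E) @[k --> \oo] -->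
   (expR (- lambda * t))%:E * ((phi x)%:E + (4 * K * e)%:E).
  apply: cvgeM => //.
    apply: cvg_EFin; first exact: nearW.
    apply: (@cvg_comp _ _ _ (fun k => - lambda * (t - k.+1%:R^-1))%R expR _
       (nbhs (- lambda * t)%R)); last exact: continuous_expR.
    apply: cvgMr; have : (t - k.+1%:R^-1)%R @[k --> \oo] --> (t - 0)%R.
      by apply: cvgB; [exact: cvg_cst|exact: cvg_harmonic].
    by rewrite subr0.
  by apply: cvgeD => //; [exact: cvg_heat0|exact: cvg_cst].
rewrite EFinM EFinD -(cvg_lim (@ereal_hausdorff R) lim).
by apply: lime_ge => //; apply/cvg_ex; eexists; exact: lim.
Unshelve. all: by end_near. Qed.

End eigenfunction.

End absolute_continuity.

(** * Right limits in time *)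

Section lower_semicontinuity.
Context (R : realType) (n : nat).
Local Notation E := 'rV[R]_n.
Local Notation mu := (@lebesgue_measure R).
Local Open Scope ereal_scope.
Context dO (Omega : measurableType dO) (P : probability Omega R)
  (Z : R -> Omega -> E).
Hypothesis hZ : levy P Z.
Let pZ := levy_process_of hZ.
Local Notation one := (cst 1 : E -> \bar R).

Lemma occ_fin (b : E -> R) t x : measurable_fun [set: E] b ->
  (forall y, (0 <= b y)%R) -> small_occupation P Z b -> (0 <= t)%R ->
  occ P Z b t x < +oo.
Proof.
move=> mb b0 sb t0; have [M _ hM] := fk_exp_moment hZ mb b0 sb t0.
apply: (@le_lt_trans _ _ M%:E); last exact: ltry.
apply: le_trans (hM x); rewrite fk0b; apply: ge0_le_integral => //.
- by move=> w _; exact: time_int_ge0.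
- exact: measurable_time_int2.
- apply: emeasurable_funM => //; apply: (measurableT_comp (@measurable_expeR R)).
  exact: measurable_time_int2.
- move=> w _; rewrite mule1; apply: le_trans (expeR_ge1Dx _).
  by rewrite leeDr.
Qed.

Lemma time_int_split (a : E -> R) t e x w : measurable_fun [set: E] a ->
  (forall y, (0 <= a y)%R) -> (0 <= t)%R -> (0 <= e)%R ->
  time_int Z a (t + e) x w =
  time_int Z a t x w + \int[mu]_(s in `]t, (t + e)%R]) (a (x + Z s w)%R)%:E.
Proof.
move=> ma a0 t0 e0; rewrite /time_int.
have tte : (t <= t + e)%R by rewrite lerDl.
rewrite (_ : `[0%R, (t + e)%R]%classic = `[0%R, t]%classic `|` `]t, (t + e)%R]%classic); last first.
  by rewrite -itv_bndbnd_setU// bnd_simp.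
rewrite ge0_integral_setU//.
- by apply: measurable_funTS; exact: (measurable_time_integrand pZ).
- by move=> u _; rewrite lee_fin.
- apply/disj_setPLR => u /=; rewrite !in_itv /= => /andP[_ ut].
  by apply/negP; rewrite negb_and -leNgt ut.
Qed.

Definition locally_small_occupation (a : E -> R) : Prop :=
  forall r : R, small_occupation P Z (fun y => a y * \1_(box r : set E) y)%R.

Lemma integral_small_interval (f : R -> R) (t : R) :
  measurable_fun [set: R] f -> (forall s, (0 <= f s)%R) ->
  \int[mu]_(s in `]t, (t + 1)%R]) (f s)%:E < +oo ->
  \int[mu]_(s in `]t, (t + k.+1%:R^-1)%R]) (f s)%:E @[k --> \oo] --> 0.
Proof.
move=> mf f0 foo.
have sub k : `]t, (t + k.+1%:R^-1)%R] `<=` `]t, (t + 1)%R].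
  apply: subset_itvl; rewrite bnd_simp lerD2l -[leRHS]invr1.
  by rewrite lef_pV2 ?posrE// ler1n.
pose g k s := (f s)%:E * (\1_(`]t, (t + k.+1%:R^-1)%R]%classic : set R) s)%:E.
have -> : (fun k => \int[mu]_(s in `]t, (t + k.+1%:R^-1)%R]) (f s)%:E) =
    (fun k => \int[mu]_(s in `]t, (t + 1)%R]) g k s).
  apply/funext => k; rewrite integral_mkcond [RHS]integral_mkcond.
  apply: eq_integral => s _; rewrite !patchE /g indicE.
  have [sk|sk] := boolP (s \in `]t, (t + k.+1%:R^-1)%R]%classic).
    rewrite mule1 ifT// inE; apply: sub; move: sk; rewrite inE; exact.
  by rewrite mule0; case: ifP.
have -> : 0 = \int[mu]_(s in `]t, (t + 1)%R]) cst 0 s by rewrite integral0.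
apply: (@dominated_cvg _ _ _ mu _ _ g (cst 0) (EFin \o f)) => //.
- move=> k; apply: measurable_funTS; apply/measurable_EFinP.
  by apply: measurable_funM => //; exact: measurable_indic.
- move=> s; rewrite /= in_itv /= => /andP[ts _].
  have st0 : (0 < (s : R) - t)%R by rewrite subr_gt0.
  apply: cvg_near_cst; near=> k.
  rewrite /g indicE memNset ?mule0//= in_itv /= => /andP[_].
  apply/negP; rewrite -ltNge -ltrBrDl.
  by near: k; exact: (near_infty_natSinv_lt (PosNum st0)).
- apply/integrableP; split; first by apply: measurable_funTS; exact/measurable_EFinP.
  apply: le_lt_trans foo; rewrite le_eqVlt; apply/orP; left; apply/eqP.
  by apply: eq_integral => s _; rewrite gee0_abs ?lee_fin.
- move=> k s _; rewrite gee0_abs; last by rewrite mule_ge0// lee_fin.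
  rewrite /g /= -EFinM lee_fin -[leRHS]mulr1 ler_wpM2l// indicE.
Unshelve. all: by end_near. Qed.

Variables (a b : E -> R).
Hypotheses (ma : measurable_fun [set: E] a) (mb : measurable_fun [set: E] b).
Hypotheses (a0 : forall y, (0 <= a y)%R) (b0 : forall y, (0 <= b y)%R).
Hypothesis lsa : locally_small_occupation a.

(** The integral of [a] itself may be infinite, but almost surely the cut-offs of [a] to all boxes
    of integer radius have finite integrals up to t + 1. Right continuity keeps the path in one such
    box just after t, so the integral over that short interval tends to 0. The factor exp(- int a)
    up to time t is kept apart and may be 0. *)
Lemma cvg_time_int_right t x : (0 <= t)%R -> {ae P, forall w,
  expeR (- time_int Z a (t + k.+1%:R^-1) x w) @[k --> \oo] -->
  expeR (- time_int Z a t x w)}.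
Proof.
move=> t0.
pose ar (r : nat) y := (a y * \1_(box r%:R : set E) y)%R.
have mar r : measurable_fun [set: E] (ar r).
  by apply: measurable_funM => //; apply: measurable_indic; exact: measurable_box.
have ar0 r y : (0 <= ar r y)%R by rewrite mulr_ge0.
have t10 : (0 <= t + 1)%R by rewrite addr_ge0.
have aefin r : {ae P, forall w, time_int Z (ar r) (t + 1) x w \is a fin_num}.
  have I : P.-integrable setT (time_int Z (ar r) (t + 1) x).
    apply/integrableP; split; first exact: measurable_time_int2.
    under eq_integral do rewrite gee0_abs ?time_int_ge0//.
    exact: (occ_fin x (mar r) (ar0 r) (lsa _)).
  by apply: filterS (integrable_ae measurableT I) => w; apply.
have := ae_foralln aefin.
apply: filterS => w fin.
pose I k := \int[mu]_(s in `]t, (t + k.+1%:R^-1)%R]) (a (x + Z s w)%R)%:E.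
have I0 : I k @[k --> \oo] --> 0.
  (* The margin 1 leaves room for each coordinate to move by at most 1 after t. *)
  pose S := (\sum_j `|(x + Z t w)%R 0%R j| + 1)%R.
  pose r := (Num.truncn S).+1.
  have near_box : \forall s \near t^'+, box r%:R (x + Z s w)%R.
    have h : (x + Z s w)%R @[s --> t^'+] --> (x + Z t w)%R.
      by apply: cvgD; [exact: cvg_cst|exact: (levy_rc hZ)].
    have hi i : \forall s \near t^'+, (`|(x + Z s w) 0 i| <= r%:R)%R.
      have hc : (x + Z s w)%R 0%R i @[s --> t^'+] --> (x + Z t w)%R 0%R i.
        apply: (@cvg_comp _ _ _ (fun s => (x + Z s w)%R) (fun y : E => y 0%R i) _
          (nbhs (x + Z t w)%R)); first exact: h.
        exact: coord_continuous.
      have rS : (S <= r%:R)%R by apply: ltW; exact: truncnS_gt.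
      have iS : (`|(x + Z t w)%R 0%R i| + 1 <= S)%R.
        by rewrite /S lerD2r (bigD1 i)//= lerDl sumr_ge0.
      move/cvgrPdist_le : hc => /(_ 1%R ltr01); apply: filterS => s hs.
      apply: le_trans rS; apply: le_trans iS.
      rewrite -[X in (`|X| <= _)%R](subrK ((x + Z t w)%R 0%R i)) addrC.
      by apply: (le_trans (ler_normD _ _)); rewrite lerD2l distrC.
    exact: (filter_forall _ hi).
  have [d /= d0 hd] := near_box.
  have f0 s : (0 <= ar r (x + Z s w))%R by exact: ar0.
  have mf : measurable_fun [set: R] (fun s => ar r (x + Z s w)%R).
    exact: (measurableT_comp (mar r) (measurable_path1 pZ x w)).
  have J0 : \int[mu]_(s in `]t, (t + k.+1%:R^-1)%R]) (ar r (x + Z s w)%R)%:E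
      @[k --> \oo] --> 0.
    apply: integral_small_interval => //.
    have /fin_numPlt/andP[_] := fin r.
    rewrite time_int_split//; apply: le_lt_trans.
    by rewrite leeDr// time_int_ge0.
  apply: cvg_trans J0; apply: near_eq_cvg; near=> k.
  apply: eq_integral => s; rewrite inE /= in_itv /= => /andP[ts sk].
  rewrite /ar indicE mem_set ?mulr1//; apply: hd => //=.
  rewrite distrC gtr0_norm ?subr_gt0// ltrBlDl (le_lt_trans sk)// ltrD2l.
  by near: k; exact: (near_infty_natSinv_lt (PosNum d0)).
have -> : (fun k => expeR (- time_int Z a (t + k.+1%:R^-1) x w)) =
    (fun k => expeR (- time_int Z a t x w) * expeR (- I k)).
  apply/funext => k; rewrite time_int_split// ?invr_ge0// -expeRD; congr expeR.
  rewrite oppeD// ge0_adde_def// inE; first exact: time_int_ge0.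
  by apply: integral_ge0 => s _; rewrite lee_fin.
rewrite -[X in _ --> X]mule1; apply: cvgeZl.
  rewrite fin_numElt (lt_le_trans _ (expeR_ge0 _))//=.
  rewrite (@le_lt_trans _ _ 1)// ?ltry//.
  by rewrite -expeR0 lee_expeR oppe_le0 time_int_ge0.
have h : 1 - I k @[k --> \oo] --> 1.
  rewrite -[X in _ --> X]sube0; apply: cvgeB => //; exact: cvg_cst.
apply: (squeeze_cvge _ h (cvg_cst 1)); apply: nearW => k.
rewrite expeR_ge1Dx/= -expeR0 lee_expeR oppe_le0.
by apply: integral_ge0 => s _; rewrite lee_fin.
Unshelve. all: by end_near. Qed.

(* Shortening the time only increases exp (- int a), so after bounding exp (int b)
   at t by its value at t + e, monotone convergence takes the bound to t. *)
Lemma fk_one_right_limit t x (L : \bar R) : (0 <= t)%R ->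
  (forall e : R, (0 < e <= 1)%R -> fk P Z a b (t + e)%R one x <= L) ->
  fk P Z a b t one x <= L.
Proof.
move=> t0 hL.
pose v k w := expeR (time_int Z b t x w) *
  expeR (- time_int Z a (t + k.+1%:R^-1)%R x w).
have mv k : measurable_fun [set: Omega] (v k).
  apply: emeasurable_funM; apply: (measurableT_comp (@measurable_expeR R)).
    exact: measurable_time_int2.
  by apply: (measurableT_comp (@oppe_measurable R _)) => //;
    exact: measurable_time_int2.
have v0 k w : 0 <= v k w by rewrite mule_ge0// expeR_ge0.
have inv_le i j : (i <= j)%N -> (j.+1%:R^-1 <= i.+1%:R^-1 :> R)%R.
  by move=> ij; rewrite lef_pV2 ?posrE// ler_nat.
have ndv w : nondecreasing_seq (v ^~ w).
  move=> i j ij; rewrite lee_wpmul2l ?expeR_ge0// lee_expeR leeN2.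
  by apply: (le_time_int_time hZ) => //; rewrite lerD2l inv_le.
have lim : \int[P]_w v k w @[k --> \oo] --> \int[P]_w limn (v ^~ w).
  by apply: cvg_monotone_convergence.
apply: (@le_trans _ _ (\int[P]_w limn (v ^~ w))).
  apply: ae_ge0_le_integral => //.
  - by move=> w _; exact: fk_integrand_ge0.
  - exact: measurable_fk_integrand2.
  - by move=> w _; apply: lime_ge => //; [exact: ereal_nondecreasing_is_cvgn|exact: nearW].
  - apply: (emeasurable_fun_cvg v) => // w _.
    exact: ereal_nondecreasing_is_cvgn.
  - apply: filterS (cvg_time_int_right x t0) => w hw _; rewrite mule1.
    rewrite le_eqVlt; apply/orP; left; apply/eqP/esym/cvg_lim => //.
    apply: (@nd_cvgeM _ (fun=> _)) => //; try by move=> k; exact: expeR_ge0.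
      move=> i j ij; rewrite lee_expeR leeN2.
      by apply: (le_time_int_time hZ) => //; rewrite lerD2l inv_le.
    exact: cvg_cst.
rewrite -(cvg_lim (@ereal_hausdorff R) lim).
apply: lime_le; first by apply/cvg_ex; eexists; exact: lim.
apply: nearW => k.
have ek : (0 < (k.+1%:R^-1 : R) <= 1)%R by rewrite invr_gt0 ltr0n/= -[leRHS]invr1 (inv_le 0%N).
apply: le_trans (hL _ ek); apply: ge0_le_integral => //.
- apply: measurable_fk_integrand2 => //.
- move=> w _; rewrite mule1 lee_wpmul2r ?expeR_ge0// lee_expeR.
  by apply: (le_time_int_time hZ) => //; rewrite lerDl invr_ge0.
Qed.

End lower_semicontinuity.

(** * Contractivity and ground state domination *)

Section contractivity.
Context (R : realType) (n : nat).
Local Notation E := 'rV[R]_n.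
Local Open Scope ereal_scope.
Context dO (Omega : measurableType dO) (P : probability Omega R)
  (Z : R -> Omega -> E).
Hypothesis hZ : levy P Z.
Let pZ := levy_process_of hZ.
Local Notation one := (cst 1 : E -> \bar R).
Local Notation leb := (@lebesgue_rV R n).
Hypothesis acZ : absolutely_continuous_law P Z.
Variables (a b : E -> R).
Hypotheses (ma : measurable_fun [set: E] a) (mb : measurable_fun [set: E] b).
Hypotheses (a0 : forall y, (0 <= a y)%R) (b0 : forall y, (0 <= b y)%R).
Hypotheses (sb : small_occupation P Z b) (ca : coercive a).
Hypothesis lsa : locally_small_occupation P Z a.
Local Notation T := (fk P Z a b).
Variables (phi : E -> R) (lambda K : R).
Hypotheses (mphi : measurable_fun [set: E] phi) (phi0 : forall y, (0 < phi y)%R).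
Hypotheses (phiK : forall y, (phi y <= K)%R) (cphi : continuous phi).
Hypothesis phi_L2 : \int[leb]_x (phi x * phi x)%:E < +oo.
Hypothesis eigen : forall t, (0 < t)%R ->
  {ae leb, forall x, T t (EFin \o phi) x = (expR (- lambda * t) * phi x)%:E}.

Let one0 (y : E) : 0 <= one y. Proof. by rewrite lee_fin. Qed.

Let mphi' : measurable_fun [set: E] (EFin \o phi).
Proof. exact/measurable_EFinP. Qed.

Let phi0' y : 0 <= (EFin \o phi) y. Proof. by rewrite lee_fin ltW. Qed.

Let eigenE t x : (0 < t)%R ->
  T t (EFin \o phi) x <= (expR (- lambda * t) * phi x)%:E.
Proof.
apply: (eigen_everywhere hZ acZ ma mb a0 b0 sb mphi _ phiK cphi eigen).
by move=> y; exact: ltW.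
Qed.

(** IUC without weights: for g = phi f the weighted norm of f is the L^2 norm of g. The number [N]
    is any finite upper bound of that norm. *)
Definition l2_bound (t C : R) : Prop := forall (g : E -> R) (N : R),
  measurable_fun [set: E] g -> (forall x, 0 <= g x)%R -> (0 <= N)%R ->
  \int[leb]_x (g x * g x)%:E <= (N * N)%:E ->
  {ae leb, forall x, T t (EFin \o g) x <= (C * N * phi x)%:E}.

Lemma l2_bound_gsd t C : (0 < t)%R -> (0 <= C)%R -> l2_bound t C ->
  exists2 C' : R, (0 < C')%R & forall x, T (2 * t)%R one x <= (C' * phi x)%:E.
Proof.
move=> t0 C0 iuc.
have Phioo : \int[leb]_x (phi x)%:E < +oo.
  apply: (ground_state_integrable hZ ma mb a0 b0 sb ca mphi phi0 _ phi_L2 t0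
    (expR_gt0 (- lambda * t))) => //; first by exists K.
  exact: eigen.
have Phi0 : 0 <= \int[leb]_x (phi x)%:E by apply: integral_ge0 => x _; exact: phi0'.
pose Phi := fine (\int[leb]_x (phi x)%:E).
have PhiE : \int[leb]_x (phi x)%:E = Phi%:E by rewrite fineK// ge0_fin_numE.
have Phi0r : (0 <= Phi)%R by exact: fine_ge0.
have [M M0 hM] := fk_one_bounded hZ ma mb a0 b0 sb (ltW t0).
pose h x := fine (T t one x).
have T10 x : 0 <= T t one x by exact: fk_ge0.
have hE x : (h x)%:E = T t one x.
  by rewrite /h fineK// ge0_fin_numE// (le_lt_trans (hM x))// ltry.
have h0 x : (0 <= h x)%R by exact: fine_ge0.
have hhM x : (h x <= M)%R by rewrite -lee_fin hE.
have mh : measurable_fun [set: E] h.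
  apply: (measurableT_comp (fine_measurable _)) => //.
  exact: measurable_fk.
pose N0 := (C * Phi)%R.
have N00 : (0 <= N0)%R by exact: mulr_ge0.
have main (k : nat) : \int[leb]_(x in box k%:R) (h x * h x)%:E <= (N0 * N0)%:E.
  pose F := box k%:R : set E.
  have mF : measurable F by exact: measurable_box.
  (* The cut-off has a finite norm [N], so one factor [N] can be divided out of N^2 <= C N Phi. *)
  pose hk x := (h x * \1_F x)%R.
  have mhk : measurable_fun [set: E] hk.
    by apply: measurable_funM => //; exact: measurable_indic.
  have hk0 x : (0 <= hk x)%R by rewrite mulr_ge0.
  have hkE x : (hk x * hk x)%R = (hk x * h x)%R.
    rewrite /hk indicE; case: (_ \in _); rewrite ?mulr1// !mulr0 mul0r//.
  have mhk' : measurable_fun [set: E] (EFin \o hk) by exact/measurable_EFinP.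
  have mhkk : measurable_fun [set: E] (fun x => (hk x * hk x)%:E).
    by apply/measurable_EFinP; exact: measurable_funM.
  pose S := \int[leb]_x (hk x * hk x)%:E.
  have S0 : 0 <= S by apply: integral_ge0 => x _; rewrite lee_fin mulr_ge0.
  have Soo : S < +oo.
    apply: (@le_lt_trans _ _ (\int[leb]_x ((M * M)%:E * (\1_F x)%:E))).
      apply: ge0_le_integral => //.
      - by move=> x _; rewrite lee_fin mulr_ge0.
      - apply: measurable_funeM; apply/measurable_EFinP; exact: measurable_indic.
      - move=> x _; rewrite hkE -EFinM lee_fin /hk mulrAC ler_wpM2r//.
        by apply: ler_pM.
    rewrite ge0_integralZl//; first last.
    - by rewrite lee_fin mulr_ge0// ltW.
    - by apply/measurable_EFinP; exact: measurable_indic.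
    rewrite integral_indic// setIT.
    apply: lte_mul_pinfty => //; last exact: lebesgue_rV_box.
    by rewrite lee_fin mulr_ge0// ltW.
  pose N := Num.sqrt (fine S).
  have N_ge0 : (0 <= N)%R by exact: sqrtr_ge0.
  have SE : S = (N * N)%:E.
    by rewrite -expr2 sqr_sqrtr ?fine_ge0// fineK// ge0_fin_numE.
  have SN : S <= (C * N)%:E * \int[leb]_x (phi x)%:E.
    have -> : S = \int[leb]_x ((EFin \o hk) x * T t one x).
      by apply: eq_integral => x _; rewrite hkE EFinM hE.
    rewrite (fk_symmetric hZ (ltW t0))//.
    rewrite -ge0_integralZl//; first last.
    - by rewrite lee_fin mulr_ge0.
    - by move=> x _; exact: phi0'.
    have hk0' y : 0 <= (EFin \o hk) y by rewrite lee_fin.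
    apply: ae_ge0_le_integral => //.
    - by move=> x _; rewrite mul1e; exact: fk_ge0.
    - by apply: emeasurable_funM => //; exact: measurable_fk.
    - by move=> x _; rewrite mule_ge0// ?lee_fin ?mulr_ge0//; exact: ltW.
    - exact: measurable_funeM.
    - have := iuc hk N mhk hk0 N_ge0; rewrite -/S SE => /(_ (lexx _)).
      by apply: filterS => x hx _; rewrite mul1e -EFinM.
  have NN0 : (N <= N0)%R.
    move: SN; rewrite SE PhiE -EFinM lee_fin -mulrA (mulrC N Phi) mulrA -/N0.
    have [->//|N0'] := eqVneq N 0%R.
    by rewrite ler_pM2r// lt0r N0' N_ge0.
  apply: (@le_trans _ _ S); last by rewrite SE lee_fin ler_pM.
  rewrite integral_mkcond; apply: ge0_le_integral => //.
  - by move=> x _; rewrite patchE; case: ifP => // _; rewrite lee_fin mulr_ge0.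
  - apply/(measurable_restrictT _ mF); apply: measurable_funTS.
    by apply/measurable_EFinP; exact: measurable_funM.
  - move=> x _; rewrite patchE /hk indicE; case: ifPn => [xF|_].
      by rewrite lee_fin mulr1.
    by rewrite lee_fin mulr_ge0// mulr_ge0.
have hL2 : \int[leb]_x (h x * h x)%:E <= (N0 * N0)%:E.
  apply: integral_box_le => //.
    by apply/measurable_EFinP; exact: measurable_funM.
  by move=> x; rewrite lee_fin mulr_ge0.
have aeT := iuc h N0 mh h0 N00 hL2.
have CN0 : (0 <= C * N0)%R by exact: mulr_ge0.
(* The exponential bounds exp(- lambda e) for all e in ]0, 1], and the summand 1 makes the constant
   positive. *)
exists (C * N0 * expR `|lambda| + 1)%R.
  by rewrite ltr_wpDl// mulr_ge0// expR_ge0.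
move=> x; apply: (@fk_one_right_limit _ _ _ _ P Z hZ a b ma mb a0 b0 lsa).
  by rewrite mulr_ge0// ltW.
move=> e /andP[e0 e1].
have mh' : measurable_fun [set: E] (EFin \o h) by exact/measurable_EFinP.
have h0' y : 0 <= (EFin \o h) y by rewrite lee_fin.
have -> : T (2 * t + e)%R one x = T e (T t (EFin \o h)) x.
  have t20 : (0 <= 2 * t)%R by rewrite mulr_ge0// ltW.
  have m1 : measurable_fun [set: E] one by exact: measurable_cst.
  have -> : (2 * t + e = e + 2 * t)%R by exact: addrC.
  have -> := fk_semigroup hZ (ltW e0) t20 ma mb a0 b0 x m1 one0.
  have Tt : T t one = EFin \o h by apply/funext => z; rewrite /= hE.
  suff -> : T (2 * t)%R one = T t (EFin \o h) by [].
  apply/funext => y; have -> : (2 * t = t + t)%R by rewrite mulr_natl mulr2n.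
  by have -> := fk_semigroup hZ (ltW t0) (ltW t0) ma mb a0 b0 y m1 one0; rewrite Tt.
apply: (@le_trans _ _ (T e (fun y => (C * N0)%:E * (EFin \o phi) y) x)).
  apply: (fk_ae_le hZ acZ ma mb a0 b0) => //.
  - exact: measurable_fk.
  - exact: measurable_funeM.
  - by move=> y; exact: fk_ge0.
  - by move=> y; rewrite mule_ge0.
rewrite fkZl//.
apply: (@le_trans _ _ ((C * N0)%:E * (expR (- lambda * e) * phi x)%:E)).
  by apply: lee_wpmul2l; [rewrite lee_fin|exact: eigenE].
rewrite -EFinM lee_fin mulrA; apply: ler_wpM2r; first exact: ltW.
rewrite (@le_trans _ _ (C * N0 * expR `|lambda|)%R) ?lerDl//.
rewrite ler_wpM2l// ler_expR (le_trans (ler_norm _))// normrM normrN.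
by rewrite (gtr0_norm e0) ler_piMr.
Qed.

(** After time t the semigroup acts on a multiple of phi, which [eigen_everywhere] keeps below a
    multiple of phi. *)
Lemma gsd_mono t s C : (0 < t)%R -> (t <= s)%R -> (0 <= C)%R ->
  (forall x, T t one x <= (C * phi x)%:E) ->
  exists2 C' : R, (0 < C')%R & forall x, T s one x <= (C' * phi x)%:E.
Proof.
move=> t0; rewrite le_eqVlt => /predU1P[<-|ts] C0 hC.
  exists (C + 1)%R; first by rewrite ltr_wpDl.
  move=> x; apply: (le_trans (hC x)); rewrite lee_fin ler_wpM2r ?lerDl//.
  exact: ltW.
have st0 : (0 < s - t)%R by rewrite subr_gt0.
exists (C * expR (- lambda * (s - t)) + 1)%R.
  by rewrite ltr_wpDl// mulr_ge0// expR_ge0.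
move=> x; have m1 : measurable_fun [set: E] one by exact: measurable_cst.
have := fk_semigroup hZ (ltW st0) (ltW t0) ma mb a0 b0 x m1 one0.
rewrite subrK => ->.
apply: (@le_trans _ _ (T (s - t)%R (fun y => C%:E * (EFin \o phi) y) x)).
  apply: (le_fk hZ ma mb a0 b0) => //.
  - exact: measurable_fk.
  - exact: measurable_funeM.
  - by move=> y; exact: fk_ge0.
rewrite fkZl//.
apply: (@le_trans _ _ (C%:E * (expR (- lambda * (s - t)) * phi x)%:E)).
  by apply: lee_wpmul2l; [rewrite lee_fin|exact: eigenE].
rewrite -EFinM lee_fin mulrA; apply: ler_wpM2r; first exact: ltW.
by rewrite lerDl.
Qed.

Lemma gsd_l2_bound t C Cp : (0 < t)%R -> (0 <= C)%R -> (0 <= Cp)%R ->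
  (forall f x, measurable_fun [set: E] f -> (forall y, 0 <= f y) ->
    heat P Z t f x <= Cp%:E * \int[leb]_y f y) ->
  (forall x, T t one x <= (C * phi x)%:E) ->
  exists2 C' : R, (0 < C')%R & forall (g : E -> R) (N : R),
  measurable_fun [set: E] g -> (forall x, 0 <= g x)%R -> (0 <= N)%R ->
  \int[leb]_x (g x * g x)%:E <= (N * N)%:E ->
  forall x, T (2 * t)%R (EFin \o g) x <= (C' * N * phi x)%:E.
Proof.
move=> t0 C0 Cp0 hp hC.
have [M M0 hM] := fk_dbl_one_bounded hZ ma mb a0 b0 sb (ltW t0).
(* The bound [key] at theta = N is exactly L N. *)
pose L := ((M + Cp) / 2)%R.
have L0 : (0 <= L)%R by rewrite divr_ge0// addr_ge0// ltW.
exists (C * L + 1)%R; first by rewrite ltr_wpDl// mulr_ge0.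
move=> g N mg g0 N0 hN.
have mg' : measurable_fun [set: E] (EFin \o g) by exact/measurable_EFinP.
have g0' y : 0 <= (EFin \o g) y by rewrite lee_fin.
have key (theta : R) y : (0 < theta)%R ->
    T t (EFin \o g) y <= (theta / 2 * M + (2 * theta)^-1 * (Cp * (N * N)))%:E.
  move=> th0; apply: (le_trans (fk_amgm hZ ma mb a0 b0 t y th0 mg' g0')).
  rewrite EFinD; apply: leeD.
    rewrite (EFinM (theta / 2)); apply: lee_wpmul2l; last exact: hM.
    by rewrite lee_fin divr_ge0// ltW.
  rewrite (EFinM (2 * theta)^-1); apply: lee_wpmul2l.
    by rewrite lee_fin invr_ge0 mulr_ge0// ltW.
  apply: (le_trans (hp _ _ _ _)).
  - exact: emeasurable_funM.
  - by move=> z; rewrite mule_ge0.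
  - by rewrite EFinM lee_wpmul2l.
have bound y : T t (EFin \o g) y <= (L * N)%:E.
  move: N0; rewrite le_eqVlt => /predU1P[N0|N0]; last first.
    apply: (le_trans (key N y N0)); rewrite lee_fin /L.
    rewrite le_eqVlt; apply/orP; left; apply/eqP; field.
    by rewrite gt_eqF.
  (* For N = 0 that choice of theta is not positive; theta = 2 e / M makes the remaining term equal
     to e. *)
  rewrite -N0 mulr0; apply/lee_addgt0Pr => e e0.
  apply: (le_trans (key (2 * e / M)%R y _)); first by rewrite divr_gt0// mulr_gt0.
  rewrite -N0 add0e lee_fin !mulr0 addr0.
  rewrite le_eqVlt; apply/orP; left; apply/eqP; field.
  by rewrite gt_eqF.
move=> x; have := fk_semigroup hZ (ltW t0) (ltW t0) ma mb a0 b0 x mg' g0'.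
rewrite -mulr2n -(mulr_natl t) => ->.
apply: (@le_trans _ _ (T t (fun y => (L * N)%:E * one y) x)).
  apply: (le_fk hZ ma mb a0 b0) => //.
  - exact: measurable_fk.
  - by move=> y; exact: fk_ge0.
  - by move=> y; rewrite mule1.
rewrite fkZl//; last by rewrite mulr_ge0.
apply: (@le_trans _ _ ((L * N)%:E * (C * phi x)%:E)).
  by apply: lee_wpmul2l => //; rewrite lee_fin mulr_ge0.
rewrite -EFinM lee_fin.
have NP : (0 <= N * phi x)%R by rewrite mulr_ge0// ltW.
rewrite (_ : L * N * (C * phi x) = C * L * (N * phi x))%R; last by ring.
by rewrite -[leRHS]mulrA ler_wpM2r// lerDl.
Qed.

End contractivity.

(** * The potential and the transition densities *)

Section enorm.
Context (R : realType) (n : nat).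
Local Notation E := 'rV[R]_n.

Lemma coord_le_enorm (x : E) i : `|x 0 i| <= enorm x.
Proof.
rewrite -sqrtr_sqr ler_sqrt; last first.
  by rewrite sumr_ge0// => j _; rewrite -expr2 sqr_ge0.
rewrite /dotp (bigD1 i)//= expr2 lerDl sumr_ge0// => j _.
by rewrite -expr2 sqr_ge0.
Qed.

(** The squared Euclidean norm on the box is at most n r^2 <= (n |r|)^2 < (n |r| + 1)^2. *)
Lemma box_sub_eball (r : R) : exists2 r' : R, 0 < r' & @box R n r `<=` eball 0 r'.
Proof.
exists (n%:R * `|r| + 1); first by rewrite ltr_wpDl// mulr_ge0.
move=> x hx; rewrite /eball /= subr0 /enorm.
have r'0 : 0 <= n%:R * `|r| + 1 by rewrite addr_ge0// mulr_ge0.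
rewrite -[ltRHS](ger0_norm r'0) -sqrtr_sqr ltr_sqrt; last first.
  by rewrite exprn_gt0// ltr_wpDl// mulr_ge0.
apply: (@le_lt_trans _ _ (\sum_(i < n) `|r| ^+ 2)).
  apply: ler_sum => i _; rewrite -expr2 -(real_normK (num_real (x 0 i))).
  by rewrite ler_sqr ?nnegrE// (le_trans (hx i))// ler_norm.
rewrite sumr_const card_ord -[ltLHS]mulr_natl.
apply: (@le_lt_trans _ _ (n%:R ^+ 2 * `|r| ^+ 2)).
  rewrite ler_wpM2r ?sqr_ge0// -natrX ler_nat.
  by case: n => // m; rewrite leq_pmulr.
rewrite -exprMn; have : 0 <= n%:R * `|r| by rewrite mulr_ge0.
move: (n%:R * `|r|) => u u0; nra.
Qed.

End enorm.

Section link.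
Context (R : realType) (n : nat).
Local Notation E := 'rV[R]_n.
Local Notation mu := (@lebesgue_measure R).
Local Notation leb := (@lebesgue_rV R n).
Context dO (Omega : measurableType dO) (P : probability Omega R)
  (X : R -> {RV P >-> E}).
Hypotheses (lX : levy_process X) (sX : symmetric_process X).
Local Notation Z := (centered X).
Let hZ : levy P Z := centered_levy lX sX.
Let pZ := levy_process_of hZ.
Local Open Scope ereal_scope.

Lemma centeredK s w : (0 <= s)%R -> X s w = (X 0%R w + Z s w)%R.
Proof. by move=> s0; rewrite /centered max_l// addrC subrK. Qed.

Lemma measurable_from_start (U : measurableType default_measure_display)
    (F : E * Omega -> U) x : measurable_fun [set: E * Omega] F ->
  measurable_fun [set: Omega] (fun w => F ((x + X 0%R w)%R, w)).
Proof.
move=> mF; apply: (measurableT_comp (f := F) mF (g := fun w => ((x + X 0%R w)%R, w))).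
apply: measurable_fun_pair => //; apply: measurable_funDrV => //.
Qed.

(** The process started at x is x + X_0 plus the centered one, and X_0 vanishes almost surely. *)
Lemma integral_from_start (F : E * Omega -> \bar R) x :
  measurable_fun [set: E * Omega] F ->
  \int[P]_w F ((x + X 0%R w)%R, w) = \int[P]_w F (x, w).
Proof.
move=> mF; apply: ae_eq_integral => //.
- exact: measurable_from_start.
- exact: (measurableT_comp (f := F) mF (pair1_measurable x)).
- by apply: filterS (levy_start lX) => w ->; rewrite addr0.
Qed.

Lemma time_int_from_start (b : E -> R) t x w : (0 <= t)%R ->
  \int[mu]_(s in `[0%R, t]) (b (x + X s w)%R)%:E =
  time_int Z b t (x + X 0%R w)%R w.
Proof.
move=> t0; apply: eq_integral => s; rewrite inE /= in_itv /= => /andP[s0 _].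
by rewrite centeredK// addrA.
Qed.

Lemma Ex_occ (b : E -> R) t x : measurable_fun [set: E] b ->
  (forall y, (0 <= b y)%R) -> (0 <= t)%R ->
  Ex X x (fun w => \int[mu]_(s in `[0%R, t]) `|b (w s)|%:E) = occ P Z b t x.
Proof.
move=> mb b0 t0; rewrite /Ex /occ.
rewrite -(@integral_from_start (fun q => time_int Z b t q.1 q.2)); last first.
  exact: measurable_time_int.
apply: eq_integral => w _ /=; rewrite -time_int_from_start//.
by apply: eq_integral => s _; rewrite ger0_norm.
Qed.

Lemma kato_small_occupation (b : E -> R) : (forall y, (0 <= b y)%R) ->
  kato X b -> small_occupation P Z b.
Proof.
move=> b0 [mb hk] e e0.
have e0' : 0 < e%:E by rewrite lte_fin.
have : \forall t \near 0%R^'+, ereal_sup [set Ex X x (fun w =>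
      \int[mu]_(s in `[0%R, t]) `|b (w s)|%:E) | x in setT] < e%:E.
  have /hk : nbhs (0%:E : \bar R) [set u | u < e%:E].
    exact: (open_ereal_lt' e0').
  by [].
move=> [d /= d0 hd]; exists (d / 2)%R; first by rewrite divr_gt0.
move=> x; have d20 : (0 < d / 2)%R by rewrite divr_gt0.
have /ltW : ereal_sup [set Ex X x (fun w =>
      \int[mu]_(s in `[0%R, (d / 2)%R]) `|b (w s)|%:E) | x in setT] < e%:E.
  apply: hd => //=; rewrite sub0r normrN gtr0_norm//; lra.
apply: le_trans; rewrite -Ex_occ//; last exact: ltW.
by apply: ereal_sup_ubound; exists x.
Qed.

Section potential.
Variable V : E -> R.
Hypotheses (hV : kato_potential X V) (hVc : confining V).
Local Notation a := (V^\+)%R.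
Local Notation b := (V^\-)%R.

Lemma pot_a0 y : (0 <= a y)%R. Proof. exact: funrpos_ge0. Qed.
Lemma pot_b0 y : (0 <= b y)%R. Proof. exact: funrneg_ge0. Qed.
Lemma pot_ma : measurable_fun [set: E] a. Proof. by have [_ []] := hV. Qed.
Lemma pot_mb : measurable_fun [set: E] b. Proof. by have [[]] := hV. Qed.

Lemma pot_small : small_occupation P Z b.
Proof. by have [kb _] := hV; apply: kato_small_occupation kb; exact: pot_b0. Qed.

Lemma pot_coercive : coercive a.
Proof.
move=> M; have [r hr] := hVc M; exists r => x /existsNP[i /negP].
rewrite -ltNge => ri; rewrite /funrpos le_max; apply/orP; left; apply: hr.
by rewrite (le_trans (ltW ri))// coord_le_enorm.
Qed.

Lemma pot_locally_small : locally_small_occupation P Z a.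
Proof.
move=> r; have [r' r'0 hr'] := @box_sub_eball R n r.
have [_ [_ /(_ 0%R r' r'0) hk]] := hV.
have m0 y : (0 <= (a \* \1_(eball 0%R r')) y)%R by rewrite mulr_ge0// pot_a0.
have sm := kato_small_occupation m0 hk.
move=> e e0; have [h h0 hh] := sm e e0; exists h; first exact: h0.
move=> x.
apply: le_trans (hh x).
have mbox : measurable_fun [set: E] (fun y => a y * \1_(box r : set E) y)%R.
  apply: measurable_funM; first exact: pot_ma.
  by apply: measurable_indic; exact: measurable_box.
have mball : measurable_fun [set: E] (a \* \1_(eball 0%R r'))%R by case: hk.
have box0 y : (0 <= a y * \1_(box r : set E) y)%R by rewrite mulr_ge0// pot_a0.
apply: ge0_le_integral => //.
- by move=> w _; exact: time_int_ge0.
- exact: measurable_time_int2.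
- exact: measurable_time_int2.
- move=> w _; apply: le_time_int => // y; rewrite box0/=.
  apply: ler_wpM2l; first exact: pot_a0.
  rewrite !indicE.
  have [yb|yb] := pselect (box r y); last by rewrite (memNset yb).
  by rewrite !mem_set//; exact: hr'.
Qed.

Lemma integral_potential t x w : \int[mu]_(s in `[0%R, t]) (V (x + Z s w)%R)%:E =
  time_int Z a t x w - time_int Z b t x w.
Proof.
rewrite integralE; congr (_ - _); apply: eq_integral => s _.
  by rewrite funeposE /funrpos EFin_max.
by rewrite funenegE /funrneg EFin_max.
Qed.

(** The integral of V^- has finite expectation, hence is almost surely finite. The exponent is then
    not indeterminate and the exponential factors, even where the integral of V^+ is infinite. *)
Lemma feynman_kacE t (f : E -> R) x : (0 <= t)%R -> measurable_fun [set: E] f ->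
  feynman_kac X V t f x = \int[P]_w
    (expeR (time_int Z b t x w) * expeR (- time_int Z a t x w)
     * (f (x + Z t w)%R)%:E).
Proof.
move=> t0 mf; rewrite /feynman_kac /Ex.
pose F (q : E * Omega) := expeR (- (time_int Z a t q.1 q.2 - time_int Z b t q.1 q.2))
  * (f (q.1 + Z t q.2)%R)%:E.
have ma := pot_ma; have mb := pot_mb; have a0 := pot_a0; have b0 := pot_b0.
have mF : measurable_fun [set: E * Omega] F.
  apply: emeasurable_funM; last first.
    by apply/measurable_EFinP; apply: (measurableT_comp mf);
      apply: measurable_funDrV => //; exact: (measurableT_comp (process_at t pZ)).
  apply: (measurableT_comp (@measurable_expeR R)).
  apply: (measurableT_comp (@oppe_measurable R _)) => //.
  by apply: emeasurable_funB; exact: measurable_time_int.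
transitivity (\int[P]_w F ((x + X 0%R w)%R, w)).
  apply: eq_integral => w _; rewrite /F /= -integral_potential; congr (_ * _).
    congr (expeR (- _)); apply: eq_integral => s; rewrite inE /= in_itv /= => /andP[s0 _].
    by rewrite centeredK// addrA.
  by rewrite centeredK// addrA.
rewrite integral_from_start//.
apply: ae_eq_integral => //.
- exact: (measurableT_comp (f := F) mF (pair1_measurable x)).
- apply: (measurable_fk_integrand2 pZ ma mb a0 b0 t x (f := EFin \o f)).
  exact/measurable_EFinP.
have I : P.-integrable setT (time_int Z b t x).
  apply/integrableP; split; first exact: measurable_time_int2.
  under eq_integral do rewrite gee0_abs ?time_int_ge0//.
  exact: (occ_fin hZ x mb b0 pot_small t0).
apply: filterS (integrable_ae measurableT I) => w /(_ Logic.I) bfin _.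
rewrite /F /=; congr (_ * _).
have : 0 <= time_int Z a t x w by exact: time_int_ge0.
rewrite -(fineK bfin); case: (time_int Z a t x w) => [A| |]//= _.
  by rewrite -EFinM -expRD; congr (expR _)%:E; rewrite opprB.
by rewrite mule0.
Qed.

Lemma feynman_kac_fk t (f : E -> R) x : (0 <= t)%R -> measurable_fun [set: E] f ->
  feynman_kac X V t f x = fk P Z a b t (EFin \o f) x.
Proof. by move=> t0 mf; rewrite feynman_kacE. Qed.

(** This reduces signed functions to the nonnegative ones treated by [fk]. *)
Lemma abse_feynman_kac_le t (f : E -> R) x : (0 <= t)%R ->
  measurable_fun [set: E] f ->
  `|feynman_kac X V t f x| <= fk P Z a b t (fun y => `|f y|%:E) x.
Proof.
move=> t0 mf; rewrite feynman_kacE//.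
have mi : measurable_fun [set: Omega] (fun w =>
   expeR (time_int Z b t x w) * expeR (- time_int Z a t x w)
     * (f (x + Z t w)%R)%:E).
  apply: (measurable_fk_integrand2 pZ pot_ma pot_mb pot_a0 pot_b0 t x (f := EFin \o f)).
  exact/measurable_EFinP.
apply: (le_trans (le_abse_integral P measurableT mi)).
rewrite le_eqVlt; apply/orP; left; apply/eqP.
apply: eq_integral => w _; rewrite abseM gee0_abs//.
by rewrite mule_ge0// expeR_ge0.
Qed.

End potential.

(** * Bounds from transition densities *)

Section density.
Variables (p : R -> E -> R).
Hypothesis hp : transition_density X p.

Let law_shift t x (A : set E) : (0 < t)%R -> measurable A ->
  P [set w | A (x + Z t w)%R] = \int[leb]_(y in A) (p t (y - x)%R)%:E.
Proof.
move=> t0 mA; have [_ _ <-//] := hp t0.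
have mA' : measurable [set y : E | A (x + y)%R].
  rewrite -[X in measurable X]setTI.
  exact: (measurable_funDrV (f := fun=> x) (g := id)).
exact: (centered_law lX (ltW t0) mA').
Qed.

Lemma density_absolutely_continuous : absolutely_continuous_law P Z.
Proof.
move=> t x N t0 mN N0; rewrite law_shift//.
have [mp p0 _] := hp t0.
apply: null_set_integral => //.
apply/measurable_funTS/measurable_EFinP.
by apply: (measurableT_comp mp); exact: (measurable_funBrV (f := id) (g := fun=> x)).
Qed.

(** The law of x + Z_t is bounded by [C] times Lebesgue measure on every set, hence also on
    integrals. *)
Lemma heat_le_integral t (C : R) f x : (0 < t)%R -> (0 <= C)%R ->
  (forall y, p t y <= C)%R -> measurable_fun [set: E] f -> (forall y, 0 <= f y) ->
  heat P Z t f x <= C%:E * \int[leb]_y f y.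
Proof.
move=> t0 C0 pC mf f0.
have mx : measurable_fun [set: Omega] (fun w => (x + Z t w)%R).
  by apply: (measurable_funDrV (f := fun=> x) (g := Z t)) => //; exact: process_at.
pose mm := isMeasurableFun.Build _ _ _ _ _ mx.
pose mp : {mfun Omega >-> E} := HB.pack (fun w => (x + Z t w)%R) mm.
pose Cn : {nonneg R} := NngNum C0.
have -> : heat P Z t f x = \int[pushforward P mp]_y f y.
  by rewrite (ge0_integral_pushforward mx).
rewrite -[C]/(Cn%:num) -(ge0_integral_mscale leb measurableT Cn)//.
apply: ge0_le_measure_integral => // A mA.
rewrite /= /pushforward /mscale /=.
rewrite (_ : P _ = \int[leb]_(y in A) (p t (y - x)%R)%:E); last exact: law_shift.
have [mpt p0 _] := hp t0.
rewrite -integral_cst//; apply: ge0_le_integral => //.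
- by move=> y _; rewrite lee_fin.
- apply/measurable_funTS/measurable_EFinP.
  by apply: (measurableT_comp mpt); exact: (measurable_funBrV (f := id) (g := fun=> x)).
- by move=> y _; rewrite lee_fin.
Qed.

(** A bound valid at time s persists: the remaining time t - s only averages a function already
    bounded by a constant. *)
Lemma heat_le_integral_after s t (C : R) f x : (0 < s)%R -> (s <= t)%R ->
  (0 < C)%R -> (forall y, p s y <= C)%R -> measurable_fun [set: E] f ->
  (forall y, 0 <= f y) ->
  heat P Z t f x <= C%:E * \int[leb]_y f y.
Proof.
move=> s0 st C0 pC mf f0.
have I0 : 0 <= \int[leb]_y f y by exact: integral_ge0.
have ts0 : (0 <= t - s)%R by rewrite subr_ge0.
have := heat_semigroup hZ x ts0 (ltW s0) mf f0; rewrite subrK => ->.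
have [Ioo|Ifin] := eqVneq (\int[leb]_y f y) +oo.
  by rewrite Ioo gt0_muley ?lte_fin// leey.
have IE : \int[leb]_y f y \is a fin_num by rewrite ge0_fin_numE// lt_neqAle Ifin leey.
rewrite -(fineK IE) -EFinM -[leRHS](heat_cst P Z (t - s)%R _ x).
apply: (le_heat hZ) => //.
- exact: measurable_heat.
- by move=> y; exact: heat_ge0.
- move=> y /=; rewrite EFinM fineK//; apply: heat_le_integral => //; exact: ltW.
Qed.

End density.

End link.

(** * The intrinsic semigroup in unweighted terms *)

Section intrinsic_norm.
Context (R : realType) (n : nat).
Local Notation E := 'rV[R]_n.
Local Notation leb := (@lebesgue_rV R n).
Local Open Scope ereal_scope.

Lemma weighted_norm2E (phi f : E -> R) (N : R) : (0 <= N)%R ->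
  \int[leb]_x (f x ^+ 2 * phi x ^+ 2)%:E = (N * N)%:E ->
  weighted_norm2 phi f = N%:E.
Proof.
move=> N0; rewrite /weighted_norm2 => ->.
by rewrite poweR_EFin powR12_sqrt ?mulr_ge0// -expr2 sqrtr_sqr ger0_norm.
Qed.

Lemma weighted_norm2_fin (phi f : E -> R) : weighted_norm2 phi f < +oo ->
  exists2 N : R, (0 <= N)%R &
    \int[leb]_x (f x ^+ 2 * phi x ^+ 2)%:E = (N * N)%:E.
Proof.
have S0 : 0 <= \int[leb]_x (f x ^+ 2 * phi x ^+ 2)%:E.
  by apply: integral_ge0 => x _; rewrite lee_fin mulr_ge0 ?sqr_ge0.
move=> h; have Soo : \int[leb]_x (f x ^+ 2 * phi x ^+ 2)%:E < +oo.
  by apply: (lty_poweRy (r := 2^-1) _ h); rewrite invr_eq0.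
exists (Num.sqrt (fine (\int[leb]_x (f x ^+ 2 * phi x ^+ 2)%:E))) => //.
by rewrite -expr2 sqr_sqrtr ?fine_ge0// fineK// ge0_fin_numE.
Qed.

Lemma le_Lnorm_pinfty (F : E -> \bar R) (c : \bar R) : 0 <= c ->
  (forall x, `|F x| <= c) -> 'N[leb]_+oo[F] <= c.
Proof.
move=> c0 Fc; rewrite unlock; case: ifP => // _.
by apply/ess_supP; apply: aeW.
Qed.

(** The norm is an essential supremum only if the space has positive measure; otherwise the whole
    space is an admissible exceptional set. *)
Lemma Lnorm_pinfty_ae (F : E -> \bar R) (c : \bar R) :
  'N[leb]_+oo[F] <= c -> {ae leb, forall x, `|F x| <= c}.
Proof.
rewrite unlock; case: ifPn => [_ /ess_supP//|].
rewrite -leNgt measure_le0 => /eqP leb0 _.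
by exists setT; split => //; exact: measurableT.
Qed.

End intrinsic_norm.

Section ground_state_link.
Context (R : realType) (n : nat).
Local Notation E := 'rV[R]_n.
Local Notation leb := (@lebesgue_rV R n).
Context dO (Omega : measurableType dO) (P : probability Omega R)
  (X : R -> {RV P >-> E}).
Hypotheses (lX : levy_process X) (sX : symmetric_process X).
Local Notation Z := (centered X).
Let hZ : levy P Z := centered_levy lX sX.
Variables (V : E -> R) (p : R -> E -> R).
Hypotheses (hV : kato_potential X V) (hVc : confining V).
Hypothesis hp : transition_density X p.
Local Notation a := (V^\+)%R.
Local Notation b := (V^\-)%R.
Variables (lambda : nat -> R) (phi_ : nat -> E -> R).
Hypothesis hphi : eigenbasis X V lambda phi_.
Local Notation phi := (phi_ 0%N).
Local Notation lam := (lambda 0%N).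
Local Notation T := (fk P Z a b).
Local Open Scope ereal_scope.

Let phi0 y : (0 < phi y)%R. Proof. exact: (ground_state_gt0 hphi). Qed.

Let mphi : measurable_fun [set: E] phi.
Proof.
have [/(_ 0%N) h _ _] := eigen_basis hphi.
by move: (sub_Lfun_mfun h); rewrite inE.
Qed.

Let cphi : continuous phi. Proof. exact: (eigen_continuous hphi). Qed.

(** A real-valued integral is 0 by default when the extended one is infinite, which the
    normalization to 1 excludes. *)
Let phi_L2 : \int[leb]_x (phi x * phi x)%:E < +oo.
Proof.
have [_ /(_ 0%N 0%N) h _] := eigen_basis hphi.
move: h; rewrite /l2dot eqxx /Rintegral => h.
rewrite ltey; apply/eqP => Soo; move: h; rewrite Soo /= => /eqP.
by rewrite eq_sym oner_eq0.
Qed.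

Let phi_bounded : exists K : R, forall y, (phi y <= K)%R.
Proof.
have [K hK] := eigen_bounded hphi 0%N.
by exists K => y; apply: le_trans (hK y); exact: ler_norm.
Qed.

Let eigen t : (0 < t)%R ->
  {ae leb, forall x, T t (EFin \o phi) x = (expR (- lam * t) * phi x)%:E}.
Proof.
move=> t0; apply: filterS (eigen_eq hphi 0%N t0) => x.
by rewrite (feynman_kac_fk lX sX hV)// ltW.
Qed.

(** Apply the hypothesis to f = g / phi, whose weighted norm is the norm of g; the factor exp(lambda
    t) of the intrinsic semigroup passes into the constant. *)
Lemma IUC_at_l2_bound t : (0 < t)%R -> IUC_at X V lam phi t ->
  exists2 C : R, (0 <= C)%R & l2_bound P Z a b phi t C.
Proof.
move=> t0 [C C0 hC]; exists (expR (- lam * t) * C)%R.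
  by rewrite mulr_ge0 ?expR_ge0// ltW.
move=> g N mg g0 N0 hN.
pose f x := (g x / phi x)%R.
have mf : measurable_fun [set: E] f.
  apply: measurable_funM => //.
  rewrite (_ : (fun x => _) = (fun x => phi x `^ (- 1))%R); last first.
    by apply/funext => x; rewrite powR_inv1// ltW.
  by apply: (measurableT_comp (measurable_powR _)).
have fphi x : (f x * phi x)%R = g x by rewrite /f divfK// gt_eqF.
have S0 : 0 <= \int[leb]_x (g x * g x)%:E.
  by apply: integral_ge0 => x _; rewrite lee_fin mulr_ge0.
have [M M0 SM] : exists2 M : R, (0 <= M)%R &
    \int[leb]_x (f x ^+ 2 * phi x ^+ 2)%:E = (M * M)%:E.
  under eq_integral do rewrite -exprMn fphi expr2.
  exists (Num.sqrt (fine (\int[leb]_x (g x * g x)%:E))) => //.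
  rewrite -expr2 sqr_sqrtr ?fine_ge0// fineK// ge0_fin_numE//.
  exact: le_lt_trans hN (ltry _).
have MN : (M <= N)%R.
  move: hN; rewrite (_ : \int[leb]_x _ = (M * M)%:E).
    by rewrite lee_fin -!expr2 ler_sqr.
  by rewrite -SM; apply: eq_integral => x _; rewrite -exprMn fphi expr2.
have wM := weighted_norm2E M0 SM.
have := hC f mf; rewrite wM => /(_ (ltry _)).
move/Lnorm_pinfty_ae; apply: filterS => x.
rewrite /intrinsic_sg (_ : (phi \* f)%R = g); last first.
  by apply/funext => y /=; rewrite mulrC fphi.
rewrite (feynman_kac_fk lX sX hV x (ltW t0) mg).
have c0 : (0 < expR (lam * t) / phi x)%R by rewrite divr_gt0// expR_gt0.
move/(le_trans (lee_abs _)) => hx.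
have : (expR (lam * t) / phi x)^-1%:E * ((expR (lam * t) / phi x)%:E * T t (EFin \o g) x)
    <= (expR (lam * t) / phi x)^-1%:E * (C%:E * M%:E).
  by apply: lee_wpmul2l => //; rewrite lee_fin invr_ge0 ltW.
rewrite muleA -EFinM mulVf ?gt_eqF// mul1e => /le_trans; apply.
rewrite -!EFinM lee_fin invf_div mulNr expRN.
have -> : ((expR (lam * t))^-1 * C * N * phi x =
  phi x / expR (lam * t) * (C * N))%R by ring.
apply: ler_wpM2l; first by rewrite divr_ge0 ?expR_ge0// ltW.
by rewrite ler_wpM2l// ltW.
Qed.

Lemma l2_bound_IUC_at t C : (0 < t)%R -> (0 < C)%R ->
  (forall (g : E -> R) (N : R), measurable_fun [set: E] g ->
    (forall x, 0 <= g x)%R -> (0 <= N)%R ->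
    \int[leb]_x (g x * g x)%:E <= (N * N)%:E ->
    forall x, T t (EFin \o g) x <= (C * N * phi x)%:E) ->
  IUC_at X V lam phi t.
Proof.
move=> t0 C0 hC; exists (expR (lam * t) * C)%R; first by rewrite mulr_gt0// expR_gt0.
move=> f mf /weighted_norm2_fin[N N0 SN].
rewrite (weighted_norm2E N0 SN) -EFinM.
apply: le_Lnorm_pinfty => [|x].
  by rewrite lee_fin !mulr_ge0 ?expR_ge0// ltW.
have c0 : (0 < expR (lam * t) / phi x)%R by rewrite divr_gt0// expR_gt0.
have mphif : measurable_fun [set: E] (phi \* f)%R by exact: measurable_funM.
rewrite /intrinsic_sg abseM gee0_abs ?lee_fin; last exact: ltW.
apply: (@le_trans _ _ ((expR (lam * t) / phi x)%:E * (C * N * phi x)%:E)).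
  apply: lee_wpmul2l; first by rewrite lee_fin ltW.
  apply: (le_trans (abse_feynman_kac_le lX sX hV x (ltW t0) mphif)).
  apply: (hC (fun y => `|(phi \* f)%R y|)%R N) => //.
    exact: measurableT_comp.
  rewrite -SN le_eqVlt; apply/orP; left; apply/eqP.
  apply: eq_integral => y _.
  by rewrite -normrM ger0_norm -expr2 ?sqr_ge0// exprMn mulrC.
rewrite -EFinM lee_fin le_eqVlt; apply/orP; left; apply/eqP.
by field; rewrite gt_eqF.
Qed.

Lemma GSD_atP t : (0 <= t)%R -> GSD_at X V phi t <-> exists2 C : R, (0 < C)%R &
  forall x, T t (cst 1) x <= (C * phi x)%:E.
Proof.
by move=> t0; split=> -[C C0 hC]; exists C => // x; have := hC x;
  rewrite (feynman_kac_fk lX sX hV).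
Qed.

Lemma IUC_at_GSD_at t : (0 < t)%R -> IUC_at X V lam phi t ->
  GSD_at X V phi (2 * t).
Proof.
move=> t0 /(IUC_at_l2_bound t0)[C C0 hC]; apply/GSD_atP.
  by rewrite mulr_ge0// ltW.
have [K phiK] := phi_bounded.
exact: (l2_bound_gsd hZ (density_absolutely_continuous lX hp) (pot_ma hV)
  (pot_mb hV) (@pot_a0 _ _ V) (@pot_b0 _ _ V) (pot_small lX sX hV) (pot_coercive hVc)
  (pot_locally_small lX sX hV) mphi phi0 phiK cphi phi_L2 eigen t0 C0 hC).
Qed.

Lemma GSD_at_mono t s : (0 < t)%R -> (t <= s)%R -> GSD_at X V phi t ->
  GSD_at X V phi s.
Proof.
move=> t0 ts /(GSD_atP (ltW t0))[C C0 hC].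
apply/GSD_atP; first exact: le_trans (ltW t0) ts.
have [K phiK] := phi_bounded.
exact: (gsd_mono hZ (density_absolutely_continuous lX hp) (pot_ma hV)
  (pot_mb hV) (@pot_a0 _ _ V) (@pot_b0 _ _ V) (pot_small lX sX hV) mphi phi0
  phiK cphi eigen t0 ts (ltW C0) hC).
Qed.

Lemma GSD_at_IUC_at s t (Cp : R) : (0 < s)%R -> (s <= t)%R -> (0 < Cp)%R ->
  (forall y, (p s y <= Cp)%R) -> GSD_at X V phi t -> IUC_at X V lam phi (2 * t).
Proof.
move=> s0 st Cp0 pC; have t0 := lt_le_trans s0 st.
move=> /(GSD_atP (ltW t0))[C C0 hC].
have [C' C'0 hC'] := gsd_l2_bound hZ (pot_ma hV)
  (pot_mb hV) (@pot_a0 _ _ V) (@pot_b0 _ _ V) (pot_small lX sX hV) phi0 t0 (ltW C0) (ltW Cp0)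
  (fun f x => @heat_le_integral_after _ _ _ _ _ _ lX sX _ hp _ _ _ f x s0 st Cp0 pC) hC.
by apply: (@l2_bound_IUC_at _ C') => //; rewrite mulr_gt0.
Qed.

End ground_state_link.

Theorem theorem2p5 (R : realType) (d : nat) (hd : (0 < d)%N)
    (dO : measure_display) (Omega : measurableType dO)
    (P : probability Omega R) (X : R -> {RV P >-> 'rV[R]_d})
    (p : R -> 'rV[R]_d -> R) (tb : R) (hX : regular_jump_levy X p tb)
    (V : 'rV[R]_d -> R) (hV : kato_potential X V) (hVc : confining V)
    (lambda : nat -> R) (phi : nat -> 'rV[R]_d -> R)
    (hphi : eigenbasis X V lambda phi) :
  [/\ AIUC X V (lambda 0%N) (phi 0%N) <-> AGSD X V (phi 0%N),
      IUC X V (lambda 0%N) (phi 0%N) -> GSD X V (phi 0%N),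
      (forall t0, 0 < t0 ->
         IUC_at X V (lambda 0%N) (phi 0%N) t0 -> GSD_at X V (phi 0%N) (2 * t0)) &
      (forall t0, tb <= t0 ->
         GSD_at X V (phi 0%N) t0 ->
         IUC_at X V (lambda 0%N) (phi 0%N) (2 * t0))]
  /\ ((forall t, 0 < t -> exists C4, forall x, p t x <= C4) ->
      GSD X V (phi 0%N) -> IUC X V (lambda 0%N) (phi 0%N)).
Proof.
have lX := regular_levy hX; have [sX _] := regular_A1 hX.
have [_ hp tb0 [Cb hCb]] := regular_A2 hX.
have half t : 2 * (t / 2) = t :> R by rewrite mulrC divfK.
have iuc_gsd t : 0 < t -> IUC_at X V (lambda 0%N) (phi 0%N) t ->
    GSD_at X V (phi 0%N) (2 * t).
  by move=> t0; exact: (IUC_at_GSD_at lX sX hV hVc hp hphi t0).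
have pCb y : p tb y <= Cb by have /andP[] := hCb y.
have Cb0 : 0 < Cb by have /andP[/lt_le_trans h /h] := hCb 0.
have gsd_iuc t : tb <= t -> GSD_at X V (phi 0%N) t ->
    IUC_at X V (lambda 0%N) (phi 0%N) (2 * t).
  by move=> tbt; exact: (GSD_at_IUC_at lX sX hV hp hphi tb0 tbt Cb0 pCb).
split.
  split => //.
  - split=> -[t t0 ht]; first by exists (2 * t); [rewrite mulr_gt0|exact: iuc_gsd].
    (* The given time may be smaller than [tb]; domination is first carried over to the larger of
       the two. *)
    exists (2 * Num.max t tb); first by rewrite mulr_gt0// lt_max t0.
    apply: gsd_iuc; first by rewrite le_max lexx orbT.
    by apply: (GSD_at_mono lX sX hV hp hphi t0 _ ht); rewrite le_max lexx.
  - move=> iuc t t0; rewrite -(half t); apply: iuc_gsd; first by rewrite divr_gt0.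
    by apply: iuc; rewrite divr_gt0.
move=> hpC gsd t t0; have t20 : 0 < t / 2 by rewrite divr_gt0.
have [C hC] := hpC _ t20.
have C0 : 0 < `|C| + 1 by rewrite ltr_wpDl.
have pC y : p (t / 2) y <= `|C| + 1.
  by rewrite (le_trans (hC y))// (le_trans (ler_norm C))// lerDl.
rewrite -(half t).
(* The density bound at time t / 2 itself replaces the one at [tb], so arbitrarily small times are
   reached. *)
exact: (GSD_at_IUC_at lX sX hV hp hphi t20 (lexx _) C0 pC (gsd _ t20)).
Qed.
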